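(* Consider $W_{n+1}=[V_nW_n+S_n-A_{n+1}]^+$ with $V_n<0$ almost surely, where $S_n$ has, given the state of the background chain, a rational Laplace–Stieltjes transform and $A_{n+1}$ has, given the state of the background chain, an arbitrary distribution (full setting in the context). Put $m:=\sum_{k=1}^{N}m_k$. Then for $\mathrm{Re}(s)\ge 0$, $$\Phi_{W,j}(s)=\frac{\sum_{\omega=0}^{m}c_{\omega,j}s^{\omega}}{\prod_{k=1}^{N}D_{B,k}(s)},\qquad j=1,\dots,N,$$ where $c_{0,j}=\pi_j\prod_{k=1}^{N}D_{B,k}(0)$, and the constants $c_{\omega,j}$, $\omega=1,\dots,m$, $j=1,\dots,N$, are provided by the linear system: for $f=1,\dots,m_k$, $k=1,\dots,N$, $j=1,\dots,N$, with $t=t_{f,k}$, $$\Phi_{A,j}(-t)\sum_{i=1}^{N}p_{i,j}N_{B,i}(t)\prod_{\nu\neq i}D_{B,\nu}(t)\int_{-\infty}^{0}\frac{\sum_{\omega=0}^{m}c_{\omega,i}(ty)^{\omega}}{\prod_{h=1}^{N}D_{B,h}(ty)}\,P(V^-\in dy)=\sum_{\omega=0}^{m}c_{\omega,j}t^{\omega}.$$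
   Context: $\{Z_n\}_{n\ge0}$ is an irreducible, aperiodic discrete-time Markov chain on $\{1,\dots,N\}$ with transition matrix $P=(p_{i,j})$ and stationary distribution $(\pi_1,\dots,\pi_N)^T$. $W_n\ge 0$ satisfies $W_{n+1}=[V_nW_n+S_n-A_{n+1}]^+$, $[x]^+=\max\{x,0\}$. The $V_n$ are i.i.d. and negative almost surely, and $V_n$ is independent of $W_n$, of the background chain and of $(S_n,A_{n+1})$; $V^-$ denotes a generic copy of $V_n$. With $Y_n=S_n-A_{n+1}$, assume $E|V|<\infty$, $E|Y|<\infty$. $S_n,A_{n+1}\ge 0$, and for $x,y\ge0$, $$P(A_{n+1}\le x,S_n\le y,Z_{n+1}=j\mid Z_n=i,\text{past})=p_{i,j}F_{S,i}(y)G_{A,j}(x),$$ with $F_{S,i}$, $G_{A,j}$ distribution functions. There are states $i,l$ with $P(S_n<A_{n+1},Z_{n+1}=l\mid Z_n=i)>0$ (stability). $\Phi_{B,i}(s)=\int_0^\infty e^{-st}dF_{S,i}(t)=N_{B,i}(s)/D_{B,i}(s)$ with $N_{B,i},D_{B,i}$ polynomials and $D_{B,i}(s)=\prod_{f=1}^{m_i}(s-t_{f,i})$, $\mathrm{Re}(t_{f,i})<0$. $\Phi_{A,j}(s)=\int_0^\infty e^{-st}dG_{A,j}(t)$ (not assumed rational). $\Phi_{W,j}(s)=\lim_{n\to\infty}E(e^{-sW_n}1_{\{Z_n=j\}})$, $\mathrm{Re}(s)\ge0$.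
   Formalization: That the linear system determines the constants is claimed only when all poles t_{f,k} are pairwise distinct; with a repeated pole, equations coincide and the system has infinitely many solutions. The formula for the transform and the equations themselves are claimed in all cases. *)

(* Defs.v *)
From HB Require Import structures.
From mathcomp Require Import all_boot all_order all_algebra.
From mathcomp Require Import complex.
From mathcomp Require Import all_classical all_reals all_analysis.

Set Implicit Arguments.
Unset Strict Implicit.
Unset Printing Implicit Defensive.

Import Order.TTheory GRing.Theory Num.Theory.
Import numFieldNormedType.Exports.

Local Open Scope classical_set_scope.
Local Open Scope ring_scope.
Local Open Scope complex_scope.

Section complex_transforms.
Context {R : realType}.

Definition cexp (z : R[i]) : R[i] :=
  (expR (complex.Re z) * cos (complex.Im z)) +i*
  (expR (complex.Re z) * sin (complex.Im z)).

Definition cintegral d (T : measurableType d) (mu : {measure set T -> \bar R})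
    (D : set T) (f : T -> R[i]) : R[i] :=
  (\int[mu]_(x in D) complex.Re (f x)) +i* (\int[mu]_(x in D) complex.Im (f x)).

(* The range [0, +oo[ is closed at 0: an atom of F at 0 is counted. *)
Definition LST (F : cumulative R R) (s : R[i]) : R[i] :=
  cintegral (lebesgue_stieltjes_measure F) `[0, +oo[
    (fun t => cexp (- s * t%:C)).

End complex_transforms.

Section finite_chains.
Context {R : realType} {N : nat}.

Definition transition_matrix (p : 'M[R]_N) :=
  (forall i j, 0 <= p i j) /\ (forall i, \sum_j p i j = 1).

Definition irreducible_chain (p : 'M[R]_N) :=
  forall i j, exists n, 0 < (p ^+ n) i j.

(* For each state i, the gcd of the set of its return times is 1. *)
Definition aperiodic_chain (p : 'M[R]_N) :=
  forall i d, (forall n, (0 < n)%N -> 0 < (p ^+ n) i i -> (d %| n)%N) ->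
    d = 1%N.

Definition stationary_distribution (p : 'M[R]_N) (q : 'rV[R]_N) :=
  [/\ forall i, 0 <= q 0 i, \sum_i q 0 i = 1 & q *m p = q].

End finite_chains.

Section probability_notions.
Context d (T : measurableType d) (R : realType) (P : probability T R).

Definition cond_prob (E F : set T) : R := fine (P (E `&` F)) / fine (P F).

Definition indep_classes (G H : set (set T)) :=
  forall E F, G E -> H F -> P (E `&` F) = (P E * P F)%E.

Definition iid (X : nat -> {RV P >-> R}) :=
  (forall n (B : set R), measurable B -> P (X n @^-1` B) = P (X 0%N @^-1` B)) /\
  (forall (J : seq nat) (B : nat -> set R), uniq J ->
    (forall n, measurable (B n)) ->
    P (\bigcap_(n in [set` J]) (X n @^-1` B n)) =
      (\prod_(n <- J) P (X n @^-1` B n))%E).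

Definition events (X : T -> R) : set (set T) :=
  preimage_set_system setT X measurable.

Definition state_events N (Z : T -> 'I_N) : set (set T) :=
  [set Z @^-1` [set i] | i in setT].

End probability_notions.

Section model.
Context d (T : measurableType d) (R : realType) (P : probability T R) (N : nat).
Variables (Z : nat -> T -> 'I_N) (W V S A : nat -> {RV P >-> R}).

(* Since the interarrival time A_{n+1} is indexed by n+1, only the indices
   1, ..., n of A belong to the past at time n, as against 0, ..., n-1 for S. *)
Definition past (n : nat) : set (set T) :=
  <<s \bigcup_(k in `I_n.+1) (state_events (Z k) `|` events (W k)) `|`
      \bigcup_(k in `I_n) (events (S k) `|` events (A k.+1)) >>.

(* The sigma-algebra, with respect to which V_n is independent, generated
   jointly by W_n, the whole background chain, S_n and A_{n+1}. *)
Definition environment (n : nat) : set (set T) :=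
  <<s \bigcup_k state_events (Z k) `|` events (W n) `|`
      events (S n) `|` events (A n.+1) >>.

(* Conditioning on Z_n = i and on the past is expressed by conditioning on
   H /\ {Z_n = i}, for every past event H meeting {Z_n = i} with positive
   probability. *)
Definition modulated_law (p : 'M[R]_N) (FS GA : 'I_N -> R -> R) :=
  forall n i j (x y : R) (H : set T), 0 <= x -> 0 <= y -> past n H ->
    (0 < P (H `&` [set w | Z n w = i]))%E ->
    cond_prob P [set w | [/\ A n.+1 w <= x, S n w <= y & Z n.+1 w = j]]
                (H `&` [set w | Z n w = i])
    = p i j * FS i y * GA j x.

(* By [modulated_law] the conditional probability does not depend on n as
   long as P (Z_n = i) > 0; otherwise [cond_prob] is 0. *)
Definition stability :=
  exists i l n,
    0 < cond_prob P [set w | S n w < A n.+1 w /\ Z n.+1 w = l]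
                    [set w | Z n w = i].

Definition lst_sequence (j : 'I_N) (s : R[i]) (n : nat) : R[i] :=
  cintegral P setT
    (fun w => cexp (- s * (W n w)%:C) * (if Z n w == j then 1 else 0)).

End model.

Section rational_form.
Context {R : realType} {N : nat}.
Variables (m : 'I_N -> nat) (t : forall i : 'I_N, 'I_(m i) -> R[i]).

Definition denom (i : 'I_N) : {poly R[i]} := \prod_(f < m i) ('X - (t f)%:P).

Definition total_degree : nat := \sum_k m k.

Definition rational_part (c : 'I_total_degree.+1 -> 'I_N -> R[i])
    (j : 'I_N) (s : R[i]) : R[i] :=
  (\sum_(w < total_degree.+1) c w j * s ^+ w) / \prod_k (denom k).[s].

Definition coefficient_system (p : 'M[R]_N) (q : 'rV[R]_N)
    (numer : 'I_N -> {poly R[i]}) (GA : 'I_N -> cumulative R R)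
    (muV : {measure set R -> \bar R})
    (c : 'I_total_degree.+1 -> 'I_N -> R[i]) :=
  (forall j, c ord0 j = (q 0 j)%:C * \prod_k (denom k).[0]) /\
  (forall (k : 'I_N) (f : 'I_(m k)) (j : 'I_N),
    LST (GA j) (- t f) *
      (\sum_i (p i j)%:C * (numer i).[t f] *
         (\prod_(nu | nu != i) (denom nu).[t f]) *
         cintegral muV `]-oo, 0[ (fun y => rational_part c i (t f * y%:C)))
    = \sum_(w < total_degree.+1) c w j * t f ^+ w).

Definition distinct_poles :=
  injective (fun kf : {k : 'I_N & 'I_(m k)} => t (tagged kf)).

End rational_form.

(* Main.v *)
(* Write K for the transition operator of the pair (Z_n, W_n) acting on tuples
   (g_i(w)) of bounded measurable functions. Since V < 0, the event S < A resets
   the waiting time to 0 whatever its value, so some power of K contracts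
   oscillations and K^n g converges uniformly to a constant ell(g); in particular
   Phi_{W,j}(s) = ell(e_{j,s}), where e_{j,s}(i,w) = 1_{i=j} exp(-sw).

   Given the state, X = A - VW >= 0 and the next waiting time is the overshoot
   [S - X]^+. Its transform multiplied by D_{B,i}(s) is, for Re s >= 0, an entire
   function of growth |s|^{m_i}, hence by Liouville a polynomial of degree at most
   m_i, whose value at a pole t_{f,i} is N_{B,i}(t_{f,i}) exp(t_{f,i} X). Lagrange
   interpolation turns this into identities that are linear in the transform and
   can be integrated against any complex measure. For ell = ell o K they give the
   rational form of Phi and the linear system.

   For uniqueness, partial fractions realise the candidate transforms given by
   another solution as those of a tuple rho of complex measures. The linear system
   forces rho o K^n to have these same transforms for every n, while rho o K^n
   tends to a multiple of ell. *)

Require Import Defs.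
From HB Require Import structures.
From mathcomp Require Import all_boot all_order all_algebra.
From mathcomp Require Import complex.
From mathcomp Require Import all_classical all_reals all_analysis.
From mathcomp Require Import qpoly cyclic cyclotomic separable.
From mathcomp Require Import measurable_realfun.
From mathcomp Require Import ring lra zify.
Import ComplexField.Normc.

Set Implicit Arguments.
Unset Strict Implicit.
Unset Printing Implicit Defensive.

Import Order.TTheory GRing.Theory Num.Theory.
Import numFieldNormedType.Exports.

Local Open Scope classical_set_scope.
Local Open Scope ring_scope.
Local Open Scope complex_scope.

(** * Complex numbers and integrals *)

(** The linear system lives at the poles, in the left half-plane, where exp(-sW) need not be
    integrable. Everything is therefore transported to the nodes 0, 1, ..., M of the closed right
    half-plane: a polynomial of degree at most M is fixed by its values there, and its value at a
    pole is a linear combination of them. This is why all states share one denominator, the product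
    of the D_{B,i}, of degree M. The integrals against V raise no such difficulty: for Re t < 0 and
    y < 0 the point ty is in the right half-plane, so the rational functions are integrated only
    where they are genuine transforms. Complex measures enter only through the operations asked of
    them, collected in [regular_functional]: linearity, boundedness, measurability in a parameter,
    exchange with an integral. This class is stable under composition with K and contains ell, as a
    limit of evaluations of K^n. Distinctness of the poles serves twice: it makes the partial
    fractions simple, and the poles together with 0 are then M + 1 different roots. The
    normalisation of c_{0,j} gives rho mass 1, so that the multiple of ell in the limit is ell
    itself. *)

Section complex_numbers.
Context {R : realType}.
Implicit Types (x y z : R[i]) (a b : R).

Lemma ReD x y : complex.Re (x + y) = complex.Re x + complex.Re y.
Proof. by case: x; case: y. Qed.

Lemma ImD x y : complex.Im (x + y) = complex.Im x + complex.Im y.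
Proof. by case: x; case: y. Qed.

Lemma ReM x y : complex.Re (x * y) =
  complex.Re x * complex.Re y - complex.Im x * complex.Im y.
Proof. by case: x; case: y. Qed.

Lemma ImM x y : complex.Im (x * y) =
  complex.Re x * complex.Im y + complex.Im x * complex.Re y.
Proof. by case: x; case: y. Qed.

Lemma ReN x : complex.Re (- x) = - complex.Re x.
Proof. by case: x. Qed.

Lemma ImN x : complex.Im (- x) = - complex.Im x.
Proof. by case: x. Qed.

Lemma Re_sum I (r : seq I) (Q : pred I) (F : I -> R[i]) :
  complex.Re (\sum_(i <- r | Q i) F i) = \sum_(i <- r | Q i) complex.Re (F i).
Proof. by apply: (big_morph (@complex.Re R)) => // x y; exact: ReD. Qed.

Lemma complex_eqP x y :
  complex.Re x = complex.Re y -> complex.Im x = complex.Im y -> x = y.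
Proof. by case: x => a b; case: y => c e /= -> ->. Qed.

Lemma normc_ge0 x : 0 <= normc x.
Proof. by case: x => a b; rewrite sqrtr_ge0. Qed.

Lemma normcE x : normc x = Num.sqrt (complex.Re x ^+ 2 + complex.Im x ^+ 2).
Proof. by case: x. Qed.

Lemma normc_Re x : `|complex.Re x| <= normc x.
Proof.
by rewrite normcE -sqrtr_sqr ler_sqrt ?addr_ge0 ?sqr_ge0// lerDl sqr_ge0.
Qed.

Lemma normc_Im x : `|complex.Im x| <= normc x.
Proof.
by rewrite normcE -sqrtr_sqr ler_sqrt ?addr_ge0 ?sqr_ge0// lerDr sqr_ge0.
Qed.

Lemma normc_le_ReIm x : normc x <= `|complex.Re x| + `|complex.Im x|.
Proof.
rewrite normcE -[leRHS]ger0_norm ?addr_ge0// -sqrtr_sqr ler_sqrt ?sqr_ge0//.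
by rewrite sqrrD !real_normK ?num_real// lerD2r lerDl mulrn_wge0// mulr_ge0.
Qed.

Lemma normcR a : normc a%:C = `|a|.
Proof. by rewrite normcE /= expr0n addr0 sqrtr_sqr. Qed.

Lemma normcX x n : normc (x ^+ n) = normc x ^+ n.
Proof. by elim: n => [|n IH]; rewrite ?expr0 ?normc1// !exprS normcM IH. Qed.

Lemma normcB x y : normc (x - y) <= normc x + normc y.
Proof. by rewrite -(normcN y) le_normcD. Qed.

Lemma normc_sum I (r : seq I) (Q : pred I) (F : I -> R[i]) :
  normc (\sum_(i <- r | Q i) F i) <= \sum_(i <- r | Q i) normc (F i).
Proof.
elim/big_rec2: _ => [|i a y _ h]; first by rewrite normc0.
by rewrite (le_trans (le_normcD _ _))// lerD2l.
Qed.

Lemma normr_normc x : `|x| = (normc x)%:C.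
Proof. by case: x. Qed.

Lemma Re_mul_real z a : complex.Re (z * a%:C) = complex.Re z * a.
Proof. by rewrite ReM /= mulr0 subr0. Qed.

Lemma Im_mul_real z a : complex.Im (z * a%:C) = complex.Im z * a.
Proof. by rewrite ImM /= mulr0 add0r. Qed.

Lemma cexp0 : cexp (0 : R[i]) = 1.
Proof. by rewrite /cexp /= expR0 cos0 sin0 mulr1 mulr0. Qed.

Lemma cexpD x y : cexp (x + y) = cexp x * cexp y.
Proof.
apply: complex_eqP.
  by rewrite ReM /= ReD ImD expRD cosD; ring.
by rewrite ImM /= ReD ImD expRD sinD; ring.
Qed.

Lemma normc_cexp x : normc (cexp x) = expR (complex.Re x).
Proof.
rewrite normcE /= !exprMn -mulrDr cos2Dsin2 mulr1 sqrtr_sqr ger0_norm//.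
Qed.

Lemma normc_cexp_le1 x : complex.Re x <= 0 -> normc (cexp x) <= 1.
Proof. by rewrite normc_cexp -expR0 ler_expR. Qed.

Lemma cvg_complex (u : nat -> R[i]) (l : R[i]) :
  (forall e : R, 0 < e -> exists n0, forall n, (n0 <= n)%N ->
    normc (u n - l) <= e) ->
  (u : nat -> R[i]^o) @ \oo --> (l : R[i]^o).
Proof.
move=> h; apply/cvgrPdist_le => e e0.
have e0' : 0 < complex.Re e by move: e0; rewrite ltcE /= => /andP[_].
have [n0 hn0] := h _ e0'.
near=> n; rewrite distrC normr_normc lecE /=; apply/andP; split.
  by move: e0; rewrite ltcE /= => /andP[].
by apply: hn0; near: n; exists n0.
Unshelve. all: by end_near. Qed.

End complex_numbers.

Section bounded_real_integrals.
Context {R : realType}.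

(** For a finite measure this condition alone provides integrability and Fubini. *)
Definition bounded_measurable d (T : measurableType d) (f : T -> R) :=
  measurable_fun setT f /\ exists M, forall x, `|f x| <= M.

Lemma bounded_measurable_integrable d (T : measurableType d)
    (mu : {finite_measure set T -> \bar R}) (f : T -> R) :
  bounded_measurable f -> mu.-integrable setT (EFin \o f).
Proof.
move=> [mf [M fM]]; apply: measurable_bounded_integrable => //.
  by rewrite ltey_eq fin_num_measure.
exists M; split; first by rewrite num_real.
by move=> x Mx y _; apply: (le_trans (fM y)); exact: ltW.
Qed.

Lemma Rintegral_bound d (T : measurableType d)
    (mu : {finite_measure set T -> \bar R}) (f : T -> R) (M : R) :
  measurable_fun setT f -> (forall x, `|f x| <= M) ->
  `|\int[mu]_x f x| <= M * fine (mu setT).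
Proof.
move=> mf fM; have bf : bounded_measurable f by split => //; exists M.
rewrite (le_trans (le_normr_Rintegral _ _))//.
  exact: bounded_measurable_integrable.
rewrite -Rintegral_cst//; apply: le_Rintegral => //.
  apply: bounded_measurable_integrable; split.
    exact: measurableT_comp.
  by exists M => x; rewrite normr_id.
by apply: bounded_measurable_integrable; split => //; exists `|M|.
Qed.

Lemma bounded_measurable_section d1 d2 (T1 : measurableType d1)
    (T2 : measurableType d2) (f : T1 * T2 -> R) (x : T1) :
  bounded_measurable f -> bounded_measurable (fun y => f (x, y)).
Proof.
move=> [mf [M fM]]; split; last by exists M.
exact: measurableT_comp mf (pair1_measurable x).
Qed.

Lemma bounded_measurable_Rintegral d1 d2 (T1 : measurableType d1)
    (T2 : measurableType d2) (mu : {finite_measure set T2 -> \bar R})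
    (f : T1 * T2 -> R) :
  bounded_measurable f ->
  bounded_measurable (fun x => \int[mu]_y f (x, y)).
Proof.
move=> bf; have [mf [M fM]] := bf; split; last first.
  exists (M * fine (mu setT)) => x; apply: Rintegral_bound => //.
  exact: (bounded_measurable_section x bf).1.
(* Tonelli's measurability statement asks for a nonnegative integrand: f is shifted by its bound M
   and the constant contribution is subtracted afterwards. *)
have mM : measurable_fun setT (fun z => f z + M) by exact: measurable_funD.
have -> : (fun x => \int[mu]_y f (x, y)) =
    (fun x => \int[mu]_y (f (x, y) + M) - M * fine (mu setT)).
  apply/funext => x; rewrite RintegralD ?Rintegral_cst//.
  - by rewrite addrK.
  - by apply: bounded_measurable_integrable; exact: bounded_measurable_section.
  - by apply: bounded_measurable_integrable; split => //; exists `|M|.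
apply: measurable_funB => //.
apply: measurableT_comp => //.
apply: (@measurable_fun_fubini_tonelli_F _ _ _ _ _ mu (fun z => (f z + M)%:E)).
  by apply/measurable_EFinP.
by move=> z; rewrite lee_fin -lerBlDr sub0r; have := fM z; rewrite ler_norml => /andP[].
Qed.

Lemma Rintegral_Fubini d1 d2 (T1 : measurableType d1) (T2 : measurableType d2)
    (mu1 : {finite_measure set T1 -> \bar R})
    (mu2 : {finite_measure set T2 -> \bar R}) (f : T1 * T2 -> R) :
  bounded_measurable f ->
  \int[mu1]_x \int[mu2]_y f (x, y) = \int[mu2]_y \int[mu1]_x f (x, y).
Proof.
move=> bf; have [mf [M fM]] := bf.
have bf' : bounded_measurable (fun z => f (z.2, z.1)).
  split; last by exists M.
  by apply: measurableT_comp mf _; exact: measurable_swap.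
have := @Fubini _ _ T1 T2 R mu1 mu2 (EFin \o f).
rewrite /Rintegral => F; congr fine.
transitivity (\int[mu1]_x \int[mu2]_y (f (x, y))%:E)%E.
  apply: eq_integral => x _; rewrite fineK//.
  apply: (@integrable_fin_num _ _ _ mu2) => //.
  by apply: bounded_measurable_integrable; exact: bounded_measurable_section.
rewrite F; last first.
  apply/integrable12ltyP; first exact/measurable_EFinP.
  apply: (@le_lt_trans _ _ (\int[mu1]_x (M * fine (mu2 setT))%:E)%E); last first.
    by rewrite integral_cst//= -(fineK (fin_num_measure mu1 _ measurableT))// ltry.
  apply: ge0_le_integral => //.
  - by move=> x _; exact: integral_ge0.
  - apply: (@measurable_fun_fubini_tonelli_F _ _ _ _ _ mu2 (fun z => `|(f z)%:E|%E)) => //.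
    by apply: measurableT_comp => //; exact/measurable_EFinP.
  - move=> x _; have M0 : 0 <= M by rewrite (le_trans (normr_ge0 _) (fM (x, point))).
    apply: (@le_trans _ _ (\int[mu2]_y M%:E)%E).
      apply: ge0_le_integral => //.
      + apply: measurableT_comp => //; apply/measurable_EFinP.
        exact: (bounded_measurable_section x bf).1.
      + by move=> y _; rewrite lee_fin.
    by rewrite integral_cst//= EFinM fineK ?fin_num_measure.
apply: eq_integral => y _; rewrite fineK//.
apply: (@integrable_fin_num _ _ _ mu1) => //.
apply: bounded_measurable_integrable.
exact: (@bounded_measurable_section _ _ _ _ (fun z => f (z.2, z.1)) y bf').
Qed.

Lemma Rintegral_cvg d (T : measurableType d)
    (mu : {finite_measure set T -> \bar R}) (f : nat -> T -> R) (g : T -> R)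
    (M : R) :
  (forall n, measurable_fun setT (f n)) -> measurable_fun setT g ->
  (forall n x, `|f n x| <= M) -> (forall x, f n x @[n --> \oo] --> g x) ->
  \int[mu]_x f n x @[n --> \oo] --> \int[mu]_x g x.
Proof.
move=> mf mg fM fg.
have gM x : `|g x| <= M.
  have h : `|f n x| @[n --> \oo] --> `|g x| by apply: cvg_norm; exact: fg.
  rewrite -(cvg_lim _ h)//; apply: limr_le; first by apply/cvg_ex; exists `|g x|.
  by near=> n; exact: fM.
have [|||||_ _ h] := @dominated_convergence _ T R mu setT measurableT
  (fun n => EFin \o f n) (EFin \o g) (cst M%:E).
- by move=> n; exact/measurable_EFinP.
- exact/measurable_EFinP.
- by apply: aeW => x _; apply/cvg_EFin; [near=> n|exact: fg].
- by apply: bounded_measurable_integrable; split => //; exists `|M|.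
- by apply: aeW => x n _; rewrite lee_fin.
- apply: fine_cvg; rewrite fineK; first exact: h.
  apply: (@integrable_fin_num _ _ _ mu) => //.
  by apply: bounded_measurable_integrable; split => //; exists M.
Unshelve. all: by end_near. Qed.

End bounded_real_integrals.

Section complex_integrals.
Context {R : realType}.
Implicit Types d : measure_display.

(** Measurability is asked of the two components, in accordance with [cintegral], which integrates
    them separately. *)
Definition cbounded_measurable d (T : measurableType d) (f : T -> R[i]) :=
  [/\ measurable_fun setT (fun x => complex.Re (f x)),
      measurable_fun setT (fun x => complex.Im (f x)) &
      exists M, forall x, normc (f x) <= M].

Lemma cbounded_measurable_Re d (T : measurableType d) (f : T -> R[i]) :
  cbounded_measurable f -> bounded_measurable (fun x => complex.Re (f x)).
Proof.
by move=> [mr _ [M fM]]; split => //; exists M => x; exact: le_trans (normc_Re _) (fM x).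
Qed.

Lemma cbounded_measurable_Im d (T : measurableType d) (f : T -> R[i]) :
  cbounded_measurable f -> bounded_measurable (fun x => complex.Im (f x)).
Proof.
by move=> [_ mr [M fM]]; split => //; exists M => x; exact: le_trans (normc_Im _) (fM x).
Qed.

Lemma cbounded_measurableP d (T : measurableType d) (f : T -> R[i]) :
  bounded_measurable (fun x => complex.Re (f x)) ->
  bounded_measurable (fun x => complex.Im (f x)) -> cbounded_measurable f.
Proof.
move=> [mr [M fM]] [mi [M' fM']]; split => //; exists (M + M') => x.
by rewrite (le_trans (normc_le_ReIm _))// lerD.
Qed.

Lemma cbounded_measurable_real d (T : measurableType d) (f : T -> R) :
  bounded_measurable f -> cbounded_measurable (fun x => (f x)%:C).
Proof.
move=> bf; apply: cbounded_measurableP => //=.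
by split => //; exists 0 => x; rewrite normr0.
Qed.

Lemma cbounded_measurable_cst d (T : measurableType d) (z : R[i]) :
  cbounded_measurable (fun _ : T => z).
Proof. by split => //; exists (normc z). Qed.

Lemma cbounded_measurableD d (T : measurableType d) (f g : T -> R[i]) :
  cbounded_measurable f -> cbounded_measurable g ->
  cbounded_measurable (fun x => f x + g x).
Proof.
move=> [rf imf [M fM]] [rg img [M' gM']]; split.
- by under eq_fun do rewrite ReD; exact: measurable_funD.
- by under eq_fun do rewrite ImD; exact: measurable_funD.
- by exists (M + M') => x; rewrite (le_trans (le_normcD _ _))// lerD.
Qed.

Lemma cbounded_measurableM d (T : measurableType d) (f g : T -> R[i]) :
  cbounded_measurable f -> cbounded_measurable g ->
  cbounded_measurable (fun x => f x * g x).
Proof.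
move=> [rf imf [M fM]] [rg img [M' gM']]; split.
- under eq_fun do rewrite ReM.
  by apply: measurable_funB; exact: measurable_funM.
- under eq_fun do rewrite ImM.
  by apply: measurable_funD; exact: measurable_funM.
- by exists (M * M') => x; rewrite normcM ler_pM ?normc_ge0.
Qed.

Lemma cbounded_measurable_scale d (T : measurableType d) (z : R[i])
    (f : T -> R[i]) :
  cbounded_measurable f -> cbounded_measurable (fun x => z * f x).
Proof. exact/cbounded_measurableM/cbounded_measurable_cst. Qed.

Lemma cbounded_measurable_sum d (T : measurableType d) I (r : seq I)
    (f : I -> T -> R[i]) :
  (forall i, cbounded_measurable (f i)) ->
  cbounded_measurable (fun x => \sum_(i <- r) f i x).
Proof.
move=> bf; elim: r => [|i r IH].
  by under eq_fun do rewrite big_nil; exact: cbounded_measurable_cst.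
by under eq_fun do rewrite big_cons; exact: cbounded_measurableD.
Qed.

Lemma cbounded_measurable_comp d1 d2 (T1 : measurableType d1)
    (T2 : measurableType d2) (f : T2 -> R[i]) (h : T1 -> T2) :
  cbounded_measurable f -> measurable_fun setT h ->
  cbounded_measurable (fun x => f (h x)).
Proof.
move=> [mr mi [M fM]] mh; split; last by exists M.
- exact: measurableT_comp mr mh.
- exact: measurableT_comp mi mh.
Qed.

Lemma cbounded_measurable_cexp d (T : measurableType d) (h : T -> R[i])
    (B : R) :
  measurable_fun setT (fun x => complex.Re (h x)) ->
  measurable_fun setT (fun x => complex.Im (h x)) ->
  (forall x, complex.Re (h x) <= B) ->
  cbounded_measurable (fun x => cexp (h x)).
Proof.
move=> mr mi hB.
split; last by exists (expR B) => x; rewrite normc_cexp ler_expR.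
- apply: measurable_funM; first exact: measurableT_comp.
  apply: (measurableT_comp _ mi); apply: continuous_measurable_fun.
  exact: continuous_cos.
- apply: measurable_funM; first exact: measurableT_comp.
  apply: (measurableT_comp _ mi); apply: continuous_measurable_fun.
  exact: continuous_sin.
Qed.

Lemma cbounded_measurable_section d1 d2 (T1 : measurableType d1)
    (T2 : measurableType d2) (f : T1 * T2 -> R[i]) (x : T1) :
  cbounded_measurable f -> cbounded_measurable (fun y => f (x, y)).
Proof. by move=> /cbounded_measurable_comp; apply; exact: pair1_measurable. Qed.

Lemma cbounded_measurable_cintegral d1 d2 (T1 : measurableType d1)
    (T2 : measurableType d2) (mu : {finite_measure set T2 -> \bar R})
    (f : T1 * T2 -> R[i]) :
  cbounded_measurable f ->
  cbounded_measurable (fun x => cintegral mu setT (fun y => f (x, y))).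
Proof.
move=> bf; apply: cbounded_measurableP => /=.
- exact: (bounded_measurable_Rintegral _ (cbounded_measurable_Re bf)).
- exact: (bounded_measurable_Rintegral _ (cbounded_measurable_Im bf)).
Qed.

Lemma cintegral_Fubini d1 d2 (T1 : measurableType d1) (T2 : measurableType d2)
    (mu1 : {finite_measure set T1 -> \bar R})
    (mu2 : {finite_measure set T2 -> \bar R}) (f : T1 * T2 -> R[i]) :
  cbounded_measurable f ->
  cintegral mu1 setT (fun x => cintegral mu2 setT (fun y => f (x, y))) =
  cintegral mu2 setT (fun y => cintegral mu1 setT (fun x => f (x, y))).
Proof.
move=> bf; apply: complex_eqP => /=.
- exact: (Rintegral_Fubini _ _ (cbounded_measurable_Re bf)).
- exact: (Rintegral_Fubini _ _ (cbounded_measurable_Im bf)).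
Qed.

Section one_measure.
Context d (T : measurableType d) (mu : {finite_measure set T -> \bar R}).
Implicit Types f g : T -> R[i].

Lemma eq_cintegral (D : set T) f g : (forall x, D x -> f x = g x) ->
  cintegral mu D f = cintegral mu D g.
Proof.
by move=> fg; apply: complex_eqP => /=; apply: eq_Rintegral => x /set_mem Dx;
  rewrite fg.
Qed.

Lemma cintegral_cst (z : R[i]) :
  cintegral mu setT (fun=> z) = z * (fine (mu setT))%:C.
Proof.
apply: complex_eqP => /=; rewrite Rintegral_cst//.
- by rewrite Re_mul_real.
- by rewrite Im_mul_real.
Qed.

Lemma cintegralD f g : cbounded_measurable f -> cbounded_measurable g ->
  cintegral mu setT (fun x => f x + g x) =
  cintegral mu setT f + cintegral mu setT g.
Proof.
move=> bf bg; apply: complex_eqP; rewrite ?ReD ?ImD /= -RintegralD//.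
- by apply: eq_Rintegral => x _; rewrite ReD.
- by apply: bounded_measurable_integrable; exact: cbounded_measurable_Re.
- by apply: bounded_measurable_integrable; exact: cbounded_measurable_Re.
- by apply: eq_Rintegral => x _; rewrite ImD.
- by apply: bounded_measurable_integrable; exact: cbounded_measurable_Im.
- by apply: bounded_measurable_integrable; exact: cbounded_measurable_Im.
Qed.

Lemma cintegralZ (z : R[i]) f : cbounded_measurable f ->
  cintegral mu setT (fun x => z * f x) = z * cintegral mu setT f.
Proof.
move=> bf; have /(bounded_measurable_integrable mu) ir := cbounded_measurable_Re bf.
have /(bounded_measurable_integrable mu) ii := cbounded_measurable_Im bf.
have iZ a (h : T -> R) : mu.-integrable setT (EFin \o h) ->
    mu.-integrable setT (EFin \o (fun x => a * h x)).
  by move=> ih; exact: (integrableZl _ a ih).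
apply: complex_eqP; rewrite ?ReM ?ImM /=.
- rewrite -!RintegralZl// -RintegralB//; [|exact: iZ..].
  by apply: eq_Rintegral => x _; rewrite ReM.
- rewrite -!RintegralZl// -RintegralD//; [|exact: iZ..].
  by apply: eq_Rintegral => x _; rewrite ImM.
Qed.

Lemma cintegral_sum I (r : seq I) (f : I -> T -> R[i]) :
  (forall i, cbounded_measurable (f i)) ->
  cintegral mu setT (fun x => \sum_(i <- r) f i x) =
  \sum_(i <- r) cintegral mu setT (f i).
Proof.
move=> bf; elim: r => [|i r IH].
  rewrite big_nil -[RHS](mul0r (fine (mu setT))%:C) -cintegral_cst.
  by apply: eq_cintegral => x _; rewrite big_nil.
rewrite big_cons -IH -cintegralD//; last exact: cbounded_measurable_sum.
by apply: eq_cintegral => x _; rewrite big_cons.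
Qed.

(** The factor 2 is the cost of estimating real and imaginary parts separately; it is harmless
    wherever only the order of growth matters. *)
Lemma cintegral_bound f (M : R) : cbounded_measurable f ->
  (forall x, normc (f x) <= M) ->
  normc (cintegral mu setT f) <= 2 * M * fine (mu setT).
Proof.
move=> [mr mi _] fM; rewrite (le_trans (normc_le_ReIm _))//= -mulrA mulrDl mul1r.
apply: lerD; apply: Rintegral_bound => // x.
- exact: le_trans (normc_Re _) (fM x).
- exact: le_trans (normc_Im _) (fM x).
Qed.

End one_measure.

End complex_integrals.

(** * Entire functions and Liouville's theorem *)

Section curves.
Context {R : realType}.

Definition curve_derive (f f' : R -> R[i]) := forall y : R,
  is_derive y 1 (fun x => complex.Re (f x)) (complex.Re (f' y)) /\
  is_derive y 1 (fun x => complex.Im (f x)) (complex.Im (f' y)).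

Lemma is_derive_mul (f g : R -> R) (y a b : R) :
  is_derive y 1 f a -> is_derive y 1 g b ->
  is_derive y 1 (fun x => f x * g x) (f y * b + g y * a).
Proof. by move=> df dg; exact: is_deriveM. Qed.

Lemma is_derive_scaled (f : R -> R) (y a k : R) :
  is_derive y 1 f a -> is_derive y 1 (fun x => k * f x) (k * a).
Proof. by move=> df; exact: is_deriveZ. Qed.

Lemma is_derive_dilate (f : R -> R) (y a k : R) :
  is_derive (k * y) 1 f a -> is_derive y 1 (fun x => f (k * x)) (k * a).
Proof.
move=> df; have dk : is_derive y 1 ( *%R k) k.
  by apply: (is_derive_eq (is_deriveZ k (is_derive_id y 1))); exact: mulr1.
by apply: (is_derive_eq (is_derive1_comp df dk)); exact: mulrC.
Qed.

Lemma curve_derive_ext (f g f' g' : R -> R[i]) :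
  f =1 g -> f' =1 g' -> curve_derive f f' -> curve_derive g g'.
Proof. by move=> /funext <- /funext <-. Qed.

Lemma curve_derive_cst (z : R[i]) : curve_derive (fun=> z) (fun=> 0).
Proof. by move=> y; split; exact: is_derive_cst. Qed.

Lemma curve_deriveD (f g f' g' : R -> R[i]) :
  curve_derive f f' -> curve_derive g g' ->
  curve_derive (fun x => f x + g x) (fun x => f' x + g' x).
Proof.
move=> df dg y; have [rf jf] := df y; have [rg jg] := dg y.
rewrite ReD ImD; split.
- by under eq_fun do rewrite ReD; exact: is_deriveD.
- by under eq_fun do rewrite ImD; exact: is_deriveD.
Qed.

Lemma curve_deriveZ (z : R[i]) (f f' : R -> R[i]) :
  curve_derive f f' -> curve_derive (fun x => z * f x) (fun x => z * f' x).
Proof.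
move=> df y; have [rf jf] := df y; rewrite ReM ImM; split.
- under eq_fun do rewrite ReM.
  by apply: is_deriveB; exact: is_derive_scaled.
- under eq_fun do rewrite ImM.
  by apply: is_deriveD; exact: is_derive_scaled.
Qed.

Lemma curve_derive_sum I (r : seq I) (f f' : I -> R -> R[i]) :
  (forall i, curve_derive (f i) (f' i)) ->
  curve_derive (fun x => \sum_(i <- r) f i x) (fun x => \sum_(i <- r) f' i x).
Proof.
move=> df; elim: r => [|i r IH].
  by apply: (curve_derive_ext _ _ (curve_derive_cst 0)) => x; rewrite big_nil.
by apply: (curve_derive_ext _ _ (curve_deriveD (df i) IH)) => x; rewrite big_cons.
Qed.

Lemma is_derive_pow (n : nat) (y : R) :
  is_derive y 1 (fun x => x ^+ n) (n%:R * y ^+ n.-1).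
Proof.
have h := is_deriveX n (is_derive_id y 1); rewrite exprfctE in h.
by apply: (is_derive_eq h); rewrite /GRing.scale /= mulr1.
Qed.

Lemma curve_derive_pow (n : nat) :
  curve_derive (fun x => x%:C ^+ n) (fun x => n%:R * x%:C ^+ n.-1).
Proof.
have E k (x : R) : x%:C ^+ k = (x ^+ k)%:C by rewrite rmorphXn.
apply: (@curve_derive_ext (fun x => (x ^+ n)%:C) _ (fun x => (n%:R * x ^+ n.-1)%:C)).
- by move=> x; rewrite E.
- by move=> x; rewrite E rmorphM rmorph_nat.
by move=> y /=; split; [exact: is_derive_pow|exact: is_derive_cst].
Qed.

Lemma curve_derive_cexp (z : R[i]) :
  curve_derive (fun x => cexp (z * x%:C)) (fun x => z * cexp (z * x%:C)).
Proof.
have dE (a y : R) : is_derive y 1 (fun x => expR (a * x)) (a * expR (a * y)).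
  by apply: is_derive_dilate; exact: is_derive_expR.
have dC (a y : R) : is_derive y 1 (fun x => cos (a * x)) (a * - sin (a * y)).
  by apply: is_derive_dilate; exact: is_derive_cos.
have dS (a y : R) : is_derive y 1 (fun x => sin (a * x)) (a * cos (a * y)).
  by apply: is_derive_dilate; exact: is_derive_sin.
have E (x : R) : z * x%:C = (complex.Re z * x) +i* (complex.Im z * x).
  by apply: complex_eqP; rewrite /= ?Re_mul_real ?Im_mul_real.
apply: (@curve_derive_ext
  (fun x => cexp ((complex.Re z * x) +i* (complex.Im z * x))) _
  (fun x => z * cexp ((complex.Re z * x) +i* (complex.Im z * x)))).
- by move=> x; rewrite E.
- by move=> x; rewrite E.
move=> y; split.
- by apply: (is_derive_eq (is_derive_mul (dE _ y) (dC _ y))); rewrite ReM /=; ring.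
- by apply: (is_derive_eq (is_derive_mul (dE _ y) (dS _ y))); rewrite ImM /=; ring.
Qed.

(** Since |g'| <= h', both h - g and h + g are nondecreasing on [0, Y], and they vanish at 0. *)
Lemma derive_dominated (g h g' h' : R -> R) (Y : R) :
  (forall y : R, is_derive y 1 g (g' y)) -> (forall y : R, is_derive y 1 h (h' y)) ->
  g 0 = 0 -> h 0 = 0 -> (forall y, 0 <= y <= Y -> `|g' y| <= h' y) ->
  forall y, 0 <= y <= Y -> `|g y| <= h y.
Proof.
move=> dg dh g0 h0 gh y /andP[y0 yY].
have aux (k : R -> R) (k' : R -> R) : (forall x : R, is_derive x 1 k (k' x)) ->
    k 0 = 0 -> (forall x, 0 <= x <= Y -> 0 <= k' x) -> 0 <= k y.
  move=> dk k0 k'0; rewrite -k0.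
  apply: (@ger0_derive1_le_cc _ k 0 Y) => //.
  - by move=> x; rewrite in_itv/= => /andP[x0 xY]; rewrite derive1E (@derive_val _ _ _ _ _ _ _ (dk x)) k'0// !ltW.
  - by apply: derivable_within_continuous => x _.
  - by rewrite in_itv/= lexx (le_trans y0).
  - by rewrite in_itv/= y0.
have h1 := aux (h \- g) (fun x => h' x - g' x) (fun x => is_deriveB (dh x) (dg x)).
have h2 := aux (h \+ g) (fun x => h' x + g' x) (fun x => is_deriveD (dh x) (dg x)).
rewrite ler_norml lerNl -subr_ge0 opprK.
rewrite -[X in _ && X]subr_ge0; apply/andP; split.
- apply: h2; first by rewrite /= h0 g0 addr0.
  by move=> x /gh; rewrite ler_norml lerNl -subr_ge0 opprK => /andP[].
- apply: h1; first by rewrite /= h0 g0 subr0.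
  by move=> x /gh; rewrite ler_norml => /andP[_]; rewrite subr_ge0.
Qed.

End curves.

(** * Taylor remainders of the exponential, and Laplace-type integrals as entire functions *)

Section taylor.
Context {R : realType}.
Implicit Types (z s : R[i]) (y Y r e : R).

(** Induction on the order by differentiation: the derivative of the remainder of order k+1 is z
    times the remainder of order k, and the majorant of order k+1 has derivative 2|z| times that of
    order k. The comparison is made on real and imaginary parts separately, and the factor 2 per
    order pays for recombining them. *)
Lemma cexp_taylor_bound z Y (n : nat) y : 0 <= y <= Y ->
  normc (cexp (z * y%:C) - \sum_(k < n) z ^+ k / k`!%:R * y%:C ^+ k) <=
  2 * (expR (normc z * Y) * ((2 * normc z * y) ^+ n / n`!%:R)).
Proof.
move=> yY; have Y0 : 0 <= Y by case/andP: yY => /le_trans; apply.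
pose rem n (x : R) :=
  cexp (z * x%:C) - \sum_(k < n) z ^+ k / k`!%:R * x%:C ^+ k.
pose M n (x : R) := expR (normc z * Y) * ((2 * normc z * x) ^+ n / n`!%:R).
have dR k : curve_derive (rem k.+1) (fun x => z * rem k x).
  have h := curve_deriveD (curve_derive_cexp z)
    (curve_deriveZ (-1) (curve_derive_sum (index_enum 'I_k.+1)
      (fun i => curve_deriveZ (z ^+ i / i`!%:R) (@curve_derive_pow R i)))).
  apply: (curve_derive_ext _ _ h) => x.
    by rewrite mulN1r.
  rewrite mulN1r mulrBr; congr (_ - _).
  rewrite big_ord_recl /= !mul0r mulr0 add0r mulr_sumr; apply: eq_bigr => i _.
  rewrite /bump /= add1n factS natrM exprS.
  by field; rewrite pnatr_eq0 -lt0n fact_gt0 /= -(natrD _ 1) pnatr_eq0.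
have dM k (x : R) : is_derive x 1 (M k.+1) (2 * normc z * M k x).
  have h : is_derive x 1
      (fun x => expR (normc z * Y) * (2 * normc z) ^+ k.+1 / (k.+1)`!%:R * x ^+ k.+1)
      (expR (normc z * Y) * (2 * normc z) ^+ k.+1 / (k.+1)`!%:R *
        (k.+1%:R * x ^+ k)).
    exact/is_derive_scaled/is_derive_pow.
  have -> : M k.+1 = (fun x => expR (normc z * Y) * (2 * normc z) ^+ k.+1 / (k.+1)`!%:R * x ^+ k.+1).
    by apply/funext => x'; rewrite /M [in LHS]exprMn; ring.
  apply: (is_derive_eq h); rewrite /M factS natrM [in RHS]exprMn [in LHS]exprS.
  by field; rewrite pnatr_eq0 -lt0n fact_gt0 /= -(natrD _ 1) pnatr_eq0.
have rem0 k : rem k.+1 0 = 0.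
  rewrite /rem mulr0 cexp0 big_ord_recl /= expr0 fact0 invr1 !mul1r.
  by rewrite big1 ?addr0 ?subrr// => i _; rewrite expr0n /= mulr0.
have M0 k : M k.+1 0 = 0 by rewrite /M mulr0 expr0n /= mul0r mulr0.
have main k : forall x, 0 <= x <= Y ->
    `|complex.Re (rem k x)| <= M k x /\ `|complex.Im (rem k x)| <= M k x.
  elim: k => [|k IH] x xY.
    have b : normc (rem 0%N x) <= M 0%N x.
      rewrite /rem /M big_ord0 subr0 expr0 fact0 invr1 !mulr1 normc_cexp ler_expR.
      rewrite Re_mul_real; case/andP: xY => x0 xY.
      rewrite (le_trans (ler_wpM2r x0 (ler_norm _)))//.
      by rewrite (le_trans (ler_wpM2r x0 (normc_Re _)))// ler_wpM2l// normc_ge0.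
    by split; apply: le_trans b; [exact: normc_Re|exact: normc_Im].
  have key w : 0 <= w <= Y -> normc (z * rem k w) <= 2 * normc z * M k w.
    move=> /IH [h1 h2]; rewrite normcM mulrAC mulrC [2 * _]mulrC.
    rewrite ler_wpM2r ?normc_ge0// (le_trans (normc_le_ReIm _))//.
    by rewrite mulr2n mulrDr mulr1 lerD.
  split.
  - apply: (@derive_dominated _ (fun w => complex.Re (rem k.+1 w)) (M k.+1)
      (fun w => complex.Re (z * rem k w)) (fun w => 2 * normc z * M k w) Y) => //.
    + by move=> w; have [] := dR k w.
    + by rewrite rem0.
    + by move=> w /key; apply: le_trans; exact: normc_Re.
  - apply: (@derive_dominated _ (fun w => complex.Im (rem k.+1 w)) (M k.+1)
      (fun w => complex.Im (z * rem k w)) (fun w => 2 * normc z * M k w) Y) => //.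
    + by move=> w; have [] := dR k w.
    + by rewrite rem0.
    + by move=> w /key; apply: le_trans; exact: normc_Im.
have [h1 h2] := main n y yY.
by rewrite (le_trans (normc_le_ReIm _))// mulr2n mulrDl mul1r lerD.
Qed.

(** Encoded by a power series converging uniformly on each disc, so that the partial sums are
    polynomials to which [cauchy_estimate] applies. *)
Definition entire (f : R[i] -> R[i]) := exists a : nat -> R[i],
  forall r e, 0 <= r -> 0 < e -> exists n0, forall n, (n0 <= n)%N ->
  forall s, normc s <= r -> normc (f s - \sum_(k < n) a k * s ^+ k) <= e.

Lemma entireD f g : entire f -> entire g -> entire (fun s => f s + g s).
Proof.
move=> [a fa] [b gb]; exists (fun k => a k + b k) => r e r0 e0.
have e20 : 0 < e / 2 by rewrite divr_gt0.
have [n1 h1] := fa _ _ r0 e20; have [n2 h2] := gb _ _ r0 e20.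
exists (maxn n1 n2) => n; rewrite geq_max => /andP[n1n n2n] s sr.
have -> : f s + g s - \sum_(k < n) (a k + b k) * s ^+ k =
    (f s - \sum_(k < n) a k * s ^+ k) + (g s - \sum_(k < n) b k * s ^+ k).
  by under eq_bigr do rewrite mulrDl; rewrite big_split /= opprD addrACA.
by rewrite (le_trans (le_normcD _ _))// [e]splitr lerD// ?h1 ?h2.
Qed.

Lemma entireZ (z : R[i]) f : entire f -> entire (fun s => z * f s).
Proof.
move=> [a fa]; exists (fun k => z * a k) => r e r0 e0.
have z0 : 0 < normc z + 1 by rewrite ltr_wpDl ?normc_ge0.
have [n1 h1] := fa _ _ r0 (divr_gt0 e0 z0).
exists n1 => n n1n s sr.
under eq_bigr do rewrite -mulrA.
rewrite -mulr_sumr -mulrBr normcM.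
rewrite (le_trans (ler_wpM2l (normc_ge0 _) (h1 _ n1n _ sr)))//.
rewrite mulrCA -[leRHS]mulr1 ler_wpM2l ?(ltW e0)//.
by rewrite ler_pdivrMr// mul1r lerDl.
Qed.

Lemma entireX f : entire f -> entire (fun s => s * f s).
Proof.
move=> [a fa]; exists (fun k => if k is k'.+1 then a k' else 0) => r e r0 e0.
have z0 : 0 < r + 1 by rewrite ltr_wpDl.
have [n1 h1] := fa _ _ r0 (divr_gt0 e0 z0).
exists n1.+1 => -[//|n] n1n s sr.
rewrite big_ord_recl mul0r add0r /=.
under eq_bigr do rewrite /bump /= add0n exprS mulrCA.
rewrite -mulr_sumr -mulrBr normcM.
rewrite (le_trans (ler_pM (normc_ge0 _) (normc_ge0 _) sr (h1 _ n1n _ sr)))//.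
rewrite mulrCA -[leRHS]mulr1 ler_wpM2l ?(ltW e0)//.
by rewrite ler_pdivrMr// mul1r lerDl.
Qed.

Lemma entire_cst (z : R[i]) : entire (fun=> z).
Proof.
exists (fun k => if k is 0%N then z else 0) => r e r0 e0.
exists 1%N => -[//|n] _ s _; rewrite big_ord_recl /= mulr1 big1 ?addr0 ?subrr.
  by rewrite normc0 ltW.
by move=> i _; rewrite mul0r.
Qed.

Lemma entire_polyM (p : {poly R[i]}) f :
  entire f -> entire (fun s => p.[s] * f s).
Proof.
move=> ef; elim/poly_ind: p => [|p c IH].
  have -> : (fun s => (0 : {poly R[i]}).[s] * f s) = (fun=> 0).
    by apply/funext => s; rewrite horner0 mul0r.
  exact: entire_cst.
have -> : (fun s => (p * 'X + c%:P).[s] * f s) =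
    (fun s => s * (p.[s] * f s) + c * f s).
  by apply/funext => s; rewrite hornerMXaddC; ring.
by apply: entireD; [exact: entireX|exact: entireZ].
Qed.

(** Expanding the exponential under the integral gives the coefficients, the integrals of [theta]
    times y^k / k!. The bound Y on y makes the Taylor remainder uniform in u for |s| <= r. *)
Lemma entire_laplace d (T : measurableType d)
    (mu : {finite_measure set T -> \bar R}) (theta : T -> R[i]) (y : T -> R) Y :
  cbounded_measurable theta -> measurable_fun setT y ->
  (forall u, 0 <= y u <= Y) ->
  entire (fun s => cintegral mu setT (fun u => theta u * cexp (s * (y u)%:C))).
Proof.
move=> bt my yY; have [_ _ [B tB]] := bt.
have B0 : 0 <= B by rewrite (le_trans (normc_ge0 _) (tB point)).
have Y0 : 0 <= Y by have /andP[/le_trans] := yY point; apply.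
have by_ : cbounded_measurable (fun u => (y u)%:C).
  apply: cbounded_measurable_real; split => //; exists Y => u.
  by have /andP[y0 yu] := yY u; rewrite ger0_norm.
have byn k : cbounded_measurable (fun u => (y u)%:C ^+ k).
  elim: k => [|k IH]; first exact: cbounded_measurable_cst.
  by under eq_fun do rewrite exprS; exact: cbounded_measurableM.
have bs s : cbounded_measurable (fun u => cexp (s * (y u)%:C)).
  apply: (@cbounded_measurable_cexp _ _ _ _ (normc s * Y)).
  - by under eq_fun do rewrite Re_mul_real; exact: measurable_funM.
  - by under eq_fun do rewrite Im_mul_real; exact: measurable_funM.
  - move=> u; have /andP[y0 yu] := yY u; rewrite Re_mul_real.
    rewrite (le_trans (ler_wpM2r y0 (le_trans (ler_norm _) (normc_Re s))))//.
    by rewrite ler_wpM2l ?normc_ge0.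
exists (fun k => cintegral mu setT (fun u => theta u * (y u)%:C ^+ k) / k`!%:R).
move=> r e r0 e0.
set C := 2 * (B * (2 * expR (r * Y))) * fine (mu setT).
have C0 : 0 <= C by rewrite !mulr_ge0 ?expR_ge0 ?fine_ge0.
(* The error is at most C (2rY)^n / n!, and the terms of the exponential series tend to 0; C + 1
   keeps the denominator positive even when C = 0. *)
have /cvgrPdist_le/(_ (e / (C + 1))) := cvg_exp_coeff (2 * r * Y).
have eC : 0 < e / (C + 1) by rewrite divr_gt0// ltr_wpDl.
move=> /(_ eC)[n1 _ h1]; exists n1 => n n1n s sr.
have bterm k : cbounded_measurable
    (fun u => s ^+ k / k`!%:R * (y u)%:C ^+ k) by exact: cbounded_measurable_scale.
have bsum : cbounded_measurable
    (fun u => cexp (s * (y u)%:C) - \sum_(k < n) s ^+ k / k`!%:R * (y u)%:C ^+ k).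
  apply: cbounded_measurableD => //.
  under eq_fun do rewrite -mulN1r.
  by apply: cbounded_measurable_scale; exact: cbounded_measurable_sum.
have -> : cintegral mu setT (fun u => theta u * cexp (s * (y u)%:C)) -
    \sum_(k < n) cintegral mu setT (fun u => theta u * (y u)%:C ^+ k) / k`!%:R * s ^+ k =
    cintegral mu setT (fun u => theta u * (cexp (s * (y u)%:C) -
      \sum_(k < n) s ^+ k / k`!%:R * (y u)%:C ^+ k)).
  under [RHS]eq_cintegral do rewrite mulrBr mulr_sumr -[X in _ + X]mulN1r.
  rewrite cintegralD//; last 2 first.
  - exact: cbounded_measurableM.
  - apply: cbounded_measurable_scale; apply: cbounded_measurable_sum => k.
    exact: cbounded_measurableM.
  rewrite cintegralZ; last first.
    by apply: cbounded_measurable_sum => k; exact: cbounded_measurableM.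
  rewrite mulN1r cintegral_sum; last by move=> k; exact: cbounded_measurableM.
  congr (_ - _); apply: eq_bigr => k _.
  under [RHS]eq_cintegral do rewrite mulrCA.
  rewrite cintegralZ; first by ring.
  exact: cbounded_measurableM.
have bd u : normc (theta u * (cexp (s * (y u)%:C) -
      \sum_(k < n) s ^+ k / k`!%:R * (y u)%:C ^+ k)) <=
    B * (2 * expR (r * Y)) * (e / (C + 1)).
  rewrite normcM -mulrA ler_pM ?normc_ge0// (le_trans (cexp_taylor_bound _ _ (yY u)))//.
  have /andP[y0 yu] := yY u.
  rewrite -[leRHS]mulrA ler_wpM2l//; apply: ler_pM; first exact: expR_ge0.
  - by rewrite mulr_ge0 ?invr_ge0 ?exprn_ge0 ?mulr_ge0 ?normc_ge0.
  - by rewrite ler_expR ler_wpM2r.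
  have := h1 _ n1n; rewrite sub0r normrN ger0_norm ?exp_coeff_ge0 ?mulr_ge0//.
  apply: le_trans; rewrite /exp_coeff /= ler_wpM2r ?invr_ge0//.
  rewrite lerXn2r ?nnegrE ?mulr_ge0 ?normc_ge0//.
  by rewrite -!mulrA ler_wpM2l// ler_pM ?normc_ge0.
rewrite (le_trans (cintegral_bound _ _ bd))//; first exact: cbounded_measurableM.
have -> : 2 * (B * (2 * expR (r * Y)) * (e / (C + 1))) * fine (mu setT) =
    C * (e / (C + 1)) by rewrite [in RHS]/C; ring.
by rewrite mulrCA -[leRHS]mulr1 ler_wpM2l ?(ltW e0)// ler_pdivrMr ?mul1r ?lerDl// ltr_wpDl.
Qed.

End taylor.

(** * Polynomial growth, Cauchy's estimate and Liouville's theorem *)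

Section growth.
Context {R : realType}.
Implicit Types (p : {poly R[i]}) (B r : R).

Lemma le0_of_bounded_multiples (x B : R) :
  (forall r, 1 <= r -> x * r <= B) -> x <= 0.
Proof.
move=> h; rewrite leNgt; apply/negP => x0.
have B0 : 0 <= B by rewrite (le_trans _ (h 1 (lexx _)))// mulr1 ltW.
have := h (1 + B / x); rewrite lerDl divr_ge0// ?(ltW x0)// => /(_ isT).
by rewrite mulrDr mulr1 mulrCA divff ?gt_eqF// mulr1 gerDr leNgt x0.
Qed.

Lemma normc_eq0_of_bounded_multiples (z : R[i]) B :
  (forall r, 1 <= r -> normc z * r <= B) -> z = 0.
Proof.
move=> /le0_of_bounded_multiples z0; apply: eq0_normc.
by apply/eqP; rewrite eq_le z0 normc_ge0.
Qed.

Lemma poly_growth p (m : nat) : (size p <= m.+1)%N ->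
  exists2 B, 0 <= B & forall s, normc p.[s] <= B * (1 + normc s) ^+ m.
Proof.
move=> sp; exists (\sum_(k < m.+1) normc p`_k).
  by apply: sumr_ge0 => k _; exact: normc_ge0.
move=> s; rewrite (horner_coef_wide s sp) mulr_suml.
rewrite (le_trans (normc_sum _ _ _))//; apply: ler_sum => k _.
rewrite normcM normcX ler_wpM2l ?normc_ge0//.
have s1 : 1 <= 1 + normc s by rewrite lerDl normc_ge0.
rewrite (le_trans (_ : _ <= (1 + normc s) ^+ k))//.
  by rewrite lerXn2r ?nnegrE ?normc_ge0 ?addr_ge0 ?normc_ge0// lerDr.
by rewrite ler_weXn2l// -ltnS.
Qed.

(** Growth along the positive real axis is enough: at degree d > m, division by r^(d-1) would leave
    |p_d| r bounded for r >= 1. This serves for the numerator N of a transform, which is controlled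
    only in the right half-plane. *)
Lemma size_poly_growth p (m : nat) B :
  (forall x : R, 0 <= x -> normc p.[x%:C] <= B * (1 + x) ^+ m) ->
  (size p <= m.+1)%N.
Proof.
move=> pB; rewrite leqNgt; apply/negP => mp.
have [d pd md] : exists2 d, size p = d.+1 & (m < d)%N.
  by exists (size p).-1; case: (size p) mp.
have B0 : 0 <= B.
  have := pB 0 (lexx _); rewrite addr0 expr1n mulr1; apply: le_trans.
  exact: normc_ge0.
have : p`_d = 0; last first.
  move/eqP; have := lead_coef_eq0 p; rewrite lead_coefE pd /= => ->.
  by rewrite -size_poly_eq0 pd.
apply: (@normc_eq0_of_bounded_multiples _
  (B * 2 ^+ m + \sum_(k < d) normc p`_k)) => r r1.
have r0 : 0 <= r by exact: le_trans r1.
have rd0 : 0 < r ^+ d.-1 by rewrite exprn_gt0// (lt_le_trans _ r1).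
have d0 : (0 < d)%N by case: (d) md.
rewrite -(ler_pM2r rd0) -mulrA -exprS prednK//.
have -> : normc p`_d * r ^+ d = normc (p.[r%:C] - \sum_(k < d) p`_k * r%:C ^+ k).
  rewrite horner_coef pd big_ord_recr /= addrAC subrr add0r normcM normcX normcR.
  by rewrite ger0_norm.
rewrite (le_trans (normcB _ _))// mulrDl lerD//.
  rewrite (le_trans (pB _ r0))// -mulrA ler_wpM2l//.
  rewrite (le_trans (_ : _ <= (2 * r) ^+ m))//.
    by rewrite lerXn2r ?nnegrE ?addr_ge0 ?mulr_ge0// mulr2n mulrDl mul1r lerD2r.
  rewrite exprMn ler_wpM2l ?exprn_ge0// ler_weXn2l// -ltnS prednK//.
rewrite (le_trans (normc_sum _ _ _))// mulr_suml; apply: ler_sum => k _.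
rewrite normcM normcX normcR ger0_norm// ler_wpM2l ?normc_ge0//.
by rewrite ler_weXn2l// -ltnS prednK.
Qed.

Lemma complex_prim_root_exists (n : nat) : (n > 0)%N ->
  exists w : R[i], n.-primitive_root w.
Proof.
move=> n0; pose p : {poly R[i]} := 'X^n - 1.
have [rs Dp] := closed_field_poly_normal p.
rewrite (monicP _) ?monicXnsubC// scale1r in Dp.
have rs1 : all n.-unity_root rs by apply/allP=> z; rewrite -root_prod_XsubC -Dp.
have rsn : (n < (size rs).+1)%N.
  by rewrite -(size_prod_XsubC rs id) -Dp size_XnsubC.
have [|w] := hasP (has_prim_root n0 rs1 _ rsn); last by exists w.
by rewrite -separable_prod_XsubC -Dp separable_Xn_sub_1 // pnatr_eq0 -lt0n.
Qed.

(* Cauchy's estimate, by averaging p over the n-th roots of unity. *)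
Lemma cauchy_estimate p (n : nat) r B (k : nat) :
  (size p <= n)%N -> (k < n)%N -> 0 <= r ->
  (forall s, normc s = r -> normc p.[s] <= B) -> normc p`_k * r ^+ k <= B.
Proof.
move=> pn kn r0 pB; have n0 : (0 < n)%N by case: (n) kn.
have [w pw] := complex_prim_root_exists n0.
have w1 : normc w = 1.
  apply/eqP; rewrite -(@pexpr_eq1 _ _ n) ?normc_ge0// -normcX.
  by rewrite (prim_expr_order pw) normc1.
have w0 : w != 0 by apply/eqP => wz; move: w1; rewrite wz normc0 => /esym/eqP; rewrite oner_eq0.
have E : \sum_(l < n) p.[r%:C * w ^+ l] * (w ^- k) ^+ l = n%:R * (p`_k * r%:C ^+ k).
  under eq_bigr do rewrite (horner_coef_wide _ pn) mulr_suml.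
  rewrite exchange_big /= (bigD1 (Ordinal kn)) //= [X in _ + X]big1 ?addr0.
    rewrite -[in RHS](card_ord n) -sumr_const mulr_suml.
    apply: eq_bigr => l _; rewrite mul1r exprMn -mulrA -mulrA; congr (_ * _).
    rewrite -[RHS]mulr1; congr (_ * _).
    by rewrite -exprM mulnC exprM -exprMn divff ?expr1n// expf_neq0.
  move=> j jk; have {}jk : (j : nat) != k by apply: contra jk => /eqP jk; apply/eqP/val_inj.
  (* For j different from k this is an n-th root of unity other than 1, so its powers sum to 0 and
     only the coefficient of index k survives the average. *)
  pose q := w ^+ j / w ^+ k.
  have q1 : q != 1.
    apply: contra jk => /eqP/divr1_eq/eqP.
    by rewrite (eq_prim_root_expr pw) !modn_small.
  have qn : q ^+ n = 1.
    rewrite /q exprMn exprVn -!exprM ![(_ * n)%N]mulnC !exprM.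
    by rewrite (prim_expr_order pw) !expr1n invr1 mulr1.
  under eq_bigr => l _.
    rewrite exprMn -mulrA -mulrA.
    have -> : (w ^+ l) ^+ j * (w ^- k) ^+ l = q ^+ l.
      by rewrite -exprM mulnC exprM -exprMn.
    over.
  rewrite -!mulr_sumr; suff -> : \sum_(l < n) q ^+ l = 0 by rewrite !mulr0.
  have := subrX1 q n; rewrite qn subrr => /esym/eqP.
  by rewrite mulf_eq0 subr_eq0 (negbTE q1) /= => /eqP.
have n0' : (0 : R) < n%:R by rewrite ltr0n.
rewrite -(ler_pM2l n0').
have -> : n%:R * (normc p`_k * r ^+ k) = normc (n%:R * (p`_k * r%:C ^+ k)).
  rewrite !normcM normcX normcR (ger0_norm r0).
  by rewrite -(rmorph_nat (real_complex R)) normcR ger0_norm.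
rewrite -E (le_trans (normc_sum _ _ _))//.
rewrite -[in leRHS](card_ord n) -sumr_const mulr_suml; apply: ler_sum => l _.
rewrite mul1r normcM !normcX normcV normcX w1 !expr1n invr1 expr1n mulr1.
by apply: pB; rewrite normcM normcR ger0_norm// normcX w1 expr1n mulr1.
Qed.

(** The partial sums inherit the growth of f up to an error 1, so Cauchy's estimate bounds |a_k| r
    uniformly in r >= 1 for each k > m. Hence a_k = 0 and the series stops at degree m. *)
Lemma liouville (f : R[i] -> R[i]) (m : nat) B : entire f ->
  (forall s, normc (f s) <= B * (1 + normc s) ^+ m) ->
  exists2 p : {poly R[i]}, (size p <= m.+1)%N & forall s, f s = p.[s].
Proof.
move=> [a fa] fB.
have B0 : 0 <= B.
  have := fB 0; rewrite normc0 addr0 expr1n mulr1; apply: le_trans.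
  exact: normc_ge0.
have a0 k : (m < k)%N -> a k = 0.
  move=> mk; apply: (@normc_eq0_of_bounded_multiples _ (B * 2 ^+ m + 1)) => r r1.
  have r0 : 0 <= r by exact: le_trans r1.
  have [n1 h1] := fa r 1 r0 ltr01.
  pose n := maxn n1 k.+1; have n1n : (n1 <= n)%N by exact: leq_maxl.
  have kn : (k < n)%N by exact: leq_maxr.
  have := @cauchy_estimate (\poly_(j < n) a j) n r (B * (1 + r) ^+ m + 1) k
    (size_poly _ _) kn r0.
  rewrite coef_poly kn => h.
  have {}h : normc (a k) * r ^+ k <= B * (1 + r) ^+ m + 1.
    apply: h => s sr; rewrite horner_poly.
    have -> : \sum_(j < n) a j * s ^+ j = f s - (f s - \sum_(j < n) a j * s ^+ j).
      by rewrite subKr.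
    rewrite (le_trans (normcB _ _))// lerD//; first by rewrite -sr.
    by rewrite h1// sr.
  have rm0 : 0 < r ^+ m by rewrite exprn_gt0// (lt_le_trans _ r1).
  rewrite -(ler_pM2r rm0) -mulrA -exprS.
  rewrite (le_trans (ler_wpM2l (normc_ge0 _) (_ : _ <= r ^+ k)))//.
    by rewrite ler_weXn2l.
  rewrite (le_trans h)// mulrDl mul1r lerD//; last by rewrite exprn_ege1.
  rewrite -mulrA ler_wpM2l// -exprMn lerXn2r ?nnegrE ?addr_ge0 ?mulr_ge0//.
  by rewrite mulr2n mulrDl mul1r lerD2r.
exists (\poly_(k < m.+1) a k); first exact: size_poly.
move=> s; apply/eqP; rewrite -subr_eq0; apply/eqP; apply: eq0_normc.
apply/eqP; rewrite eq_le normc_ge0 andbT; apply/ler_addgt0Pr => e e0.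
rewrite add0r.
have [n1 h1] := fa _ _ (normc_ge0 s) e0.
apply: le_trans (h1 (maxn n1 m.+1) (leq_maxl _ _) s (lexx _)).
rewrite horner_poly (big_ord_widen _ (fun k => a k * s ^+ k) (leq_maxr n1 m.+1)).
rewrite [X in f s - X]big_mkcond /=; rewrite le_eqVlt; apply/orP; left; apply/eqP; congr (normc (_ - _)).
by apply: eq_bigr => k _; case: ltnP => // /a0 ->; rewrite mul0r.
Qed.

End growth.

(** * The transform of an overshoot *)

Section overshoot.
Context {R : realType}.
Implicit Types (mu : probability R R) (D N : {poly R[i]}) (s t z : R[i]).

Lemma fine_probability_setT d (T : measurableType d) (P : probability T R) :
  fine ((P : {finite_measure set T -> \bar R}) setT) = 1.
Proof. by rewrite (_ : _ setT = 1%E) //; exact: probability_setT. Qed.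

Lemma cintegral_prob_cst d (T : measurableType d) (P : probability T R) z :
  cintegral P setT (fun=> z) = z.
Proof. by rewrite cintegral_cst fine_probability_setT mulr1. Qed.

Lemma cintegral_prob_bound d (T : measurableType d) (P : probability T R)
    (f : T -> R[i]) (M : R) :
  cbounded_measurable f -> (forall x, normc (f x) <= M) ->
  normc (cintegral P setT f) <= 2 * M.
Proof.
move=> bf fM; rewrite (le_trans (cintegral_bound _ bf fM))//.
by rewrite fine_probability_setT mulr1.
Qed.

(** The modulus keeps the kernel bounded on the whole line when Re s >= 0; it is exp(-sw) for w >=
    0. *)
Definition exp_kernel s (w : R) : R[i] := cexp (- s * `|w|%:C).

Lemma exp_kernel_bound s w : 0 <= complex.Re s -> normc (exp_kernel s w) <= 1.
Proof.
move=> s0; apply: normc_cexp_le1; rewrite Re_mul_real ReN mulNr oppr_le0.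
by rewrite mulr_ge0.
Qed.

Lemma cbounded_measurable_exp_kernel d (T : measurableType d) s (h : T -> R) :
  0 <= complex.Re s -> measurable_fun setT h ->
  cbounded_measurable (fun x => exp_kernel s (h x)).
Proof.
move=> s0 mh; have mn : measurable_fun setT (fun x => `|h x|).
  exact: measurableT_comp.
apply: (@cbounded_measurable_cexp _ _ _ _ 0).
- by under eq_fun do rewrite Re_mul_real; exact: measurable_funM.
- by under eq_fun do rewrite Im_mul_real; exact: measurable_funM.
- by move=> x; rewrite Re_mul_real ReN mulNr oppr_le0 mulr_ge0.
Qed.

Definition overshoot (x u : R) : R := Num.max (`|u| - x) 0.

Definition overshoot_transform mu s (x : R) : R[i] :=
  cintegral mu setT (fun u => exp_kernel s (overshoot x u)).

Lemma measurable_overshoot d (T : measurableType d) (h k : T -> R) :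
  measurable_fun setT h -> measurable_fun setT k ->
  measurable_fun setT (fun x => overshoot (h x) (k x)).
Proof.
move=> mh mk; apply: measurable_maxr => //; apply: measurable_funB => //.
exact: measurableT_comp.
Qed.

(* Multiplying the transform of the overshoot of x by D gives, on the right
   half-plane, an explicit entire function of polynomial growth. *)
Lemma overshoot_transform_poly mu D N (m : nat) : (size D <= m.+1)%N ->
  (forall s, 0 <= complex.Re s ->
    D.[s] * cintegral mu setT (exp_kernel s) = N.[s]) ->
  forall x, 0 <= x -> exists Q : {poly R[i]}, [/\ (size Q <= m.+1)%N,
    forall s, 0 <= complex.Re s -> Q.[s] = D.[s] * overshoot_transform mu s x &
    forall t, D.[t] = 0 -> Q.[t] = cexp (t * x%:C) * N.[t]].
Proof.
move=> sD DN x x0.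
pose theta (u : R) : R[i] := (if `|u| <= x then 1 else 0 : R)%:C.
pose y (u : R) : R := Num.max (x - `|u|) 0.
have my : measurable_fun setT y.
  by apply: measurable_maxr => //; apply: measurable_funB => //; exact: measurableT_comp.
have yx u : 0 <= y u <= x.
  by rewrite /y le_max lexx orbT ge_max x0 andbT gerBl normr_ge0.
have btheta : cbounded_measurable theta.
  apply: cbounded_measurable_real; split.
    apply: measurable_fun_ifT => //.
    by apply: measurable_fun_ler => //; exact: measurableT_comp.
  by exists 1 => u; case: ifP; rewrite ?normr1 ?normr0.
have theta1 u : normc (theta u) <= 1.
  by rewrite normcR; case: ifP; rewrite ?normr1 ?normr0.
have bexp s : cbounded_measurable (fun u => cexp (s * (y u)%:C)).
  apply: (@cbounded_measurable_cexp _ _ _ _ (normc s * x)).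
  - by under eq_fun do rewrite Re_mul_real; exact: measurable_funM.
  - by under eq_fun do rewrite Im_mul_real; exact: measurable_funM.
  - move=> u; have /andP[y0 yu] := yx u; rewrite Re_mul_real.
    rewrite (le_trans (ler_wpM2r y0 (le_trans (ler_norm _) (normc_Re s))))//.
    by rewrite ler_wpM2l ?normc_ge0.
pose F := cintegral mu setT theta.
pose I s := cintegral mu setT (fun u => theta u * cexp (s * (y u)%:C)).
(* The transform is split at |u| = x. F is the mass where the overshoot is 0; beyond x the kernel is
   exp(sx) exp(-s|u|). Completing this second part to the full transform of u, which D turns into N,
   has to be compensated by the integral I of exp(s(x - |u|)) over |u| <= x. *)
pose G s := D.[s] * F + N.[s] * cexp (s * x%:C) + -1 * (D.[s] * I s).
have bek s : 0 <= complex.Re s -> cbounded_measurable (exp_kernel s).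
  by move=> s0; exact: cbounded_measurable_exp_kernel.
have GE s : 0 <= complex.Re s -> G s = D.[s] * overshoot_transform mu s x.
  move=> s0; rewrite /G -DN// -mulrA -mulrDr mulN1r -mulrBr; congr (_ * _).
  rewrite [cintegral _ _ _ * _]mulrC -cintegralZ; last exact: bek.
  rewrite -cintegralD//; last exact/cbounded_measurable_scale/bek.
  rewrite -mulN1r -cintegralZ; last exact: cbounded_measurableM.
  rewrite -cintegralD; last 2 first.
  - by apply: cbounded_measurableD => //; exact/cbounded_measurable_scale/bek.
  - by apply: cbounded_measurable_scale; exact: cbounded_measurableM.
  apply: eq_cintegral => u _; rewrite mulN1r /exp_kernel /theta /y /overshoot.
  have [ux|xu] := leP `|u| x.
    rewrite max_l ?subr_ge0// max_r ?subr_le0// normr0 mulr0 cexp0 -cexpD mul1r.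
    have -> : s * (x - `|u|)%:C = s * x%:C + - s * `|u|%:C.
      by rewrite rmorphB mulrBr mulNr.
    by rewrite addrK.
  rewrite [in RHS]max_l ?subr_ge0 ?(ltW xu)// mul0r subr0 add0r -cexpD.
  rewrite [in RHS](@ger0_norm _ (`|u| - x)) ?subr_ge0 ?(ltW xu)//; congr cexp.
  by rewrite (_ : (`|u| - x)%:C = `|u|%:C - x%:C) ?rmorphB//; ring.
have eG : entire G.
  apply: entireD; last by apply: entireZ; apply: entire_polyM; exact: entire_laplace.
  apply: entireD; first by apply: entire_polyM; exact: entire_cst.
  apply: entire_polyM.
  have := @entire_laplace _ _ _ mu (fun=> 1) (fun=> x) x
    (cbounded_measurable_cst _ _) (measurable_cst _).
  rewrite lexx x0 => /(_ (fun=> isT)).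
  congr entire; apply/funext => s.
  by rewrite -[RHS](cintegral_prob_cst mu); apply: eq_cintegral => u _; rewrite mul1r.
have [BD BD0 DB] := poly_growth sD.
(* N inherits the degree bound of D because |N| <= 2|D| on the positive real axis. *)
have sN : (size N <= m.+1)%N.
  apply: (@size_poly_growth _ _ _ (BD * 2)) => r r0.
  rewrite -DN// normcM mulrAC ler_pM ?normc_ge0//.
    by rewrite (le_trans (DB _))// normcR ger0_norm.
  rewrite -[leRHS]mulr1; apply: cintegral_prob_bound; first exact: bek.
  by move=> u; exact: exp_kernel_bound.
have [BN BN0 NB] := poly_growth sN.
(* For Re s >= 0, [GE] gives |G| <= 2|D|. For Re s < 0 the three terms of G are bounded one by one,
   the exponentials having modulus at most 1 because x and y are nonnegative. *)
have GB s : normc (G s) <= (4 * BD + BN) * (1 + normc s) ^+ m.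
  have X0 : 0 <= (1 + normc s) ^+ m by rewrite exprn_ge0// addr_ge0// normc_ge0.
  have D0 : 0 <= normc D.[s] by exact: normc_ge0.
  have [s0|s0] := leP 0 (complex.Re s).
    rewrite GE// normcM.
    have : normc (overshoot_transform mu s x) <= 2.
      rewrite -[leRHS]mulr1; apply: cintegral_prob_bound.
        apply: cbounded_measurable_exp_kernel => //.
        exact: measurable_overshoot.
      by move=> u; exact: exp_kernel_bound.
    have := DB s; have := normc_ge0 (overshoot_transform mu s x).
    have BNX : 0 <= BN * (1 + normc s) ^+ m by exact: mulr_ge0.
    set a := normc _; set b := normc D.[s]; set X := _ ^+ m => a0 bX a2.
    rewrite mulrDl; apply: (@le_trans _ _ (b * 2)); first exact: ler_wpM2l.
    have b0 : 0 <= b by exact: normc_ge0.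
    rewrite -/X in BNX; lra.
  have cx : normc (cexp (s * x%:C)) <= 1.
    by apply: normc_cexp_le1; rewrite Re_mul_real; exact: mulr_le0_ge0 (ltW s0) x0.
  have F2 : normc F <= 2.
    by rewrite -[leRHS]mulr1; exact: cintegral_prob_bound.
  have I2 : normc (I s) <= 2.
    rewrite -[leRHS]mulr1; apply: cintegral_prob_bound.
      exact: cbounded_measurableM.
    move=> u; rewrite normcM -[leRHS]mulr1 ler_pM ?normc_ge0//.
    have /andP[y0 _] := yx u.
    by apply: normc_cexp_le1; rewrite Re_mul_real; exact: mulr_le0_ge0 (ltW s0) y0.
  rewrite /G mulN1r (le_trans (normcB _ _))//.
  rewrite (le_trans (lerD (le_normcD _ _) (lexx _)))// !normcM.
  have h1 := ler_wpM2l D0 F2; have h2 := ler_wpM2l D0 I2.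
  have h3 := ler_wpM2l (normc_ge0 N.[s]) cx.
  have := DB s; have := NB s; lra.
have [Q sQ GQ] := liouville eG GB.
exists Q; split => //.
- by move=> s s0; rewrite -GQ GE.
(* At a root of D only the term N exp(tx) of G survives. *)
- by move=> t Dt; rewrite -GQ /G Dt !mul0r mulr0 addr0 add0r mulrC.
Qed.

End overshoot.

(** * The transition operator *)

Section transition_operator.
Context {R : realType} {N : nat}.
Variables (p : 'M[R]_N) (mV : probability R R) (mS mA : 'I_N -> probability R R).
Hypothesis p_sum1 : forall i, \sum_j p i j = 1.
Implicit Types (g h : 'I_N -> R -> R[i]) (s z : R[i]).

(* The absolute values make every kernel bounded and change nothing on the
   support of the model, where A, S, W >= 0 > V. *)
Definition next_wait (w v a u : R) : R := overshoot (`|a| + `|v| * `|w|) u.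

Definition transition g : 'I_N -> R -> R[i] := fun i w =>
  \sum_j (p i j)%:C * cintegral mV setT (fun v =>
    cintegral (mA j) setT (fun a =>
      cintegral (mS i) setT (fun u => g j (next_wait w v a u)))).

Definition tuple_bm g := forall i, cbounded_measurable (g i).

(** Measurability is joint in the parameter and the waiting time, as Fubini requires when an
    integral over the parameter passes through K. *)
Definition family_bm d (Y : measurableType d) (G : Y -> 'I_N -> R -> R[i]) :=
  forall i, cbounded_measurable (fun yw : Y * R => G yw.1 i yw.2).

Lemma family_bm_tuple d (Y : measurableType d) (G : Y -> 'I_N -> R -> R[i]) y :
  family_bm G -> tuple_bm (G y).
Proof. by move=> bG i; exact: (cbounded_measurable_section y (bG i)). Qed.

Lemma measurable_next_wait d (X : measurableType d) (w v a u : X -> R) :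
  measurable_fun setT w -> measurable_fun setT v -> measurable_fun setT a ->
  measurable_fun setT u ->
  measurable_fun setT (fun x => next_wait (w x) (v x) (a x) (u x)).
Proof.
move=> mw mv ma mu; apply: measurable_overshoot => //.
apply: measurable_funD; first exact: measurableT_comp.
by apply: measurable_funM; exact: measurableT_comp.
Qed.

(** The coordinates are the parameter, w, v, a and u, in this order, so that u, a and v can be
    integrated out successively from the right. *)
Lemma next_wait_bm4 d (Y : measurableType d) (G : Y -> 'I_N -> R -> R[i]) j :
  family_bm G -> cbounded_measurable
    (fun x : Y * R * R * R * R =>
      G x.1.1.1.1 j (next_wait x.1.1.1.2 x.1.1.2 x.1.2 x.2)).
Proof.
move=> bG.
have m1 : measurable_fun setT (fun x : Y * R * R * R * R => x.1.1.1.1).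
  by do 3 apply: measurableT_comp measurable_fst _; exact: measurable_fst.
have m2 : measurable_fun setT (fun x : Y * R * R * R * R => x.1.1.1.2).
  apply: measurableT_comp measurable_snd _.
  by do 2 apply: measurableT_comp measurable_fst _; exact: measurable_fst.
have m3 : measurable_fun setT (fun x : Y * R * R * R * R => x.1.1.2).
  apply: measurableT_comp measurable_snd _.
  by apply: measurableT_comp measurable_fst _; exact: measurable_fst.
have m4 : measurable_fun setT (fun x : Y * R * R * R * R => x.1.2).
  by apply: measurableT_comp measurable_snd _; exact: measurable_fst.
have m5 : measurable_fun setT (fun x : Y * R * R * R * R => x.2).
  exact: measurable_snd.
apply: (@cbounded_measurable_comp _ _ _ _ _ (fun yw : Y * R => G yw.1 j yw.2)
  (fun x : Y * R * R * R * R =>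
     (x.1.1.1.1, next_wait x.1.1.1.2 x.1.1.2 x.1.2 x.2))) => //.
by apply/measurable_fun_pairP; split => //; exact: measurable_next_wait.
Qed.

Lemma family_bm_transition d (Y : measurableType d)
    (G : Y -> 'I_N -> R -> R[i]) :
  family_bm G -> family_bm (fun y => transition (G y)).
Proof.
move=> bG i; apply: cbounded_measurable_sum => j.
apply: cbounded_measurable_scale.
have h := next_wait_bm4 j bG.
have h1 := cbounded_measurable_cintegral (mS i) h.
have h2 := cbounded_measurable_cintegral (mA j) h1.
exact: (cbounded_measurable_cintegral mV h2).
Qed.

Lemma next_wait_bm3 g j w : tuple_bm g -> cbounded_measurable
  (fun x : R * R * R => g j (next_wait w x.1.1 x.1.2 x.2)).
Proof.
move=> bg; apply: (cbounded_measurable_comp (bg j)).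
apply: measurable_next_wait => //.
- by apply: measurableT_comp measurable_fst _; exact: measurable_fst.
- by apply: measurableT_comp measurable_snd _; exact: measurable_fst.
Qed.

Lemma tuple_bm_transition g : tuple_bm g -> tuple_bm (transition g).
Proof.
move=> bg; have bG : family_bm (fun _ : unit => g).
  by move=> i; exact: (cbounded_measurable_comp (bg i) measurable_snd).
exact: (family_bm_tuple tt (family_bm_transition bG)).
Qed.

Lemma transitionD g h i w : tuple_bm g -> tuple_bm h ->
  transition (fun i w => g i w + h i w) i w = transition g i w + transition h i w.
Proof.
move=> bg bh; rewrite /transition -big_split /=; apply: eq_bigr => j _.
have h1 := next_wait_bm3 j w bg; have k1 := next_wait_bm3 j w bh.
have h2 := cbounded_measurable_cintegral (mS i) h1.
have k2 := cbounded_measurable_cintegral (mS i) k1.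
have h3 := cbounded_measurable_cintegral (mA j) h2.
have k3 := cbounded_measurable_cintegral (mA j) k2.
rewrite -mulrDr; congr (_ * _); rewrite -cintegralD//.
apply: eq_cintegral => v _; rewrite -cintegralD; last 2 first.
- exact: (cbounded_measurable_section v h2).
- exact: (cbounded_measurable_section v k2).
apply: eq_cintegral => a _; rewrite -cintegralD//.
- exact: (cbounded_measurable_section (v, a) h1).
- exact: (cbounded_measurable_section (v, a) k1).
Qed.

Lemma transitionZ z g i w : tuple_bm g ->
  transition (fun i w => z * g i w) i w = z * transition g i w.
Proof.
move=> bg; rewrite /transition mulr_sumr; apply: eq_bigr => j _.
have h1 := next_wait_bm3 j w bg.
have h2 := cbounded_measurable_cintegral (mS i) h1.
have h3 := cbounded_measurable_cintegral (mA j) h2.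
rewrite mulrCA; congr (_ * _); rewrite -cintegralZ//.
apply: eq_cintegral => v _; rewrite -cintegralZ; last first.
  exact: (cbounded_measurable_section v h2).
apply: eq_cintegral => a _; rewrite -cintegralZ//.
exact: (cbounded_measurable_section (v, a) h1).
Qed.

Lemma transition_cst z i w : transition (fun _ _ => z) i w = z.
Proof.
rewrite /transition; under eq_bigr => j _.
  under eq_cintegral do under eq_cintegral do rewrite cintegral_prob_cst.
  under eq_cintegral do rewrite cintegral_prob_cst.
  rewrite cintegral_prob_cst; over.
by rewrite -mulr_suml -(rmorph_sum (real_complex R)) p_sum1 mul1r.
Qed.

Lemma transition_state (c : 'I_N -> R[i]) i w :
  transition (fun j _ => c j) i w = \sum_j (p i j)%:C * c j.
Proof.
rewrite /transition; apply: eq_bigr => j _; congr (_ * _).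
under eq_cintegral do under eq_cintegral do rewrite cintegral_prob_cst.
by under eq_cintegral do rewrite cintegral_prob_cst; rewrite cintegral_prob_cst.
Qed.

(** Three uses of Fubini carry the integral over y past those over v, a and u. *)
Lemma transition_Fubini (Q : probability R R) (G : R -> 'I_N -> R -> R[i]) i w :
  family_bm G ->
  transition (fun j w' => cintegral Q setT (fun y => G y j w')) i w =
  cintegral Q setT (fun y => transition (G y) i w).
Proof.
move=> bG; rewrite /transition cintegral_sum; last first.
  move=> j; have := family_bm_transition bG.
  pose c4 := next_wait_bm4 j bG.
  have h1 := cbounded_measurable_cintegral (mS i) c4.
  have h2 := cbounded_measurable_cintegral (mA j) h1.
  have h3 := cbounded_measurable_cintegral mV h2.
  move=> _; apply: cbounded_measurable_scale.
  exact: (cbounded_measurable_comp h3 (pair2_measurable w)).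
apply: eq_bigr => j _.
have c4 : cbounded_measurable (fun x : R * R * R * R =>
    G x.1.1.1 j (next_wait w x.1.1.2 x.1.2 x.2)).
  apply: (@cbounded_measurable_comp _ _ _ _ _
    (fun x : R * R * R * R * R =>
      G x.1.1.1.1 j (next_wait x.1.1.1.2 x.1.1.2 x.1.2 x.2))
    (fun x : R * R * R * R => (x.1.1.1, w, x.1.1.2, x.1.2, x.2)) (next_wait_bm4 j bG)).
  have m1 : measurable_fun setT (fun x : R * R * R * R => x.1.1.1).
    by do 2 apply: measurableT_comp measurable_fst _; exact: measurable_fst.
  have m2 : measurable_fun setT (fun x : R * R * R * R => x.1.1.2).
    apply: measurableT_comp measurable_snd _.
    by apply: measurableT_comp measurable_fst _; exact: measurable_fst.
  have m3 : measurable_fun setT (fun x : R * R * R * R => x.1.2).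
    by apply: measurableT_comp measurable_snd _; exact: measurable_fst.
  have m4 : measurable_fun setT (fun x : R * R * R * R => x.2).
    exact: measurable_snd.
  by do 4 (apply: measurable_fun_pair => //).
have h1 := cbounded_measurable_cintegral (mS i) c4.
have h2 := cbounded_measurable_cintegral (mA j) h1.
have h3 := cbounded_measurable_cintegral mV h2.
rewrite cintegralZ//; congr (_ * _).
rewrite [RHS](cintegral_Fubini _ _ h2).
apply: eq_cintegral => v _.
have b1 : cbounded_measurable (fun x : R * R => cintegral (mS i) setT
    (fun u => G x.1 j (next_wait w v x.2 u))).
  apply: (@cbounded_measurable_comp _ _ _ _ _ _ (fun x : R * R => (x.1, v, x.2)) h1).
  by do 2 (apply: measurable_fun_pair => //).
rewrite [RHS](cintegral_Fubini _ _ b1).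
apply: eq_cintegral => a _.
have b2 : cbounded_measurable (fun x : R * R => G x.1 j (next_wait w v a x.2)).
  apply: (@cbounded_measurable_comp _ _ _ _ _ _ (fun x : R * R => (x.1, v, a, x.2)) c4).
  by do 3 (apply: measurable_fun_pair => //).
by rewrite [RHS](cintegral_Fubini _ _ b2).
Qed.

End transition_operator.

(** * Functionals standing for tuples of complex measures *)

Section functionals.
Context {R : realType} {N : nat}.
Variables (p : 'M[R]_N) (mV : probability R R) (mS mA : 'I_N -> probability R R).
Hypothesis p_ge0 : forall i j, 0 <= p i j.
Hypothesis p_sum1 : forall i, \sum_j p i j = 1.
Implicit Types (g h : 'I_N -> R -> R[i]) (s z : R[i]).
Implicit Types rho : ('I_N -> R -> R[i]) -> R[i].

Local Notation K := (transition p mV mS mA).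

(* Abstract form of the integral against a tuple of complex measures. *)
Record regular_functional rho : Prop := RegularFunctional {
  regularD : forall g h, tuple_bm g -> tuple_bm h ->
    rho (fun i w => g i w + h i w) = rho g + rho h;
  regularZ : forall z g, tuple_bm g -> rho (fun i w => z * g i w) = z * rho g;
  regular_bound : exists2 B, 0 <= B & forall g M, tuple_bm g ->
    (forall i w, normc (g i w) <= M) -> normc (rho g) <= B * M;
  regular_bm : forall G : R -> 'I_N -> R -> R[i], family_bm G ->
    cbounded_measurable (fun y => rho (G y));
  regular_Fubini : forall (Q : probability R R) (G : R -> 'I_N -> R -> R[i]),
    family_bm G -> rho (fun i w => cintegral Q setT (fun y => G y i w)) =
      cintegral Q setT (fun y => rho (G y)) }.

Lemma tuple_bm_cst z : tuple_bm (fun (_ : 'I_N) (_ : R) => z).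
Proof. by move=> i; exact: cbounded_measurable_cst. Qed.

Lemma tuple_bmD g h : tuple_bm g -> tuple_bm h ->
  tuple_bm (fun i w => g i w + h i w).
Proof. by move=> bg bh i; exact: cbounded_measurableD. Qed.

Lemma tuple_bmZ z g : tuple_bm g -> tuple_bm (fun i w => z * g i w).
Proof. by move=> bg i; exact: cbounded_measurable_scale. Qed.

Lemma tuple_bm_sum I (r : seq I) (g : I -> 'I_N -> R -> R[i]) :
  (forall k, tuple_bm (g k)) -> tuple_bm (fun i w => \sum_(k <- r) g k i w).
Proof. by move=> bg i; apply: cbounded_measurable_sum => k; exact: bg. Qed.

Lemma regular0 rho : regular_functional rho -> rho (fun _ _ => 0) = 0.
Proof.
move=> ok; have E := regularZ ok 0 (tuple_bm_cst 0); rewrite [RHS]mul0r in E.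
rewrite -[RHS]E.
by congr rho; apply/funext => i; apply/funext => w; rewrite mul0r.
Qed.

Lemma regular_sum rho I (r : seq I) (g : I -> 'I_N -> R -> R[i]) :
  regular_functional rho -> (forall k, tuple_bm (g k)) ->
  rho (fun i w => \sum_(k <- r) g k i w) = \sum_(k <- r) rho (g k).
Proof.
move=> ok bg; elim: r => [|k r IH].
  rewrite big_nil -[RHS](regular0 ok); congr rho.
  by apply/funext => i; apply/funext => w; rewrite big_nil.
rewrite big_cons -IH -(regularD ok)//; last exact: tuple_bm_sum.
by congr rho; apply/funext => i; apply/funext => w; rewrite big_cons.
Qed.

(** 8 = 2^3, one factor for each of the three complex integrals in K; the sum over j costs nothing
    since the rows of p sum to 1. *)
Lemma transition_bound g (M : R) : tuple_bm g ->
  (forall i w, normc (g i w) <= M) -> forall i w, normc (K g i w) <= 8 * M.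
Proof.
move=> bg gM i w; rewrite (le_trans (normc_sum _ _ _))//.
rewrite (_ : 8 * M = \sum_j p i j * (8 * M)); last first.
  by rewrite -mulr_suml p_sum1 mul1r.
apply: ler_sum => j _; rewrite normcM normcR ger0_norm// ler_wpM2l//.
have h1 := next_wait_bm3 j w bg.
have h2 := cbounded_measurable_cintegral (mS i) h1.
have h3 := cbounded_measurable_cintegral (mA j) h2.
rewrite (_ : 8 * M = 2 * (2 * (2 * M))); last by ring.
apply: cintegral_prob_bound; first exact: h3.
move=> v; apply: cintegral_prob_bound.
  exact: (cbounded_measurable_section v h2).
move=> a; apply: cintegral_prob_bound => //.
exact: (cbounded_measurable_section (v, a) h1).
Qed.

Lemma regular_transition rho :
  regular_functional rho -> regular_functional (fun g => rho (K g)).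
Proof.
move=> ok; split.
- move=> g h bg bh; rewrite -(regularD ok); [|exact: tuple_bm_transition..].
  congr rho; apply/funext => i; apply/funext => w; exact: transitionD.
- move=> z g bg; rewrite -(regularZ ok); last exact: tuple_bm_transition.
  by congr rho; apply/funext => i; apply/funext => w; exact: transitionZ.
- have [B B0 hB] := regular_bound ok; exists (B * 8); first exact: mulr_ge0.
  move=> g M bg gM; rewrite -mulrA; apply: hB; first exact: tuple_bm_transition.
  exact: transition_bound.
- by move=> G bG; apply: (regular_bm ok); exact: family_bm_transition.
- move=> Q G bG; rewrite -(regular_Fubini ok); last exact: family_bm_transition.
  by congr rho; apply/funext => i; apply/funext => w; exact: transition_Fubini.
Qed.

Lemma regular_iter rho n : regular_functional rho ->
  regular_functional (fun g => rho (iter n K g)).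
Proof.
move=> ok; elim: n => [|n IH]//=.
suff -> : (fun g => rho (K (iter n K g))) = (fun g => rho (iter n K (K g))).
  exact: (regular_transition IH).
by apply/funext => g; rewrite -iterS iterSr.
Qed.

Lemma cbounded_measurable_state d (T : measurableType d) (zeta : T -> 'I_N)
    (f : 'I_N -> T -> R[i]) :
  (forall i, measurable [set x | zeta x = i]) ->
  (forall i, cbounded_measurable (f i)) ->
  cbounded_measurable (fun x => f (zeta x) x).
Proof.
move=> mz bf.
have -> : (fun x => f (zeta x) x) =
    (fun x => \sum_i (\1_[set x | zeta x = i] x)%:C * f i x).
  apply/funext => x; rewrite (bigD1 (zeta x))//= big1 ?addr0.
    by rewrite indicE mem_set// mul1r.
  by move=> i iz; rewrite indicE memNset ?mul0r// => /esym/eqP; rewrite (negbTE iz).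
apply: cbounded_measurable_sum => i; apply: cbounded_measurableM => //.
apply: cbounded_measurable_real; split; first exact: measurable_indic.
by exists 1 => x; rewrite indicE; case: (_ \in _); rewrite ?normr1 ?normr0.
Qed.

(** Integration of g along a random point (zeta, omega) with complex weight theta. It produces both
    the initial law of (Z_0, W_0), with weight 1, and the complex exponential densities attached to
    the poles. *)
Lemma regular_atom d (T : measurableType d)
    (mu : {finite_measure set T -> \bar R}) (theta : T -> R[i])
    (zeta : T -> 'I_N) (omega : T -> R) :
  cbounded_measurable theta -> (forall i, measurable [set x | zeta x = i]) ->
  measurable_fun setT omega ->
  regular_functional
    (fun g => cintegral mu setT (fun x => theta x * g (zeta x) (omega x))).
Proof.
move=> bt mz mo.
have bgo g : tuple_bm g -> cbounded_measurable (fun x => g (zeta x) (omega x)).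
  move=> bg; apply: (cbounded_measurable_state (f := fun i x => g i (omega x))) => //.
  by move=> i; exact: cbounded_measurable_comp.
have bG G : family_bm G ->
    cbounded_measurable (fun z : R * T => theta z.2 * G z.1 (zeta z.2) (omega z.2)).
  move=> bG; apply: cbounded_measurableM.
    exact: cbounded_measurable_comp bt measurable_snd.
  apply: (cbounded_measurable_state (zeta := fun z : R * T => zeta z.2)
    (f := fun i (z : R * T) => G z.1 i (omega z.2))).
    by move=> i; have := @measurable_snd _ _ R T measurableT _ (mz i); rewrite setTI.
  move=> i; apply: (@cbounded_measurable_comp _ _ _ _ _ _
    (fun z : R * T => (z.1, omega z.2)) (bG i)).
  apply: measurable_fun_pair => //.
  exact: measurableT_comp mo measurable_snd.
split.
- move=> g h bg bh; rewrite -cintegralD; try by apply: cbounded_measurableM => //; exact: bgo.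
  by apply: eq_cintegral => x _; rewrite mulrDr.
- move=> z g bg; rewrite -cintegralZ; last by apply: cbounded_measurableM => //; exact: bgo.
  by apply: eq_cintegral => x _; rewrite mulrCA.
- have [_ _ [B tB]] := bt.
  have B0 : 0 <= B by exact: le_trans (normc_ge0 _) (tB point).
  exists (2 * B * fine (mu setT)); first by rewrite !mulr_ge0 ?fine_ge0.
  move=> g M bg gM; rewrite -mulrA [_ * M]mulrC mulrA -(mulrA 2).
  apply: cintegral_bound; first by apply: cbounded_measurableM => //; exact: bgo.
  by move=> x; rewrite normcM ler_pM ?normc_ge0.
- move=> G /bG h; exact: (cbounded_measurable_cintegral mu h).
- move=> Q G fG; rewrite (cintegral_Fubini _ _ (bG _ fG)).
  apply: eq_cintegral => x _; rewrite -cintegralZ//=.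
  exact: (cbounded_measurable_comp (fG (zeta x)) (pair2_measurable (omega x))).
Qed.

Lemma regular_lincomb I (r : seq I) (c : I -> R[i])
    (rho : I -> ('I_N -> R -> R[i]) -> R[i]) :
  (forall k, regular_functional (rho k)) ->
  regular_functional (fun g => \sum_(k <- r) c k * rho k g).
Proof.
move=> ok; split.
- move=> g h bg bh; rewrite -big_split /=; apply: eq_bigr => k _.
  by rewrite (regularD (ok k))// mulrDr.
- move=> z g bg; rewrite mulr_sumr; apply: eq_bigr => k _.
  by rewrite (regularZ (ok k))// mulrCA.
- have /choice[B hB] : forall k, exists B, 0 <= B /\ forall g M, tuple_bm g ->
      (forall i w, normc (g i w) <= M) -> normc (rho k g) <= B * M.
    by move=> k; have [B B0 h] := regular_bound (ok k); exists B.
  exists (\sum_(k <- r) normc (c k) * B k).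
    by apply: sumr_ge0 => k _; rewrite mulr_ge0 ?normc_ge0//; have [] := hB k.
  move=> g M bg gM; rewrite (le_trans (normc_sum _ _ _))// mulr_suml.
  apply: ler_sum => k _; rewrite normcM -mulrA ler_wpM2l ?normc_ge0//.
  by have [_] := hB k; apply.
- move=> G bG; apply: cbounded_measurable_sum => k.
  by apply: cbounded_measurable_scale; exact: (regular_bm (ok k)).
- move=> Q G bG; rewrite cintegral_sum; last first.
    by move=> k; apply: cbounded_measurable_scale; exact: (regular_bm (ok k)).
  apply: eq_bigr => k _; rewrite (regular_Fubini (ok k))// cintegralZ//.
  exact: (regular_bm (ok k)).
Qed.

End functionals.

(** * Ergodicity *)

Section primitivity.

(** The least positive difference d of two elements divides every element, since a nonzero remainder
    modulo d would be a smaller difference. So d = 1, and two consecutive elements b and b + 1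
    generate every n >= b^2. *)
Lemma cofinite_semigroup (S : nat -> Prop) :
  S 0%N -> (forall a b, S a -> S b -> S (a + b)%N) ->
  (forall d, (forall n, (0 < n)%N -> S n -> (d %| n)%N) -> d = 1%N) ->
  exists n0, forall n, (n0 <= n)%N -> S n.
Proof.
move=> S0 SD gcd1.
have SM a k : S a -> S (k * a)%N.
  by move=> Sa; elim: k => [|k IH]; rewrite ?mul0n// mulSn; exact: SD.
pose diff d := (0 < d)%N /\ exists b, S b /\ S (b + d)%N.
have [n0 [n00 Sn0]] : exists n, (0 < n)%N /\ S n.
  apply: contrapT => /forallNP h; suff : 2%N = 1%N by [].
  by apply: gcd1 => n n0 Sn; case: (h n).
have ex : exists d, `[< diff d >] by exists n0; apply/asboolP; split => //; exists 0%N.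
case: (ex_minnP ex) => d /asboolP[d0 [b [Sb Sbd]]] dmin.
have d1 : d = 1%N.
  apply: gcd1 => n _ Sn; apply: contrapT => /negP dn.
  have r0 : (0 < n %% d)%N by rewrite lt0n.
  have : (d <= n %% d)%N.
    apply: dmin; apply/asboolP; split => //.
    (* With k = n / d, the elements k(b + d) and n + kb differ by exactly n mod d. *)
    exists (n %/ d * (b + d))%N; split; first exact: SM.
    rewrite (_ : _ + _ = n + n %/ d * b)%N; first by apply: SD => //; exact: SM.
    by rewrite {3}(divn_eq n d); lia.
  by rewrite leqNgt ltn_mod d0.
move: Sbd; rewrite d1 => Sb1.
have [b0|b0] := posnP b.
  exists 0%N => n _; have := SM _ n Sb1; rewrite b0 add0n.
  by rewrite muln1.
exists (b * b)%N => n bn.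
have rb : (n %% b < b)%N by rewrite ltn_mod.
have bq : (b <= n %/ b)%N by rewrite leq_divRL.
(* Here n = qb + r with r < b <= q is rewritten as (q - r) b + r (b + 1). *)
rewrite (_ : n = (n %/ b - n %% b) * b + n %% b * (b + 1))%N.
  by apply: SD; exact: SM.
rewrite {1}(divn_eq n b) mulnBl mulnDr muln1 addnA subnK//.
by rewrite leq_mul2r (leq_trans (ltnW rb) bq) orbT.
Qed.

Context {R : realType} {N : nat}.
Variable p : 'M[R]_N.
Hypothesis p_ge0 : forall i j, 0 <= p i j.

Lemma expmx_succ n i k : (p ^+ n.+1) i k = \sum_j p i j * (p ^+ n) j k.
Proof. by rewrite exprS -[p * _]/(p *m _) mxE. Qed.

Lemma expmx_add a b i k :
  (p ^+ (a + b)) i k = \sum_j (p ^+ a) i j * (p ^+ b) j k.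
Proof. by rewrite exprD -[p ^+ a * _]/(p ^+ a *m _) mxE. Qed.

Lemma expmx_ge0 n i j : 0 <= (p ^+ n) i j.
Proof.
elim: n i j => [|n IH] i j; first by rewrite expr0 mxE ler0n.
by rewrite expmx_succ sumr_ge0// => k _; rewrite mulr_ge0.
Qed.

Lemma expmx_add_ge a b i j k :
  (p ^+ a) i j * (p ^+ b) j k <= (p ^+ (a + b)) i k.
Proof.
rewrite expmx_add (bigD1 j)//= lerDl sumr_ge0// => l _.
by rewrite mulr_ge0 ?expmx_ge0.
Qed.

Lemma expmx_add_gt0 a b i j k :
  0 < (p ^+ a) i j -> 0 < (p ^+ b) j k -> 0 < (p ^+ (a + b)) i k.
Proof. by move=> h1 h2; rewrite (lt_le_trans _ (expmx_add_ge _ _ _ j _))// mulr_gt0. Qed.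

(** Each state reaches k at some time, and the time left until a common n is filled by a loop at k,
    since aperiodicity gives loops of every large length. The minorisation below only has to reach
    one state, hence a single column. *)
Lemma primitive_column (k : 'I_N) :
  irreducible_chain p -> aperiodic_chain p ->
  exists n, forall i, 0 < (p ^+ n) i k.
Proof.
move=> irr aper.
have [n0 hn0] : exists n0, forall n, (n0 <= n)%N -> 0 < (p ^+ n) k k.
  apply: cofinite_semigroup.
  - by rewrite expr0 mxE eqxx ltr01.
  - by move=> a b; exact: expmx_add_gt0.
  - by move=> d h; apply: (aper k) => n n0 Sn; exact: h.
have /choice[f hf] : forall i, exists n, 0 < (p ^+ n) i k by move=> i; exact: irr.
exists (\max_i f i + n0)%N => i.
have fi : (f i <= \max_i f i)%N by exact: leq_bigmax.
rewrite (_ : _ + _ = f i + (\max_i f i - f i + n0))%N; last by rewrite addnA subnKC.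
by apply: (expmx_add_gt0 (hf i)); apply: hn0; exact: leq_addl.
Qed.

End primitivity.

Section ergodicity.
Context {R : realType} {N : nat}.
Variables (p : 'M[R]_N) (mV : probability R R) (mS mA : 'I_N -> probability R R).
Hypothesis p_ge0 : forall i j, 0 <= p i j.
Hypothesis p_sum1 : forall i, \sum_j p i j = 1.
Implicit Types (g h : 'I_N -> R -> R[i]) (z : R[i]).

Local Notation K := (transition p mV mS mA).

Lemma Re_transition g i w : complex.Re (K g i w) =
  \sum_j p i j * \int[mV]_v \int[mA j]_a \int[mS i]_u
    complex.Re (g j (next_wait w v a u)).
Proof.
by rewrite /transition Re_sum; apply: eq_bigr => j _; rewrite ReM /= mul0r subr0.
Qed.

Lemma transition_ge0 g : (forall i w, 0 <= complex.Re (g i w)) ->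
  forall i w, 0 <= complex.Re (K g i w).
Proof.
move=> g0 i w; rewrite Re_transition sumr_ge0// => j _; rewrite mulr_ge0//.
by do 3 (apply: Rintegral_ge0 => ? _).
Qed.

Lemma iter_transition_ge0 n g : (forall i w, 0 <= complex.Re (g i w)) ->
  forall i w, 0 <= complex.Re (iter n K g i w).
Proof. by elim: n => [//|n IH] g0 /=; exact/transition_ge0/IH. Qed.

Lemma tuple_bm_iter n g : tuple_bm g -> tuple_bm (iter n K g).
Proof. by elim: n => [//|n IH] bg /=; exact/tuple_bm_transition/IH. Qed.

Lemma regular_eval i w : regular_functional (fun g : 'I_N -> R -> R[i] => g i w).
Proof.
split=> //.
- exists 1 => // g M bg gM; by rewrite mul1r.
- by move=> G bG; exact: (cbounded_measurable_comp (bG i) (pair2_measurable w)).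
Qed.

Lemma regular_iter_eval n i w :
  regular_functional (fun g => iter n K g i w).
Proof. exact: (regular_iter mV mS mA p_ge0 p_sum1 n (regular_eval i w)). Qed.

Lemma iter_transition_cst n z : iter n K (fun _ _ => z) = (fun _ _ => z).
Proof.
elim: n => [//|n IH] /=; rewrite IH; apply/funext => i; apply/funext => w.
exact: transition_cst.
Qed.

Lemma iter_transition_state n (c : 'I_N -> R[i]) :
  iter n K (fun j _ => c j) = (fun i _ => \sum_j ((p ^+ n) i j)%:C * c j).
Proof.
elim: n => [|n IH].
  apply/funext => i; apply/funext => w /=; rewrite expr0 (bigD1 i)//= big1 ?addr0.
    by rewrite mxE eqxx mul1r.
  by move=> j ji; rewrite mxE eq_sym (negbTE ji) mul0r.
rewrite iterS IH; apply/funext => i; apply/funext => w.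
rewrite transition_state; under eq_bigr do rewrite mulr_sumr.
rewrite exchange_big /=; apply: eq_bigr => j _; rewrite expmx_succ.
rewrite (rmorph_sum (real_complex R)) /= mulr_suml; apply: eq_bigr => k _.
by rewrite rmorphM mulrA.
Qed.

Hypothesis irr : irreducible_chain p.
Hypothesis aper : aperiodic_chain p.
Variables (i0 l0 : 'I_N).
Hypothesis p_i0l0 : 0 < p i0 l0.
Hypothesis idle : 0 < \int[mA l0]_a \int[mS i0]_u
  (if `|u| <= `|a| then 1 else 0 : R).

(** Probability, from state i0, of a step to l0 whose service time does not exceed the interarrival
    time. *)
Let delta := p i0 l0 * \int[mA l0]_a \int[mS i0]_u
  (if `|u| <= `|a| then 1 else 0 : R).

Let delta_gt0 : 0 < delta. Proof. exact: mulr_gt0. Qed.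

Let bm_idle (c : R) : bounded_measurable
  (fun x : R * R => c * (if `|x.2| <= `|x.1| then 1 else 0 : R)).
Proof.
split.
  apply: measurable_funM => //; apply: measurable_fun_ifT => //.
  by apply: measurable_fun_ler; exact: measurableT_comp.
exists `|c| => x; case: ifP => _; rewrite ?mulr1// mulr0 normr0 normr_ge0//.
Qed.

(* If the interarrival time exceeds the service time, the next waiting time is
   0 whatever the current one, since the V_n are negative. *)
Lemma transition_minor g : tuple_bm g ->
  (forall i w, 0 <= complex.Re (g i w)) ->
  forall w, delta * complex.Re (g l0 0) <= complex.Re (K g i0 w).
Proof.
move=> bg g0 w; rewrite Re_transition (bigD1 l0)//= ler_wpDr//.
  rewrite sumr_ge0// => j _; rewrite mulr_ge0//.
  by do 3 (apply: Rintegral_ge0 => ? _).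
rewrite /delta -mulrA ler_wpM2l//.
set c := complex.Re (g l0 0).
have b0 := bm_idle c.
have b1 := bounded_measurable_Rintegral (mS i0) b0.
have h1 := cbounded_measurable_Re (next_wait_bm3 l0 w bg).
have h2 := bounded_measurable_Rintegral (mS i0) h1.
have h3 := bounded_measurable_Rintegral (mA l0) h2.
have -> : (\int[mA l0]_a \int[mS i0]_u (if `|u| <= `|a| then 1 else 0 : R)) * c =
    \int[mV]_v \int[mA l0]_a \int[mS i0]_u (c * (if `|u| <= `|a| then 1 else 0 : R)).
  rewrite Rintegral_cst// fine_probability_setT mulr1 mulrC.
  have b2 := bm_idle 1; have b3 := bounded_measurable_Rintegral (mS i0) b2.
  rewrite -RintegralZl//; last first.
    have := bounded_measurable_integrable (mA l0) b3.
    by under eq_fun do under eq_Rintegral do rewrite mul1r.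
  apply: eq_Rintegral => a _; rewrite -RintegralZl//.
  have := bounded_measurable_integrable (mS i0) (bounded_measurable_section a b2).
  by under eq_fun do rewrite mul1r.
apply: le_Rintegral => //.
- apply: bounded_measurable_integrable.
  by split => //; exists `|\int[mA l0]_a \int[mS i0]_u (c * (if `|u| <= `|a| then 1 else 0 : R))|.
- exact: (bounded_measurable_integrable mV h3).
move=> v _; apply: le_Rintegral => //.
- exact: (bounded_measurable_integrable (mA l0) b1).
- exact: (bounded_measurable_integrable (mA l0) (bounded_measurable_section v h2)).
move=> a _; apply: le_Rintegral => //.
- exact: (bounded_measurable_integrable (mS i0) (bounded_measurable_section a b0)).
- exact: (bounded_measurable_integrable (mS i0) (bounded_measurable_section (v, a) h1)).
move=> u _; case: ifP => [ua|_]; last by rewrite mulr0.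
rewrite mulr1 /next_wait /overshoot max_r// subr_le0 (le_trans ua)//.
by rewrite lerDl mulr_ge0.
Qed.

(** Doeblin's condition. From any state, n steps bring the chain to i0 with probability at least
    eta; one more step then empties the system in state l0 with probability at least delta. *)
Lemma iter_transition_minor : exists n (e : R), 0 < e /\ forall g, tuple_bm g ->
  (forall i w, 0 <= complex.Re (g i w)) ->
  forall i w, e * complex.Re (g l0 0) <= complex.Re (iter n K g i w).
Proof.
have [n hn] := primitive_column p_ge0 i0 irr aper.
have [eta eta0 etaP] : exists2 eta, 0 < eta & forall i, eta <= (p ^+ n) i i0.
  exists ((p ^+ n) [arg min_(k < i0) (p ^+ n) k i0]%O i0); first exact: hn.
  by move=> i; case: arg_minP => // k _; apply.
exists n.+1, (eta * delta); split; first exact: mulr_gt0.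
move=> g bg g0 i w; rewrite iterSr.
set c := complex.Re (g l0 0); have c0 : 0 <= c by exact: g0.
(* K g dominates h in real part, and h depends on the state only, so that K^n h is given by the
   matrix power p^n. *)
pose h : 'I_N -> R[i] := fun j => if j == i0 then (delta * c)%:C else 0.
have bh : tuple_bm (fun j (_ : R) => h j).
  by move=> j; exact: cbounded_measurable_cst.
have bKg := tuple_bm_transition p mV mS mA bg.
have ok := regular_iter_eval n i w.
have : 0 <= complex.Re (iter n K (fun j x => K g j x + -1 * h j) i w).
  apply: iter_transition_ge0 => j x; rewrite mulN1r ReD ReN subr_ge0 /h.
  case: eqP => [->|_] /=; first exact: transition_minor.
  exact: transition_ge0.
rewrite (regularD ok) //; last exact: tuple_bmZ.
rewrite (regularZ ok) // mulN1r ReD ReN subr_ge0; apply: le_trans.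
rewrite iter_transition_state (bigD1 i0)//= big1 ?addr0.
  by rewrite /h eqxx -rmorphM /= -mulrA ler_wpM2r// mulr_ge0// ltW.
by move=> j ji; rewrite /h (negbTE ji) mulr0.
Qed.

Definition iter_between g n (lo hi : R) :=
  forall i w, lo <= complex.Re (iter n K g i w) <= hi.

Lemma Re_iter_affine n g (a b : R) i w : tuple_bm g ->
  complex.Re (iter n K (fun i w => a%:C * g i w + b%:C) i w) =
  a * complex.Re (iter n K g i w) + b.
Proof.
move=> bg; have ok := regular_iter_eval n i w.
rewrite (regularD ok); last 2 first.
- exact: tuple_bmZ.
- exact: tuple_bm_cst.
by rewrite (regularZ ok)// iter_transition_cst ReD ReM /= mul0r subr0.
Qed.

(** K preserves nonnegativity of real parts and fixes constants, so bounds reached at time n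
    persist. *)
Lemma iter_between_add g n k lo hi : tuple_bm g ->
  iter_between g n lo hi -> iter_between g (k + n) lo hi.
Proof.
move=> bg h i w; rewrite iterD.
have bi := tuple_bm_iter n bg.
have h1 : 0 <= complex.Re (iter k K (fun i w => 1%:C * iter n K g i w + (- lo)%:C) i w).
  apply: iter_transition_ge0 => j x; have /andP[] := h j x.
  by rewrite ReD mul1r /= subr_ge0.
have h2 : 0 <= complex.Re (iter k K (fun i w => (-1)%:C * iter n K g i w + hi%:C) i w).
  apply: iter_transition_ge0 => j x; have /andP[_] := h j x.
  by rewrite ReD ReM /= mul0r subr0 mulN1r addrC subr_ge0.
move: h1 h2; rewrite !Re_iter_affine// mul1r subr_ge0 => -> /=.
by rewrite mulN1r addrC subr_ge0.
Qed.

(** Let c be the current value at (l0, 0). The minorisation applied to the differences with lo and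
    with hi raises the lower bound by eps (c - lo) and lowers the upper bound by eps (hi - c). As c
    is the same in both, each block of n steps multiplies the width by 1 - eps. *)
Lemma iter_between_shrink g : tuple_bm g -> forall e : R, 0 < e ->
  exists n lo hi, hi - lo <= e /\ iter_between g n lo hi.
Proof.
move=> bg e e0; have [n [eps [eps0 epsP]]] := iter_transition_minor.
have eps1 : eps <= 1.
  have := epsP (fun _ _ => 1) (tuple_bm_cst 1) (fun _ _ => ler01) i0 0.
  by rewrite iter_transition_cst mulr1.
have [M gM] : exists M, forall i w, normc (g i w) <= M.
  have /choice[B hB] : forall i, exists B, forall w, normc (g i w) <= B.
    by move=> i; have [_ _ [B hB]] := bg i; exists B.
  exists (\sum_i B i) => i w; rewrite (bigD1 i)//= (le_trans (hB i w))// lerDl.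
  by rewrite sumr_ge0// => j _; exact: le_trans (normc_ge0 _) (hB j 0).
have step k : exists lo hi, hi - lo <= (1 - eps) ^+ k * (2 * M) /\
    iter_between g (k * n) lo hi.
  elim: k => [|k [lo [hi [hl hb]]]].
    exists (- M), M; split; first by rewrite opprK expr0 mul1r mulr2n mulrDl mul1r.
    move=> i w; rewrite mul0n /= -ler_norml.
    exact: le_trans (normc_Re _) (gM i w).
  have bi := tuple_bm_iter (k * n) bg.
  pose c := complex.Re (iter (k * n) K g l0 0).
  exists (lo + eps * (c - lo)), (hi - eps * (hi - c)); split.
    rewrite exprS -mulrA (le_trans _ (ler_wpM2l _ hl)) ?subr_ge0//.
    by rewrite le_eqVlt; apply/orP; left; apply/eqP; ring.
  have baff (a b : R) : tuple_bm (fun i w => a%:C * iter (k * n) K g i w + b%:C).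
    by apply: tuple_bmD; [exact: tuple_bmZ|exact: tuple_bm_cst].
  move=> i w; rewrite mulSn iterD; apply/andP; split.
    have := epsP _ (baff 1 (- lo)) _ i w.
    rewrite Re_iter_affine// ReD mul1r /= -/c mul1r => h.
    rewrite addrC -lerBrDr; apply: h.
    by move=> j x; have /andP[] := hb j x; rewrite ReD mul1r /= subr_ge0.
  have := epsP _ (baff (-1) hi) _ i w.
  rewrite Re_iter_affine// ReD ReM /= mul0r subr0 -/c !mulN1r => h.
  have {}h : eps * (hi - c) <= hi - complex.Re (iter n K (iter (k * n) K g) i w).
    rewrite addrC [hi - _]addrC; apply: h => j x; have /andP[_] := hb j x.
    by rewrite ReD ReM /= mul0r subr0 mulN1r addrC subr_ge0.
  by rewrite lerBrDr -lerBrDl.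
have M0 : 0 <= 2 * M by rewrite mulr_ge0// (le_trans (normc_ge0 _) (gM i0 0)).
have cv : (1 - eps) ^+ k * (2 * M) @[k --> \oo] --> (0 : R).
  rewrite -[X in _ --> X](mul0r (2 * M)); apply: cvgMl.
  by apply: cvg_expr; rewrite ger0_norm ?subr_ge0// gtrBl.
have /cvgrPdist_le/(_ e e0)[k0 _ /(_ k0 (leqnn _))] := cv.
rewrite sub0r normrN ger0_norm; last by rewrite mulr_ge0 ?exprn_ge0 ?subr_ge0.
move=> he; have [lo [hi [h1 h2]]] := step k0.
by exists (k0 * n)%N, lo, hi; split => //; exact: le_trans he.
Qed.

Lemma Re_iter_converges g : tuple_bm g -> exists l : R, forall e : R, 0 < e ->
  exists n0, forall n, (n0 <= n)%N -> forall i w,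
    `|complex.Re (iter n K g i w) - l| <= e.
Proof.
(* The limit is the supremum of the lower bounds valid uniformly at some time. An upper bound from
   any other time dominates S, because both bounds persist up to a common later time. *)
move=> bg; pose S := [set lo : R | exists n, forall i w,
  lo <= complex.Re (iter n K g i w)].
have ubS n lo hi : iter_between g n lo hi -> ubound S hi.
  move=> hb lo' [n' hn'].
  have bi := tuple_bm_iter n' bg.
  have h1 : 0 <= complex.Re (iter n K (fun i w => 1%:C * iter n' K g i w + (- lo')%:C) i0 0).
    apply: iter_transition_ge0 => j x.
    by rewrite ReD mul1r /= subr_ge0.
  move: h1; rewrite Re_iter_affine// mul1r subr_ge0 -iterD addnC iterD => h1.
  have /andP[_ h2] := iter_between_add n' bg hb i0 0.
  by apply: le_trans h2; rewrite iterD.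
exists (sup S) => e e0; have [n0 [lo [hi [hl hb]]]] := iter_between_shrink bg e0.
have supS : has_sup S.
  split; last by exists hi; exact: ubS hb.
  by exists lo; exists n0 => i w; have /andP[] := hb i w.
have h1 : lo <= sup S.
  apply: ub_le_sup; first by case: supS.
  by exists n0 => i w; have /andP[] := hb i w.
have h2 : sup S <= hi by apply: ge_sup; [case: supS|exact: ubS hb].
exists n0 => n n0n i w.
have /andP[h3 h4] := iter_between_add (n - n0) bg hb i w.
by move: h3 h4; rewrite subnK// ler_norml => h3 h4; apply/andP; split; lra.
Qed.

Lemma iter_converges g : tuple_bm g -> exists l : R[i], forall e : R, 0 < e ->
  exists n0, forall n, (n0 <= n)%N -> forall i w,
    normc (iter n K g i w - l) <= e.
Proof.
move=> bg; have [lr hr] := Re_iter_converges bg.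
(* Multiplication by -i turns the imaginary part into a real part. *)
have [li hi] := Re_iter_converges (tuple_bmZ (0 -i* 1) bg).
exists (lr +i* li) => e e0; have e20 : 0 < e / 2 by rewrite divr_gt0.
have [n1 h1] := hr _ e20; have [n2 h2] := hi _ e20.
exists (maxn n1 n2) => n; rewrite geq_max => /andP[n1n n2n] i w.
rewrite (le_trans (normc_le_ReIm _))// [e]splitr ReD ImD ReN ImN /= lerD ?h1//.
have := h2 _ n2n i w; rewrite (regularZ (regular_iter_eval n i w))//.
by rewrite ReM /= mul0r mulN1r opprK add0r.
Qed.

End ergodicity.

(** * Interpolation identities *)

Section denominators.
Context {R : realType} {N : nat}.
Variables (m : 'I_N -> nat) (t : forall i : 'I_N, 'I_(m i) -> R[i]).
Hypothesis t_lt0 : forall i (f : 'I_(m i)), complex.Re (t f) < 0.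
Implicit Types (s : R[i]).

Local Notation D := (\prod_k denom t k).
Local Notation M := (total_degree m).

Lemma card_poles : #|{: {k : 'I_N & 'I_(m k)}}| = M.
Proof.
rewrite card_tagged sumnE big_map big_enum /=.
by under eq_bigr do rewrite card_ord; apply: eq_bigl.
Qed.

Lemma denom_monic i : denom t i \is monic.
Proof. exact: monic_prod_XsubC. Qed.

Lemma size_denom i : size (denom t i) = (m i).+1.
Proof.
by rewrite /denom size_prod_XsubC /index_enum -enumT size_enum_ord.
Qed.

Lemma size_prod_denom (Q : pred 'I_N) :
  size (\prod_(k | Q k) denom t k) = (\sum_(k | Q k) m k).+1.
Proof.
suff [] : \prod_(k | Q k) denom t k \is monic /\
    size (\prod_(k | Q k) denom t k) = (\sum_(k | Q k) m k).+1 by [].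
elim/big_rec2: _ => [|k n q _ [mq sq]]; first by rewrite monic1 size_poly1.
split; first by rewrite monicMr// denom_monic.
by rewrite size_monicM ?denom_monic ?monic_neq0// size_denom sq addSn addnS.
Qed.

Lemma denom_neq0 i s : 0 <= complex.Re s -> (denom t i).[s] != 0.
Proof.
move=> s0; rewrite horner_prod; apply/prodf_neq0 => f _.
rewrite hornerXsubC subr_eq0; apply: contraTneq s0 => ->.
by rewrite -ltNge t_lt0.
Qed.

Lemma prod_denom_neq0 s : 0 <= complex.Re s -> D.[s] != 0.
Proof.
by move=> s0; rewrite horner_prod; apply/prodf_neq0 => k _; exact: denom_neq0.
Qed.

Lemma denom_root i (f : 'I_(m i)) : (denom t i).[t f] = 0.
Proof.
by rewrite horner_prod (bigD1 f)//= hornerXsubC subrr mul0r.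
Qed.

(** Lagrange basis at 0, 1, ..., M: distinct points of the closed right half-plane, where all
    transforms are defined. *)
Definition node_basis (k : 'I_M.+1) : {poly R[i]} :=
  tnth (lagrange M.+1 (fun n => n%:R)) k.

Lemma size_node_basis k : (size (node_basis k) <= M.+1)%N.
Proof. by rewrite size_lagrange_//; exact: mulrIn (oner_neq0 _). Qed.

Lemma node_interpolation (q : {poly R[i]}) s : (size q <= M.+1)%N ->
  q.[s] = \sum_(k < M.+1) (node_basis k).[s] * q.[k%:R].
Proof.
move=> sq.
have x_inj : injective (fun n => n%:R : R[i]) by exact: mulrIn (oner_neq0 _).
rewrite {1}(lagrange_gen (ltn0Sn M) x_inj sq) horner_sum.
by apply: eq_bigr => k _; rewrite hornerM hornerC mulrC.
Qed.

End denominators.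

Section transform_identities.
Context {R : realType} {N : nat}.
Variables (p : 'M[R]_N) (mV : probability R R) (mS mA : 'I_N -> probability R R).
Variables (m : 'I_N -> nat) (t : forall i : 'I_N, 'I_(m i) -> R[i]).
Variable numer : 'I_N -> {poly R[i]}.
Hypothesis t_lt0 : forall i (f : 'I_(m i)), complex.Re (t f) < 0.
Hypothesis service_transform : forall i (s : R[i]), 0 <= complex.Re s ->
  cintegral (mS i) setT (exp_kernel s) = (numer i).[s] / (denom t i).[s].
Implicit Types (s z : R[i]) (i j : 'I_N).
Implicit Types rho : ('I_N -> R -> R[i]) -> R[i].

Local Notation K := (transition p mV mS mA).
Local Notation D := (\prod_k denom t k).
Local Notation M := (total_degree m).
Local Notation L := (@node_basis R N m).

Lemma natc_ge0 n : 0 <= complex.Re (n%:R : R[i]).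
Proof. by rewrite -(rmorph_nat (real_complex R)) ler0n. Qed.

(* Clearing the denominators turns the transform into a polynomial of degree at
   most M, determined by its values at the nodes 0, ..., M. *)
Lemma overshoot_interpolation i (x : R) : 0 <= x ->
  (forall s, 0 <= complex.Re s -> D.[s] * overshoot_transform (mS i) s x =
    \sum_(k < M.+1) (L k).[s] * (D.[k%:R] * overshoot_transform (mS i) k%:R x)) /\
  (forall k (f : 'I_(m k)),
    (numer i).[t f] * (\prod_(nu | nu != i) (denom t nu).[t f]) *
      cexp (t f * x%:C) =
    \sum_(k < M.+1) (L k).[t f] *
      (D.[k%:R] * overshoot_transform (mS i) k%:R x)).
Proof.
move=> x0.
have sDi : (size (denom t i) <= (m i).+1)%N by rewrite size_denom.
have tr s : 0 <= complex.Re s ->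
    (denom t i).[s] * cintegral (mS i) setT (exp_kernel s) = (numer i).[s].
  by move=> s0; rewrite service_transform// mulrCA divff ?mulr1// denom_neq0.
have [Q [sQ QE Qt]] := overshoot_transform_poly sDi tr x0.
(* Q clears the denominator of state i alone; the other factors bring it to the denominator D common
   to all states. *)
pose q := Q * \prod_(nu | nu != i) denom t nu.
have sq : (size q <= M.+1)%N.
  rewrite (leq_trans (size_polyMleq _ _))// size_prod_denom addnS /=.
  have -> : M = (m i + \sum_(nu | nu != i) m nu)%N by rewrite /total_degree (bigD1 i).
  by rewrite -addSn leq_add2r.
have qE s : 0 <= complex.Re s -> q.[s] = D.[s] * overshoot_transform (mS i) s x.
  move=> s0; rewrite /q hornerM QE// [in RHS](bigD1 i)//= hornerM.
  by rewrite mulrAC.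
have int s : q.[s] = \sum_(k < M.+1) (L k).[s] *
    (D.[k%:R] * overshoot_transform (mS i) k%:R x).
  rewrite (node_interpolation _ sq); apply: eq_bigr => k _.
  by rewrite qE//; exact: natc_ge0.
split=> [s s0|k f]; first by rewrite -int qE.
rewrite -int /q hornerM horner_prod.
(* At a pole indexed by another state the product over nu <> i has a vanishing factor, so both sides
   are 0. *)
have [ki|ki] := eqVneq k i.
  by subst k; rewrite Qt ?denom_root//; ring.
by rewrite (bigD1 k)//= denom_root mul0r !mulr0 mul0r.
Qed.

(** Mean of X at the quantity A - VW of the overview, given W = w and next state j, with |V| in the
    place of -V. *)
Definition workload_mean j (X : R -> R[i]) (w : R) : R[i] :=
  cintegral mV setT (fun v =>
    cintegral (mA j) setT (fun a => X (`|a| + `|v| * `|w|))).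

Lemma workload_bm2 (X : R -> R[i]) (w : R) : cbounded_measurable X ->
  cbounded_measurable (fun va : R * R => X (`|va.2| + `|va.1| * `|w|)).
Proof.
move=> bX; apply: cbounded_measurable_comp => //.
apply: measurable_funD; first exact: measurableT_comp.
by apply: measurable_funM => //; exact: measurableT_comp.
Qed.

Lemma workload_meanZ j z X w : cbounded_measurable X ->
  workload_mean j (fun x => z * X x) w = z * workload_mean j X w.
Proof.
move=> bX; have h1 := workload_bm2 w bX.
rewrite /workload_mean -cintegralZ; last exact: (cbounded_measurable_cintegral (mA j) h1).
apply: eq_cintegral => v _; rewrite -cintegralZ//.
exact: (cbounded_measurable_section v h1).
Qed.

Lemma workload_mean_sum I (r : seq I) j (X : I -> R -> R[i]) (w : R) :
  (forall k, cbounded_measurable (X k)) ->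
  workload_mean j (fun x => \sum_(k <- r) X k x) w =
  \sum_(k <- r) workload_mean j (X k) w.
Proof.
move=> bX; rewrite /workload_mean -cintegral_sum; last first.
  by move=> k; exact: (cbounded_measurable_cintegral (mA j) (workload_bm2 w (bX k))).
apply: eq_cintegral => v _; rewrite -cintegral_sum//.
by move=> k; exact: (cbounded_measurable_section v (workload_bm2 w (bX k))).
Qed.

Lemma eq_workload_mean j (X Y : R -> R[i]) w :
  (forall x, 0 <= x -> X x = Y x) -> workload_mean j X w = workload_mean j Y w.
Proof.
move=> XY; apply: eq_cintegral => v _; apply: eq_cintegral => a _; apply: XY.
by rewrite addr_ge0// mulr_ge0.
Qed.

Definition state_exp j s : 'I_N -> R -> R[i] :=
  fun i w => if i == j then exp_kernel s w else 0.

Lemma tuple_bm_state_exp j s : 0 <= complex.Re s -> tuple_bm (state_exp j s).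
Proof.
move=> s0 i; rewrite /state_exp; case: eqP => _; last exact: cbounded_measurable_cst.
exact: cbounded_measurable_exp_kernel.
Qed.

Lemma transition_state_exp j s i w :
  K (state_exp j s) i w =
  (p i j)%:C * workload_mean j (overshoot_transform (mS i) s) w.
Proof.
rewrite /transition (bigD1 j)//= big1 ?addr0.
  by rewrite /state_exp eqxx /workload_mean /overshoot_transform /next_wait.
move=> k kj; rewrite /state_exp (negbTE kj).
under eq_cintegral do under eq_cintegral do rewrite cintegral_prob_cst.
by under eq_cintegral do rewrite cintegral_prob_cst; rewrite cintegral_prob_cst mulr0.
Qed.

Lemma cbounded_measurable_overshoot_transform i s : 0 <= complex.Re s ->
  cbounded_measurable (overshoot_transform (mS i) s).
Proof.
move=> s0; have h : cbounded_measurable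
    (fun xu : R * R => exp_kernel s (overshoot xu.1 xu.2)).
  by apply: cbounded_measurable_exp_kernel => //; exact: measurable_overshoot.
exact: (cbounded_measurable_cintegral (mS i) h).
Qed.

(** The exponential of A + |V|w splits into two factors. The first gives the transform of A at -z;
    the second is a kernel in w of parameter -z|v|, from which the integral against V in the linear
    system arises. *)
Lemma workload_mean_exp j z w : complex.Re z <= 0 ->
  workload_mean j (fun x => cexp (z * `|x|%:C)) w =
  cintegral (mA j) setT (exp_kernel (- z)) *
  cintegral mV setT (fun v => exp_kernel (- z * `|v|%:C) w).
Proof.
move=> z0; have nz0 : 0 <= complex.Re (- z) by rewrite ReN oppr_ge0.
rewrite -cintegralZ; last first.
  have h : cbounded_measurable (fun v : R => exp_kernel (- z) (`|v| * `|w|)).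
    apply: cbounded_measurable_exp_kernel => //.
    by apply: measurable_funM => //; exact: measurableT_comp.
  congr (cbounded_measurable _): h; apply/funext => v.
  by rewrite /exp_kernel normrM !normr_id rmorphM /=; congr cexp; ring.
apply: eq_cintegral => v _; rewrite [RHS]mulrC -cintegralZ; last first.
  exact: cbounded_measurable_exp_kernel.
apply: eq_cintegral => a _; rewrite /exp_kernel -cexpD; congr cexp.
rewrite ger0_norm; last by rewrite addr_ge0// mulr_ge0.
by rewrite rmorphD rmorphM /=; ring.
Qed.

(** The identity of [overshoot_interpolation] holds for each value x of the workload with
    coefficients that do not involve x, hence it can be averaged over A and V. *)
Lemma transition_interpolation j s i w : 0 <= complex.Re s ->
  D.[s] * K (state_exp j s) i w =
  \sum_(k < M.+1) (L k).[s] * (D.[k%:R] * K (state_exp j k%:R) i w).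
Proof.
move=> s0; rewrite transition_state_exp mulrCA -workload_meanZ; last first.
  exact: cbounded_measurable_overshoot_transform.
under [RHS]eq_bigr do rewrite transition_state_exp mulrCA [X in _ * X]mulrCA mulrCA.
rewrite -mulr_sumr; congr (_ * _).
have bk (k : 'I_M.+1) : cbounded_measurable
    (fun x => (L k).[s] * (D.[k%:R] * overshoot_transform (mS i) k%:R x)).
  do 2 apply: cbounded_measurable_scale.
  by apply: cbounded_measurable_overshoot_transform; exact: natc_ge0.
rewrite (@eq_workload_mean _ _ (fun x => \sum_(k < M.+1) (L k).[s] *
    (D.[k%:R] * overshoot_transform (mS i) k%:R x))); last first.
  by move=> x x0; have [h _] := overshoot_interpolation i x0; exact: h.
rewrite workload_mean_sum//; apply: eq_bigr => k _.
have b := cbounded_measurable_overshoot_transform i (natc_ge0 k).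
rewrite workload_meanZ; last exact: cbounded_measurable_scale.
by rewrite workload_meanZ// mulrCA.
Qed.

Lemma transition_interpolation_pole j k (f : 'I_(m k)) i w :
  \sum_(l < M.+1) (L l).[t f] * (D.[l%:R] * K (state_exp j l%:R) i w) =
  (p i j)%:C * (numer i).[t f] * (\prod_(nu | nu != i) (denom t nu).[t f]) *
  (cintegral (mA j) setT (exp_kernel (- t f)) *
   cintegral mV setT (fun v => exp_kernel (- t f * `|v|%:C) w)).
Proof.
rewrite -workload_mean_exp; last by rewrite ltW// t_lt0.
under [LHS]eq_bigr do rewrite transition_state_exp mulrCA [X in _ * X]mulrCA mulrCA.
rewrite -mulr_sumr -!mulrA; congr (_ * _); rewrite mulrA.
have be : cbounded_measurable (fun x : R => cexp (t f * `|x|%:C)).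
  have h : 0 <= complex.Re (- t f) by rewrite ReN oppr_ge0 ltW// t_lt0.
  have := cbounded_measurable_exp_kernel h (@measurable_id _ R setT).
  by congr cbounded_measurable; apply/funext => x; rewrite /exp_kernel opprK.
rewrite -workload_meanZ//.
have bk (l : 'I_M.+1) : cbounded_measurable
    (fun x => (L l).[t f] * (D.[l%:R] * overshoot_transform (mS i) l%:R x)).
  do 2 apply: cbounded_measurable_scale.
  by apply: cbounded_measurable_overshoot_transform; exact: natc_ge0.
rewrite [RHS](@eq_workload_mean _ _ (fun x => \sum_(l < M.+1) (L l).[t f] *
    (D.[l%:R] * overshoot_transform (mS i) l%:R x))); last first.
  by move=> x x0; have [_ h] := overshoot_interpolation i x0; rewrite ger0_norm.
rewrite workload_mean_sum//; apply: eq_bigr => l _.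
have b := cbounded_measurable_overshoot_transform i (natc_ge0 l).
rewrite [in RHS]workload_meanZ; last exact: cbounded_measurable_scale.
by rewrite [in RHS]workload_meanZ// mulrCA.
Qed.

(** For any functional, invariant or not, D(s) times the transform of rho o K is a polynomial of
    degree at most M on Re s >= 0: a single step of K creates the rational form through the service
    time. *)
Lemma regular_interpolation rho j s : regular_functional rho ->
  0 <= complex.Re s ->
  D.[s] * rho (K (state_exp j s)) =
  \sum_(k < M.+1) (L k).[s] * (D.[k%:R] * rho (K (state_exp j k%:R))).
Proof.
move=> ok s0; have bK z : 0 <= complex.Re z -> tuple_bm (K (state_exp j z)).
  by move=> z0; exact/tuple_bm_transition/tuple_bm_state_exp.
rewrite -(regularZ ok); last exact: bK.
under [RHS]eq_bigr => k _.
  rewrite -(regularZ ok); last exact/bK/natc_ge0.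
  rewrite -(regularZ ok); last exact/tuple_bmZ/bK/natc_ge0.
  over.
rewrite -(regular_sum _ ok); last first.
  by move=> k; do 2 apply: tuple_bmZ; exact/bK/natc_ge0.
by congr rho; apply/funext => i; apply/funext => w; exact: transition_interpolation.
Qed.

Lemma family_bm_state_exp i z : 0 <= complex.Re z ->
  family_bm (fun v : R => state_exp i (z * `|v|%:C)).
Proof.
move=> z0 k; rewrite /state_exp; case: eqP => _; last exact: cbounded_measurable_cst.
have h : cbounded_measurable (fun vw : R * R => exp_kernel z (`|vw.1| * `|vw.2|)).
  apply: cbounded_measurable_exp_kernel => //.
  by apply: measurable_funM; exact: measurableT_comp.
congr (cbounded_measurable _): h; apply/funext => v.
by rewrite /exp_kernel normrM !normr_id rmorphM /=; congr cexp; ring.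
Qed.

(** The polynomial of [regular_interpolation], evaluated at a pole, takes the shape of the left side
    of the linear system, with rho(e_{i,-t|v|}) where the system has the rational function.
    [regular_Fubini] is what brings rho inside the integral over V. *)
Lemma regular_interpolation_pole rho j k (f : 'I_(m k)) :
  regular_functional rho ->
  \sum_(l < M.+1) (L l).[t f] * (D.[l%:R] * rho (K (state_exp j l%:R))) =
  cintegral (mA j) setT (exp_kernel (- t f)) *
  (\sum_i (p i j)%:C * (numer i).[t f] *
     (\prod_(nu | nu != i) (denom t nu).[t f]) *
     cintegral mV setT (fun v => rho (state_exp i (- t f * `|v|%:C)))).
Proof.
move=> ok; have bK z : 0 <= complex.Re z -> tuple_bm (K (state_exp j z)).
  by move=> z0; exact/tuple_bm_transition/tuple_bm_state_exp.
have h : 0 <= complex.Re (- t f) by rewrite ReN oppr_ge0 ltW// t_lt0.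
under [LHS]eq_bigr => l _.
  rewrite -(regularZ ok); last exact/bK/natc_ge0.
  rewrite -(regularZ ok); last exact/tuple_bmZ/bK/natc_ge0.
  over.
rewrite -(regular_sum _ ok); last first.
  by move=> l; do 2 apply: tuple_bmZ; exact/bK/natc_ge0.
pose H i : 'I_N -> R -> R[i] := fun i' w =>
  cintegral mV setT (fun v => state_exp i (- t f * `|v|%:C) i' w).
have bH i : tuple_bm (H i).
  move=> i'; have b := family_bm_state_exp i h i'.
  exact: (cbounded_measurable_cintegral mV
    (cbounded_measurable_comp b (@measurable_swap _ _ R R))).
pose c i := cintegral (mA j) setT (exp_kernel (- t f)) * ((p i j)%:C *
  (numer i).[t f] * (\prod_(nu | nu != i) (denom t nu).[t f])).
transitivity (rho (fun i' w => \sum_i c i * H i i' w)).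
  congr rho; apply/funext => i; apply/funext => w.
  rewrite transition_interpolation_pole [RHS](bigD1 i)//= [X in _ = _ + X]big1 ?addr0.
    by rewrite /H /state_exp eqxx /c; ring.
  move=> i' ii'; rewrite /H /state_exp eq_sym (negbTE ii').
  by rewrite cintegral_prob_cst mulr0.
rewrite (regular_sum _ ok); last by move=> i; exact: tuple_bmZ.
rewrite mulr_sumr; apply: eq_bigr => i _.
rewrite (regularZ ok)// /c -!mulrA; do 4 congr (_ * _).
by rewrite (regular_Fubini ok)//; exact: family_bm_state_exp.
Qed.

End transform_identities.

(** * The law of the process *)

Section product_laws.
Context {R : realType}.

Lemma measure_unique_rectangles d1 d2 (T1 : measurableType d1)
    (T2 : measurableType d2) (m1 m2 : {measure set (T1 * T2) -> \bar R}) :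
  (m1 setT < +oo)%E ->
  (forall A B, measurable A -> measurable B -> m1 (A `*` B) = m2 (A `*` B)) ->
  forall C, measurable C -> m1 C = m2 C.
Proof.
move=> m1oo m12 C mC.
apply: (measure_unique [set A `*` B | A in measurable & B in measurable]
  (fun=> setT)) => //.
- by rewrite measurable_prod_measurableType.
- move=> _ _ [A1 mA1 [B1 mB1 <-]] [A2 mA2 [B2 mB2 <-]].
  exists (A1 `&` A2); first exact: measurableI.
  by exists (B1 `&` B2); [exact: measurableI|rewrite setXI].
- by move=> _; exists setT => //; exists setT => //; rewrite setXTT.
- by rewrite bigcup_const//; exists 0%N.
- by move=> _ [A mA [B mB <-]]; exact: m12.
Qed.

Lemma measurable_halflines :
  @measurable _ R = <<s [set A : set R | exists x, A = `]-oo, x]%classic] >>.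
Proof.
rewrite [LHS](RGenOInfty.measurableE R) eqEsubset; split => A.
  apply: smallest_sub; first exact: smallest_sigma_algebra.
  move=> _ [x ->]; rewrite -setCitvl; apply: sigma_algebraC.
  by apply: sub_sigma_algebra; exists x.
apply: smallest_sub; first exact: smallest_sigma_algebra.
move=> _ [x ->]; rewrite -setCitvr; apply: sigma_algebraC.
by apply: sub_sigma_algebra; exists x.
Qed.

Lemma measure_unique_halflines (m1 m2 : {measure set R -> \bar R}) :
  (m1 setT < +oo)%E ->
  (forall x : R, m1 `]-oo, x]%classic = m2 `]-oo, x]%classic) ->
  forall B, measurable B -> m1 B = m2 B.
Proof.
move=> m1oo m12 B mB.
apply: (measure_unique [set A : set R | exists x, A = `]-oo, x]%classic]
  (fun n => `]-oo, n%:R]%classic)) => //.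
- exact: measurable_halflines.
- move=> _ _ [x ->] [y ->]; exists (Num.min x y).
  by apply/seteqP; split => z /=; rewrite !in_itv/= le_min; [move=> [-> ->]|move=> /andP].
- by move=> n; exists n%:R.
- apply/seteqP; split => // x _; exists (Num.bound `|x|) => //=.
  by rewrite in_itv/= ltW// (le_lt_trans (ler_norm _))//; exact: archi_boundP.
- by move=> _ [x ->]; exact: m12.
- move=> n; apply: le_lt_trans m1oo; apply: le_measure; rewrite ?inE//.
Qed.

Lemma lebesgue_stieltjes_halfline (F : cumulativeBounded (0 : R) (1 : R)) x :
  lebesgue_stieltjes_measure F `]-oo, x]%classic = (F x)%:E.
Proof. by rewrite -cdf_lebesgue_stieltjes_id /cdf /distribution /pushforward preimage_id. Qed.

Let idR : measurableTypeR R -> R := idfun.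

#[local] HB.instance Definition _ :=
  @isMeasurableFun.Build _ _ _ _ idR (@measurable_id _ _ setT).

(* lebesgue_stieltjes_measure F lives on the alias measurableTypeR R of R. *)
Definition stieltjes_prob (F : cumulativeBounded (0 : R) (1 : R)) :
    probability R R :=
  distribution (lebesgue_stieltjes_measure F) idR.

Lemma stieltjes_prob_halfline F x : stieltjes_prob F `]-oo, x]%classic = (F x)%:E.
Proof. exact: lebesgue_stieltjes_halfline. Qed.

Lemma Rintegral_stieltjes_prob F (f : R -> R) : bounded_measurable f ->
  \int[stieltjes_prob F]_x f x = \int[lebesgue_stieltjes_measure F]_x f x.
Proof.
move=> bf; congr fine.
apply: (@integral_distribution _ _ _ _ _ _ (idR : {RV lebesgue_stieltjes_measure F >-> R}) (EFin \o f)).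
  by apply/measurable_EFinP; case: bf.
exact: (@bounded_measurable_integrable _ _ _ (lebesgue_stieltjes_measure F) f bf).
Qed.

Context d (T : measurableType d) (P : probability T R).

(** Working with P restricted to E and an unnormalised constant c avoids any division by P(E). The
    two finite measures compared agree on half-lines, which form a generating pi-system. *)
Lemma law_halflines (E : set T) (Y : T -> R) (c : {nonneg R})
    (F : cumulativeBounded (0 : R) (1 : R)) : measurable E ->
  measurable_fun setT Y ->
  (forall x, P (E `&` Y @^-1` `]-oo, x]%classic) = (c%:num * F x)%:E) ->
  forall B, measurable B ->
    P (E `&` Y @^-1` B) = (c%:num%:E * stieltjes_prob F B)%E.
Proof.
move=> mE mY h B mB; rewrite setIC.
apply: (@measure_unique_halflines (pushforward (mrestr P mE) Y)
  (mscale c (stieltjes_prob F))) => //.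
- change (P (Y @^-1` setT `&` E) < +oo)%E.
  by rewrite preimage_setT setTI ltey_eq fin_num_measure.
- move=> x.
  change (P (Y @^-1` `]-oo, x]%classic `&` E) =
    (c%:num%:E * stieltjes_prob F `]-oo, x]%classic)%E).
  by rewrite setIC h stieltjes_prob_halfline.
Qed.

Lemma law_rectangles d1 d2 (T1 : measurableType d1) (T2 : measurableType d2)
    (E : set T) (X : T -> T1) (Y : T -> T2) (c : {nonneg R})
    (m1 : probability T1 R) (m2 : probability T2 R) :
  measurable E -> measurable_fun setT X -> measurable_fun setT Y ->
  (forall A B, measurable A -> measurable B ->
    P (E `&` X @^-1` A `&` Y @^-1` B) = (c%:num%:E * (m1 A * m2 B))%E) ->
  forall C, measurable C ->
    P (E `&` (fun x => (X x, Y x)) @^-1` C) = (c%:num%:E * (m1 \x m2) C)%E.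
Proof.
move=> mE mX mY h C mC; rewrite setIC.
have mXY : measurable_fun setT (fun x => (X x, Y x)) by exact: measurable_fun_pair.
apply: (@measure_unique_rectangles _ _ _ _
  (pushforward (mrestr P mE) (fun x => (X x, Y x))) (mscale c (m1 \x m2)%E)) => //.
- change (P ((fun x => (X x, Y x)) @^-1` setT `&` E) < +oo)%E.
  by rewrite preimage_setT setTI ltey_eq fin_num_measure.
- move=> A B mA mB.
  change (P ((fun x => (X x, Y x)) @^-1` (A `*` B) `&` E) =
    (c%:num%:E * (m1 \x m2)%E (A `*` B))%E).
  rewrite product_measure1E// -h//; congr (P _).
  by apply/seteqP; split => x /=; tauto.
Qed.

End product_laws.

Section restricted_law.
Context {R : realType} d (T : measurableType d) (P : probability T R).
Context d' (T' : measurableType d') (E : set T) (mE : measurable E).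
Context (X : {mfun T >-> T'}).

(** In general not normalised. It is made an instance of a finite measure so that Tonelli applies to
    its product with another law. *)
Definition restricted_law : set T' -> \bar R := pushforward (mrestr P mE) X.

Let restricted_law0 : restricted_law set0 = 0%E.
Proof. by change (P (set0 `&` E) = 0%E); rewrite set0I measure0. Qed.

Let restricted_law_ge0 A : (0 <= restricted_law A)%E.
Proof. by rewrite /restricted_law /pushforward measure_ge0. Qed.

Let restricted_law_sigma_additive : semi_sigma_additive restricted_law.
Proof.
rewrite /restricted_law; apply: measure_semi_sigma_additive.
exact: measurable_funPT.
Qed.

HB.instance Definition _ := isMeasure.Build _ _ _ restricted_law
  restricted_law0 restricted_law_ge0 restricted_law_sigma_additive.

Let restricted_law_fin : fin_num_fun restricted_law.
Proof.
move=> A mA; change (P (X @^-1` A `&` E) \is a fin_num).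
apply: fin_num_measure; apply: measurableI => //.
by rewrite -[Y in measurable Y]setTI; exact: measurable_funPT.
Qed.

HB.instance Definition _ :=
  @Measure_isFinite.Build _ T' _ restricted_law restricted_law_fin.

Lemma ge0_integral_restricted_law (f : T' -> \bar R) :
  measurable_fun setT f -> (forall y, 0 <= f y)%E ->
  (\int[restricted_law]_y f y = \int[P]_(x in E) f (X x))%E.
Proof.
move=> mf f0; rewrite ge0_integral_pushforward//= preimage_setT.
have mfX : measurable_fun setT (f \o X) by exact: measurableT_comp.
rewrite (ge0_negligible_integral (N := ~` E))//=.
- rewrite setTD setCK; apply: eq_measure_integral => A mA AE.
  by change (P (A `&` E) = P A); rewrite setIidl.
- exact: measurableC.
- by change (P (~` E `&` E) = 0%E); rewrite setICl measure0.
Qed.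

End restricted_law.

Section product_law_integral.
Context {R : realType} d (T : measurableType d) (P : probability T R).
Context d1 d2 (T1 : measurableType d1) (T2 : measurableType d2).
Variables (E E' : set T) (mE : measurable E) (mE' : measurable E').
Variables (X : {mfun T >-> T1}) (Y : {mfun T >-> T2}).
Variables (c : {nonneg R}) (nu : probability T2 R).
Hypothesis product_law : forall A B, measurable A -> measurable B ->
  P (E `&` X @^-1` A `&` Y @^-1` B) =
  (c%:num%:E * (P (E' `&` X @^-1` A) * nu B))%E.

Let XY : T -> T1 * T2 := fun x => (X x, Y x).

Let mXY : measurable_fun setT XY.
Proof. exact: measurable_fun_pair. Qed.

#[local] HB.instance Definition _ := @isMeasurableFun.Build _ _ _ _ XY mXY.

Let ge0_product_law (f : T1 * T2 -> \bar R) :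
  measurable_fun setT f -> (forall y, 0 <= f y)%E ->
  (\int[P]_(x in E) f (X x, Y x) =
   c%:num%:E * \int[P]_(x in E') \int[nu]_y f (X x, y))%E.
Proof.
move=> mf f0.
rewrite -(@ge0_integral_restricted_law _ _ _ P _ _ E mE XY f)//.
rewrite (eq_measure_integral (mscale c (restricted_law P mE' X \x nu)%E)); last first.
  move=> C mC _; apply: measure_unique_rectangles => //.
    by rewrite ltey_eq fin_num_measure.
  move=> A B mA mB.
  change (P (XY @^-1` (A `*` B) `&` E) =
    (c%:num%:E * (restricted_law P mE' X \x nu)%E (A `*` B))%E).
  rewrite product_measure1E//.
  change (P (XY @^-1` (A `*` B) `&` E) =
    (c%:num%:E * (P (X @^-1` A `&` E') * nu B))%E).
  rewrite [X @^-1` A `&` E']setIC -product_law//; congr (P _).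
  by apply/seteqP; split => x /=; tauto.
rewrite ge0_integral_mscale// fubini_tonelli1//.
rewrite ge0_integral_restricted_law//.
- exact: measurable_fun_fubini_tonelli_F.
- by move=> x; apply: integral_ge0 => y _.
Qed.

Lemma Rintegral_product_law (f : T1 * T2 -> R) : bounded_measurable f ->
  \int[P]_(x in E) f (X x, Y x) =
  c%:num * \int[P]_(x in E') \int[nu]_y f (X x, y).
Proof.
move=> bf; have [mf [M fM]] := bf.
have M0 : 0 <= M by exact: le_trans (fM point).
have PE : fine (P E) = c%:num * fine (P E').
  have := product_law measurableT measurableT.
  rewrite !preimage_setT !setIT probability_setT mule1 => ->.
  by rewrite fineM ?fin_num_measure.
(* Tonelli gives the formula for nonnegative integrands. It is used for f + M, and the contribution
   of M cancels thanks to [PE]. *)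
have ge0 (h : T1 * T2 -> R) : bounded_measurable h -> (forall z, 0 <= h z) ->
    \int[P]_(x in E) h (X x, Y x) =
    c%:num * \int[P]_(x in E') \int[nu]_y h (X x, y).
  move=> bh h0; have [mh _] := bh.
  rewrite /Rintegral (ge0_product_law (f := EFin \o h)); last 2 first.
  - by apply/measurable_EFinP.
  - by move=> z; rewrite lee_fin.
  have E1 : (\int[P]_(x in E') \int[nu]_y (h (X x, y))%:E =
      \int[P]_(x in E') (\int[nu]_y h (X x, y))%:E)%E.
    apply: eq_integral => x _; rewrite /Rintegral fineK//.
    apply: (@integrable_fin_num _ _ _ nu) => //.
    exact: (bounded_measurable_integrable nu (bounded_measurable_section (X x) bh)).
  rewrite E1 fineM//.
  apply: (@integrable_fin_num _ _ _ P) => //.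
  apply: (@integrableS _ _ _ _ setT) => //.
  have b := bounded_measurable_Rintegral nu bh.
  apply: (@bounded_measurable_integrable _ _ _ P (fun x => \int[nu]_y h (X x, y))).
  by split; [exact: measurableT_comp b.1 _|have [_ [B hB]] := b; exists B].
have bS (D : set T) (g : T -> R) : measurable D -> bounded_measurable g ->
    P.-integrable D (EFin \o g).
  move=> mD bg; apply: (@integrableS _ _ _ _ setT) => //.
  exact: bounded_measurable_integrable.
have bcst d0 (T0 : measurableType d0) (r : R) : bounded_measurable (fun _ : T0 => r).
  by split => //; exists `|r|.
have bfM : bounded_measurable (fun z => f z + M).
  split; first exact: measurable_funD.
  by exists (M + M) => z; rewrite (le_trans (ler_normD _ _))// (ger0_norm M0) lerD2r.
have := ge0 (fun z => f z + M) bfM; rewrite /= => h.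
have {}h : \int[P]_(x in E) (f (X x, Y x) + M) =
    c%:num * \int[P]_(x in E') \int[nu]_y (f (X x, y) + M).
  by apply: h => z; have := fM z; rewrite ler_norml -subr_ge0 opprK => /andP[].
have bfXY : bounded_measurable (fun x => f (X x, Y x)).
  by split; [exact: measurableT_comp mf _|exists M].
have bn := bounded_measurable_Rintegral nu bf.
have bnX : bounded_measurable (fun x => \int[nu]_y f (X x, y)).
  by split; [exact: measurableT_comp bn.1 _|have [_ [B hB]] := bn; exists B].
have E2 : \int[P]_(x in E') \int[nu]_y (f (X x, y) + M) =
    \int[P]_(x in E') (\int[nu]_y f (X x, y) + M).
  apply: eq_Rintegral => x _; rewrite RintegralD//.
  - by rewrite Rintegral_cst// fine_probability_setT mulr1.
  - exact: (bounded_measurable_integrable nu (bounded_measurable_section (X x) bf)).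
  - exact: (bounded_measurable_integrable nu (bcst _ _ M)).
move: h; rewrite E2 !RintegralD//; try exact: bS.
rewrite !Rintegral_cst// PE mulrDr => h.
by apply: (addIr (M * (c%:num * fine (P E')))); rewrite h; congr (_ + _); ring.
Qed.

End product_law_integral.

Section cintegral_more.
Context {R : realType} d (T : measurableType d) (P : probability T R).
Implicit Types f g : T -> R[i].

Lemma cintegral_indic (E : set T) f :
  cintegral P E f = cintegral P setT (fun x => (\1_E x)%:C * f x).
Proof.
apply: complex_eqP; rewrite /= Rintegral_mkcond; apply: eq_Rintegral => x _;
  rewrite patchE indicE ?ReM ?ImM /= mul0r; case: (x \in E);
  by rewrite ?mul1r ?mul0r ?subr0 ?addr0.
Qed.

Lemma cbounded_measurable_indic (E : set T) : measurable E ->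
  cbounded_measurable (fun x => (\1_E x)%:C : R[i]).
Proof.
move=> mE; apply: cbounded_measurable_real; split; first exact: measurable_indic.
by exists 1 => x; rewrite indicE; case: (_ \in _); rewrite ?normr1 ?normr0.
Qed.

Lemma cintegral_partition (I : finType) (zeta : T -> I) (f : I -> T -> R[i]) :
  (forall k, measurable [set x | zeta x = k]) ->
  (forall k, cbounded_measurable (f k)) ->
  cintegral P setT (fun x => f (zeta x) x) =
  \sum_k cintegral P [set x | zeta x = k] (f k).
Proof.
move=> mz bf; under [RHS]eq_bigr do rewrite cintegral_indic.
rewrite -cintegral_sum; last first.
  by move=> k; apply: cbounded_measurableM => //; exact: cbounded_measurable_indic.
apply: eq_cintegral => x _; rewrite (bigD1 (zeta x))//= big1 ?addr0.
  by rewrite indicE mem_set// mul1r.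
by move=> k kz; rewrite indicE memNset ?mul0r// => /esym/eqP; rewrite (negbTE kz).
Qed.

Lemma ae_eq_cintegral f g : cbounded_measurable f -> cbounded_measurable g ->
  {ae P, forall x, f x = g x} -> cintegral P setT f = cintegral P setT g.
Proof.
move=> [rf jf _] [rg jg _] fg; apply: complex_eqP; congr fine;
  apply: ae_eq_integral => //; try exact/measurable_EFinP;
  by apply: filterS fg => x fgx _; rewrite fgx.
Qed.

Lemma cintegral_full (D : set T) f g : measurable D -> P D = 1%E ->
  cbounded_measurable g -> (forall x, D x -> f x = g x) ->
  cintegral P D f = cintegral P setT g.
Proof.
move=> mD PD bg fg; rewrite cintegral_indic.
have -> : (fun x => (\1_D x)%:C * f x) = (fun x => (\1_D x)%:C * g x).
  apply/funext => x; rewrite indicE; case: (boolP (x \in D)); last by rewrite !mul0r.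
  by move=> /set_mem /fg ->.
apply: ae_eq_cintegral => //.
  by apply: cbounded_measurableM => //; exact: cbounded_measurable_indic.
exists (~` D); split; first exact: measurableC.
- by rewrite probability_setC// PD subee.
- move=> x /= h Dx; apply: h.
  by rewrite indicE mem_set// mul1r.
Qed.

Context d1 d2 (T1 : measurableType d1) (T2 : measurableType d2).

Lemma cintegral_prod (nu1 : probability T1 R) (nu2 : probability T2 R)
    (f : T1 * T2 -> R[i]) : cbounded_measurable f ->
  cintegral (nu1 \x nu2)%E setT f =
  cintegral nu1 setT (fun x => cintegral nu2 setT (fun y => f (x, y))).
Proof.
have rl (h : T1 * T2 -> R) : bounded_measurable h ->
    \int[(nu1 \x nu2)%E]_z h z = \int[nu1]_x \int[nu2]_y h (x, y).
  move=> bh; have ih : (nu1 \x nu2)%E.-integrable setT (EFin \o h).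
    have [mh [M hM]] := bh; apply: measurable_bounded_integrable => //.
      apply: (@le_lt_trans _ _ 1%E); last exact: ltry.
      exact: (@probability_le1 _ _ _ (nu1 \x nu2)%E _ measurableT).
    exists M; split; first by rewrite num_real.
    by move=> x Mx y _; apply: (le_trans (hM y)); exact: ltW.
  rewrite /Rintegral -(integral12_prod_meas1 ih); congr fine.
  apply: eq_integral => x _; rewrite fineK//.
  apply: (@integrable_fin_num _ _ _ nu2) => //.
  exact: (bounded_measurable_integrable nu2 (bounded_measurable_section x bh)).
move=> bf; apply: complex_eqP => /=.
- exact: (rl _ (cbounded_measurable_Re bf)).
- exact: (rl _ (cbounded_measurable_Im bf)).
Qed.

Lemma cintegral_product_law (E E' : set T) (X : {mfun T >-> T1})
    (Y : {mfun T >-> T2}) (c : R) (nu : probability T2 R) (f : T1 * T2 -> R[i]) :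
  measurable E -> measurable E' -> 0 <= c ->
  (forall A B, measurable A -> measurable B ->
    P (E `&` X @^-1` A `&` Y @^-1` B) =
    (c%:E * (P (E' `&` X @^-1` A) * nu B))%E) ->
  cbounded_measurable f ->
  cintegral P E (fun x => f (X x, Y x)) =
  c%:C * cintegral P E' (fun x => cintegral nu setT (fun y => f (X x, y))).
Proof.
move=> mE mE' c0 law bf.
apply: complex_eqP; rewrite ?ReM ?ImM /= mul0r ?subr0 ?addr0.
- exact: (Rintegral_product_law mE mE' (c := NngNum c0) law (cbounded_measurable_Re bf)).
- exact: (Rintegral_product_law mE mE' (c := NngNum c0) law (cbounded_measurable_Im bf)).
Qed.

End cintegral_more.

Section sigma_algebra_events.
Context (T : pointedType) (G : set (set T)).

Lemma sigma_closedI A B : <<s G >> A -> <<s G >> B -> <<s G >> (A `&` B).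
Proof. exact: (@measurableI _ (g_sigma_algebraType G)). Qed.

End sigma_algebra_events.

Lemma product_probability_snd {R : realType} d1 d2 (T1 : measurableType d1)
    (T2 : measurableType d2) (m1 : probability T1 R) (m2 : probability T2 R)
    (C : set T2) : measurable C -> (m1 \x m2)%E (setT `*` C) = m2 C.
Proof.
move=> mC; transitivity (m1 setT * m2 C)%E; first exact: product_measure1E.
by rewrite probability_setT mul1e.
Qed.

(** * From the model assumptions to one step of K *)

Section process.
Context {R : realType} d (T : measurableType d) (P : probability T R) (N : nat).
Variables (p : 'M[R]_N) (Z : nat -> T -> 'I_N) (W V S A : nat -> {RV P >-> R}).
Variables (FS GA : 'I_N -> cumulativeBounded (0 : R) (1 : R)).
Hypothesis p_ge0 : forall i j, 0 <= p i j.
Hypothesis p_sum1 : forall i, \sum_j p i j = 1.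
Hypothesis mZ : forall n i, measurable [set w | Z n w = i].
Hypothesis W_ge0 : forall n w, 0 <= W n w.
Hypothesis S_ge0 : forall n w, 0 <= S n w.
Hypothesis A_ge0 : forall n w, 0 <= A n.+1 w.
Hypothesis W_rec : forall n w,
  W n.+1 w = Num.max (V n w * W n w + S n w - A n.+1 w) 0.
Hypothesis V_iid : iid V.
Hypothesis V_lt0 : forall n, {ae P, forall w, V n w < 0}.
Hypothesis V_indep :
  forall n, indep_classes P (events (V n)) (environment Z W S A n).
Hypothesis FS0 : forall i x, x < 0 -> FS i x = 0.
Hypothesis GA0 : forall j x, x < 0 -> GA j x = 0.
Hypothesis law : modulated_law Z W S A p FS GA.

Local Notation mV := (distribution P (V 0%N)).
Local Notation mS := (fun i => stieltjes_prob (FS i)).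
Local Notation mA := (fun j => stieltjes_prob (GA j)).

Lemma measurable_RV_preimage (X : {RV P >-> R}) B :
  measurable B -> measurable (X @^-1` B).
Proof. by move=> mB; rewrite -[Y in measurable Y]setTI; exact: measurable_funPT. Qed.

Lemma past_W n B : measurable B -> past Z W S A n (W n @^-1` B).
Proof.
move=> mB; apply: sub_sigma_algebra; left; exists n => /=; first exact: ltnSn.
by right; exists B => //; rewrite setTI.
Qed.

Local Notation E_ n i j := ([set w | Z n w = i] `&` [set w | Z n.+1 w = j]).

(** The conditional law with its denominator cleared. Negative x or y give 0 on both sides, and so
    does a null conditioning event, about which [modulated_law] says nothing. *)
Lemma joint_cdf n i j B x y : measurable B ->
  P (E_ n i j `&` W n @^-1` B `&` A n.+1 @^-1` `]-oo, x]%classic `&`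
     S n @^-1` `]-oo, y]%classic) =
  (p i j * FS i y * GA j x * fine (P ([set w | Z n w = i] `&` W n @^-1` B)))%:E.
Proof.
move=> mB; set H := W n @^-1` B.
have mH : measurable H by exact: measurable_RV_preimage.
have mF : measurable (H `&` [set w | Z n w = i]) by exact: measurableI.
have mA x' : measurable (A n.+1 @^-1` `]-oo, x']%classic) by exact: measurable_RV_preimage.
have mS y' : measurable (S n @^-1` `]-oo, y']%classic) by exact: measurable_RV_preimage.
have [x0|x0] := ltP x 0.
  rewrite GA0// mulr0 mul0r (_ : _ `&` _ = set0) ?measure0//.
  rewrite -subset0 => w /= [[_ ]]; rewrite !in_itv /= => Ax _.
  by have := le_lt_trans Ax x0; rewrite ltNge A_ge0.
have [y0|y0] := ltP y 0.
  rewrite FS0// mulr0 !mul0r (_ : _ `&` _ = set0) ?measure0//.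
  rewrite -subset0 => w /= [_]; rewrite !in_itv /= => Sy.
  by have := le_lt_trans Sy y0; rewrite ltNge S_ge0.
rewrite [_ `&` H in RHS]setIC.
have [F0|F0] := eqVneq (P (H `&` [set w | Z n w = i])) 0%E.
  rewrite F0 mulr0; apply/eqP; rewrite eq_le measure_ge0 andbT.
  apply: (@le_trans _ _ (P (H `&` [set w | Z n w = i]))); last by rewrite F0.
  apply: le_measure; rewrite ?inE//.
    by do 3 (apply: measurableI => //); exact: measurableI.
  by move=> w /= [[[[? ?] ?] _] _].
have Fgt0 : (0 < P (H `&` [set w | Z n w = i]))%E by rewrite lt_neqAle eq_sym F0 measure_ge0.
have := @law n i j x y H x0 y0 (past_W mB) Fgt0; rewrite /cond_prob => h.
have fF : fine (P (H `&` [set w | Z n w = i])) != 0.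
  by rewrite fine_eq0// fin_num_measure.
rewrite -h -mulrA mulVf// mulr1 fineK ?fin_num_measure//.
  congr (P _); apply/seteqP; split => w /=; rewrite !in_itv /=.
    by move=> [[[[? ?] ?] ?] ?]; split => //; split.
  by move=> [[? ? ?] [? ?]]; do !split.
apply: measurableI => //.
rewrite (_ : [set _ | _] = A n.+1 @^-1` `]-oo, x]%classic `&`
    S n @^-1` `]-oo, y]%classic `&` [set w | Z n.+1 w = j]).
  by do 2 apply: measurableI => //.
apply/seteqP; split => w /=; rewrite !in_itv /=; first by case.
by case=> [[]].
Qed.

(** Half-lines are replaced by Borel sets one variable at a time: first for A with y fixed, then for
    S with the Borel set of A already in place. *)
Lemma joint_law n i j B B3 B4 : measurable B -> measurable B3 -> measurable B4 ->
  P (E_ n i j `&` W n @^-1` B `&` A n.+1 @^-1` B3 `&` S n @^-1` B4) =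
  ((p i j * fine (P ([set w | Z n w = i] `&` W n @^-1` B)))%:E *
   (stieltjes_prob (GA j) B3 * stieltjes_prob (FS i) B4))%E.
Proof.
move=> mB mB3 mB4.
have mE : measurable (E_ n i j `&` W n @^-1` B).
  by apply: measurableI; [exact: measurableI|exact: measurable_RV_preimage].
set q := fine (P _).
have FS_ge0 y : 0 <= FS i y by rewrite -lee_fin -stieltjes_prob_halfline.
have step1 y : P (E_ n i j `&` W n @^-1` B `&` S n @^-1` `]-oo, y]%classic `&`
    A n.+1 @^-1` B3) = ((p i j * FS i y * q)%:E * stieltjes_prob (GA j) B3)%E.
  have c0 : 0 <= p i j * FS i y * q by rewrite !mulr_ge0// fine_ge0.
  apply: (law_halflines (c := NngNum c0)) => //=.
    by apply: measurableI => //; exact: measurable_RV_preimage.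
  move=> x; rewrite setIAC joint_cdf//; congr (_%:E); rewrite -/q; ring.
have GA3 : (fine (stieltjes_prob (GA j) B3))%:E = stieltjes_prob (GA j) B3.
  by rewrite fineK ?fin_num_measure.
have c0 : 0 <= p i j * q * fine (stieltjes_prob (GA j) B3).
  by rewrite !mulr_ge0// fine_ge0.
rewrite (law_halflines (F := FS i) (c := NngNum c0))//=.
- by rewrite EFinM GA3 muleA.
- by apply: measurableI => //; exact: measurable_RV_preimage.
- by move=> y; rewrite setIAC step1 -GA3 -EFinM; congr (_%:E); ring.
Qed.

Let AS n : T -> R * R := fun w => (A n.+1 w, S n w).
Let VAS n : T -> R * (R * R) := fun w => (V n w, AS n w).

Let mAS n : measurable_fun setT (AS n).
Proof. exact: measurable_fun_pair. Qed.

Let mVAS n : measurable_fun setT (VAS n).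
Proof. by apply: measurable_fun_pair => //; exact: mAS. Qed.

(** All events other than that of V_n belong to [environment], so independence splits off the factor
    of V_n, whose law is that of V_0. *)
Lemma joint_law_V n i j B B2 B3 B4 :
  measurable B -> measurable B2 -> measurable B3 -> measurable B4 ->
  P (E_ n i j `&` W n @^-1` B `&` V n @^-1` B2 `&` A n.+1 @^-1` B3 `&` S n @^-1` B4) =
  ((p i j * fine (P ([set w | Z n w = i] `&` W n @^-1` B)) * fine (mV B2))%:E *
   (stieltjes_prob (GA j) B3 * stieltjes_prob (FS i) B4))%E.
Proof.
move=> mB mB2 mB3 mB4.
pose F := E_ n i j `&` W n @^-1` B `&` A n.+1 @^-1` B3 `&` S n @^-1` B4.
have envZ k l : environment Z W S A n [set w | Z k w = l].
  by apply: sub_sigma_algebra; left; left; left; exists k => //; exists l.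
have envI X Y : environment Z W S A n X -> environment Z W S A n Y ->
    environment Z W S A n (X `&` Y) by exact: sigma_closedI.
have envF : environment Z W S A n F.
  apply: (envI _ _); [apply: (envI _ _); [apply: (envI _ _); [exact: envI|]|]|].
  - by apply: sub_sigma_algebra; left; left; right; exists B => //; rewrite setTI.
  - by apply: sub_sigma_algebra; right; exists B3 => //; rewrite setTI.
  - by apply: sub_sigma_algebra; left; right; exists B4 => //; rewrite setTI.
have evV : events (V n) (V n @^-1` B2) by exists B2 => //; rewrite setTI.
transitivity (P (V n @^-1` B2 `&` F)).
  by congr (P _); apply/seteqP; split => w; rewrite /F /=; tauto.
rewrite (V_indep evV envF) joint_law// (V_iid.1 n B2 mB2).
rewrite [in RHS]EFinM (fineK (fin_num_measure mV B2 mB2)).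
by rewrite muleCA muleA.
Qed.

(** Rectangles determine the law, in two stages: the pair (A, S) for a fixed event of V, then V
    together with that pair. *)
Lemma joint_law_pairs n i j (X : {mfun T >-> (R * (R * R))%type}) : X = VAS n :> (T -> R * (R * R)) ->
  forall B C, measurable B -> measurable C ->
  P (E_ n i j `&` W n @^-1` B `&` X @^-1` C) =
  ((p i j)%:E * (P ([set w | Z n w = i] `&` W n @^-1` B) *
    (mV \x (stieltjes_prob (GA j) \x stieltjes_prob (FS i)))%E C))%E.
Proof.
move=> XE B C mB mC; rewrite XE.
have mE : measurable (E_ n i j `&` W n @^-1` B).
  by apply: measurableI; [exact: measurableI|exact: measurable_RV_preimage].
have mZB : measurable ([set w | Z n w = i] `&` W n @^-1` B).
  by apply: measurableI => //; exact: measurable_RV_preimage.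
set q := P ([set w | Z n w = i] `&` W n @^-1` B).
have qE : (fine q)%:E = q by rewrite fineK// fin_num_measure.
have c0 : 0 <= p i j * fine q by rewrite mulr_ge0// fine_ge0// /q measure_ge0.
rewrite (law_rectangles (c := NngNum c0) (m1 := mV)
  (m2 := (stieltjes_prob (GA j) \x stieltjes_prob (FS i))%E))//=.
- by rewrite EFinM qE muleA.
- move=> B2 D mB2 mD.
  have c1 : 0 <= p i j * fine q * fine (mV B2) by rewrite mulr_ge0// fine_ge0.
  rewrite (law_rectangles (c := NngNum c1) (m1 := stieltjes_prob (GA j))
    (m2 := stieltjes_prob (FS i)))//=.
  + rewrite EFinM [X in (_ * X * _)%E]fineK; last exact: fin_num_measure.
    by rewrite muleA.
  + by apply: measurableI => //; exact: measurable_RV_preimage.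
  + by move=> B3 B4 mB3 mB4; rewrite joint_law_V.
Qed.

(** On each event (Z_n, Z_{n+1}) = (i, j) the triple (V, A, S) has a product law not involving W_n;
    integrating it out produces the (i, j) term of K. *)
Lemma transition_step n (g : 'I_N -> R -> R[i]) : tuple_bm g ->
  cintegral P setT (fun w => g (Z n.+1 w) (W n.+1 w)) =
  cintegral P setT (fun w => transition p mV mS mA g (Z n w) (W n w)).
Proof.
move=> bg.
pose nxt w := next_wait (W n w) (V n w) (A n.+1 w) (S n w).
have mnxt : measurable_fun setT nxt by exact: measurable_next_wait.
have bgn i : cbounded_measurable (fun w => g i (nxt w)) by exact: cbounded_measurable_comp.
have bgW k i : cbounded_measurable (fun w => g i (W k w)) by exact: cbounded_measurable_comp.
(* Almost surely V < 0, so |V| = -V and the recursion for W_{n+1} is the overshoot formula with its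
   moduli. *)
transitivity (cintegral P setT (fun w => g (Z n.+1 w) (nxt w))).
  apply: ae_eq_cintegral.
  - exact: (cbounded_measurable_state (f := fun i w => g i (W n.+1 w))).
  - exact: (cbounded_measurable_state (f := fun i w => g i (nxt w))).
  apply: filterS (V_lt0 n) => w Vw; rewrite W_rec /nxt /next_wait /overshoot.
  rewrite (ger0_norm (S_ge0 _ _)) (ger0_norm (A_ge0 _ _)) (ger0_norm (W_ge0 _ _)).
  by rewrite (ltr0_norm Vw); congr (g _ (Num.max _ _)); ring.
rewrite (@cintegral_partition _ _ _ P ('I_N * 'I_N)%type (fun w => (Z n w, Z n.+1 w))
  (fun k w => g k.2 (nxt w))); last 2 first.
- move=> [i j]; rewrite (_ : [set _ | _] = E_ n i j); first exact: measurableI.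
  by apply/seteqP; split => w /=; [move=> [-> ->]|move=> [-> ->]].
- by move=> k; exact: bgn.
pose X : {mfun T >-> (R * (R * R))%type} := mfun_Sub (mem_set (mVAS n)).
have XE : X = VAS n :> (T -> R * (R * R)) by [].
have bK := tuple_bm_transition p mV mS mA bg.
rewrite (cintegral_partition P (f := fun i w => transition p mV mS mA g i (W n w)));
  [|exact: mZ|by move=> i; exact: cbounded_measurable_comp].
pose F i j := cintegral P [set w | (Z n w, Z n.+1 w) = (i, j)] (fun w => g j (nxt w)).
transitivity (\sum_(k : 'I_N * 'I_N) F k.1 k.2); first by apply: eq_bigr => -[].
rewrite -(pair_bigA _ F) /=; apply: eq_bigr => i _.
have bj j : cbounded_measurable (fun x : R * (R * (R * R)) =>
    g j (next_wait x.1 x.2.1 x.2.2.1 x.2.2.2)).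
  apply: (cbounded_measurable_comp (bg j)); apply: measurable_next_wait => //.
  - by apply: measurableT_comp measurable_fst _; exact: measurable_snd.
  - apply: measurableT_comp measurable_fst _.
    by apply: measurableT_comp measurable_snd _; exact: measurable_snd.
  - apply: measurableT_comp measurable_snd _.
    by apply: measurableT_comp measurable_snd _; exact: measurable_snd.
pose Kij j w := cintegral mV setT (fun v => cintegral (stieltjes_prob (GA j)) setT
  (fun a => cintegral (stieltjes_prob (FS i)) setT (fun u => g j (next_wait w v a u)))).
have bKij j : cbounded_measurable (fun w => Kij j (W n w)).
  have bG : family_bm (fun _ : unit => g).
    by move=> k; exact: (cbounded_measurable_comp (bg k) measurable_snd).
  have c1 := cbounded_measurable_cintegral (stieltjes_prob (FS i)) (next_wait_bm4 j bG).
  have c2 := cbounded_measurable_cintegral (stieltjes_prob (GA j)) c1.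
  have c3 := cbounded_measurable_cintegral mV c2.
  exact: (cbounded_measurable_comp (cbounded_measurable_section tt c3)
    (measurable_funPT (W n))).
rewrite cintegral_indic.
transitivity (cintegral P setT (fun x => \sum_j
    (p i j)%:C * ((\1_[set x | Z n x = i] x)%:C * Kij j (W n x)))); last first.
  apply: eq_cintegral => w _; rewrite mulr_sumr; apply: eq_bigr => j _.
  by rewrite mulrCA.
rewrite cintegral_sum; last first.
  move=> j; apply: cbounded_measurable_scale; apply: cbounded_measurableM => //.
  exact: cbounded_measurable_indic.
apply: eq_bigr => j _; rewrite cintegralZ; last first.
  by apply: cbounded_measurableM => //; exact: cbounded_measurable_indic.
rewrite -cintegral_indic /F.
rewrite (_ : [set _ | _] = E_ n i j); last first.
  by apply/seteqP; split => w /=; [move=> [-> ->]|move=> [-> ->]].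
have := cintegral_product_law (X := W n) (Y := X)
  (measurableI _ _ (mZ n i) (mZ n.+1 j)) (mZ n i) (p_ge0 i j)
  (joint_law_pairs i j XE) (bj j).
move=> ->; congr (_ * _); apply: eq_cintegral => w _ /=.
rewrite cintegral_prod; last exact: (cbounded_measurable_section (W n w) (bj j)).
apply: eq_cintegral => v _ /=; rewrite cintegral_prod//.
exact: (cbounded_measurable_section v (cbounded_measurable_section (W n w) (bj j))).
Qed.

(** The event in [stability] lies in one whose probability is p i l times P(Z_n = i) times the
    product mass of {S <= A}. Positivity of this product makes p i l and that mass positive. *)
Lemma stability_idle : stability Z S A -> exists i l, 0 < p i l /\
  0 < \int[stieltjes_prob (GA l)]_a \int[stieltjes_prob (FS i)]_u
    (if `|u| <= `|a| then 1 else 0 : R).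
Proof.
move=> [i [l [n]]]; rewrite /cond_prob => st; exists i, l.
pose C : set (R * R) := [set x | `|x.2| <= `|x.1|].
have mC : measurable C.
  rewrite (_ : C = (fun x : R * R => `|x.2| <= `|x.1|) @^-1` [set true]) //.
  rewrite -[X in measurable X]setTI.
  by apply: measurable_fun_ler => //; exact: measurableT_comp.
pose X : {mfun T >-> (R * (R * R))%type} := mfun_Sub (mem_set (mVAS n)).
have := joint_law_pairs (n := n) i l (X := X) erefl measurableT
  (measurableX measurableT mC).
rewrite preimage_setT !setIT (product_probability_snd mV _ mC) => jl.
have evle : (P ([set w | (S n w < A n.+1 w)%R /\ Z n.+1 w = l] `&` [set w | Z n w = i]) <=
    P (E_ n i l `&` X @^-1` (setT `*` C)))%E.
  apply: le_measure; rewrite ?inE.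
  - rewrite (_ : _ `&` _ = E_ n i l `&` (fun w => S n w < A n.+1 w) @^-1` [set true]).
      apply: measurableI; first exact: measurableI.
      rewrite -[X in measurable X]setTI.
      by apply: measurable_fun_ltr => //.
    by apply/seteqP; split => w /=; [move=> [[? ?] ?]|move=> [[? ?] ?]].
  - apply: measurableI; first exact: measurableI.
    by rewrite -[X in measurable X]setTI; apply: measurable_funPT => //; exact: measurableX.
  - move=> w /= [[SA Zl] Zi]; split => //; split => //=.
    by rewrite /C /= (ger0_norm (S_ge0 _ _)) (ger0_norm (A_ge0 _ _)) ltW.
have evgt0 : (0 < P (E_ n i l `&` X @^-1` (setT `*` C)))%E.
  apply: lt_le_trans evle; rewrite lt_neqAle measure_ge0 andbT; apply/eqP => h.
  by move: st; rewrite -h mul0r ltxx.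
move: evgt0; rewrite jl => pos.
have pil : 0 < p i l.
  by rewrite lt_neqAle p_ge0 andbT; apply: contraTneq pos => <-; rewrite mul0e ltxx.
split => //.
have mu0 : (0 < (stieltjes_prob (GA l) \x stieltjes_prob (FS i))%E C)%E.
  rewrite lt_neqAle measure_ge0 andbT; apply/eqP => h.
  by move: pos; rewrite -[X in (_ < _ * (_ * X))%E]h !mule0 ltxx.
have bC : cbounded_measurable (fun x : R * R => (if `|x.2| <= `|x.1| then 1 else 0 : R)%:C).
  apply: cbounded_measurable_real; split.
    apply: measurable_fun_ifT => //.
    by apply: measurable_fun_ler; exact: measurableT_comp.
  by exists 1 => x; case: ifP => _; rewrite ?normr1 ?normr0.
have := congr1 (@complex.Re R) (cintegral_prod (stieltjes_prob (GA l)) (stieltjes_prob (FS i)) bC).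
rewrite /= => <-.
rewrite (_ : (fun x : R * R => _) = \1_C); last first.
  by apply/funext => x; rewrite indicE /C; case: ifPn => h; [rewrite mem_set|rewrite memNset//; exact/negP].
rewrite /Rintegral integral_indic// setIT fine_gt0// mu0 /=.
apply: (@le_lt_trans _ _ 1%E); last exact: ltry.
exact: (@probability_le1 _ _ _ (stieltjes_prob (GA l) \x stieltjes_prob (FS i))%E _ mC).
Qed.

End process.

(** * Exponential laws *)

Section exponential_law.
Context {R : realType}.
Variable (l : R).
Hypothesis l_gt0 : 0 < l.

Let expo : probability (measurableTypeR R) R.
Proof.
refine (exponential_prob l : probability (measurableTypeR R) R).
exact: l_gt0.
Defined.

Let idR : measurableTypeR R -> R := idfun.

#[local] HB.instance Definition _ :=
  @isMeasurableFun.Build _ _ _ _ idR (@measurable_id _ _ setT).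

Definition exponential_law : probability R R := distribution expo idR.

Let mpdf : measurable_fun setT (exponential_pdf l).
Proof. exact: measurable_exponential_pdf. Qed.

Let expo_dom : expo `<< (@lebesgue_measure R).
Proof.
apply/null_content_dominatesP => A mA muA0.
change ((\int[lebesgue_measure]_(x in A) (exponential_pdf l x)%:E)%E = 0%E).
apply: null_set_integral => //; apply/measurable_EFinP.
exact: measurable_funTS.
Qed.

(** The law is defined by a density, hence its Radon-Nikodym derivative agrees almost everywhere
    with [exponential_pdf]. *)
Let integral_expo (f : R -> R) : bounded_measurable f ->
  (\int[expo]_x (f x)%:E =
   \int[lebesgue_measure]_x ((f x)%:E * (exponential_pdf l x)%:E))%E.
Proof.
move=> bf; have [mf _] := bf.
have mf' : measurable_fun [set: measurableTypeR R] (EFin \o f).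
  by apply/measurable_EFinP.
rewrite -(Radon_Nikodym_change_of_variables expo_dom measurableT); last first.
  exact: (@bounded_measurable_integrable _ _ (measurableTypeR R) expo f bf).
apply: ae_eq_integral => //.
- exact: emeasurable_funM.
- by apply: emeasurable_funM => //; apply/measurable_EFinP.
- apply: ae_eqe_mul2l; apply: integral_ae_eq => //.
  + apply: Radon_Nikodym_integrable; exact: expo_dom.
  + by apply/measurable_EFinP.
  + by move=> E _ mE; rewrite -Radon_Nikodym_integral//; exact: expo_dom.
Qed.

Lemma Rintegral_exponential_law (f : R -> R) : bounded_measurable f ->
  (forall x, 0 <= f x) ->
  \int[exponential_law]_x f x =
  \int[lebesgue_measure]_(x in `[0, +oo[) (f x * (l * expR (- l * x))).
Proof.
move=> bf f0; have [mf _] := bf.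
transitivity (\int[expo]_x f x).
  congr fine.
  apply: (@integral_distribution _ _ _ _ _ _ (idR : {RV expo >-> R}) (EFin \o f)).
    by apply/measurable_EFinP.
  exact: (@bounded_measurable_integrable _ _ (measurableTypeR R) expo f bf).
rewrite /Rintegral integral_expo//; congr fine.
rewrite [RHS]integral_mkcond; apply: eq_integral => x _.
rewrite patchE -EFinM /exponential_pdf patchE.
by case: ifP => // _; rewrite mulr0.
Qed.

Let is_derive_continuous (f f' : R -> R) :
  (forall x : R, is_derive x 1 f (f' x)) -> continuous f.
Proof.
by move=> df x; apply/differentiable_continuous/derivable1_diffP.
Qed.

(** The improper fundamental theorem of calculus is applied to a nonnegative integrand, hence the
    added 1, which outweighs the real part because |z0| <= 1. The factor z0, taken later as 1 and as
    -i, recovers both components of the transform. *)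
Let Re_exponential_transform (z0 z : R[i]) : 0 <= complex.Re z ->
  normc z0 <= 1 ->
  \int[exponential_law]_x (1 + complex.Re (z0 * exp_kernel z x)) =
  1 + complex.Re (z0 * (l%:C / (l%:C + z))).
Proof.
move=> z_ge0 z01.
have lz0 : l%:C + z != 0.
  apply/eqP => h; have : complex.Re (l%:C + z) = 0 by rewrite h.
  by rewrite ReD /= => /eqP; rewrite gt_eqF// ltr_wpDr.
have bk : cbounded_measurable (fun x => z0 * exp_kernel z x).
  by apply: cbounded_measurable_scale; exact: cbounded_measurable_exp_kernel.
have k1 x : `|complex.Re (z0 * exp_kernel z x)| <= 1.
  rewrite (le_trans (normc_Re _))// normcM -[leRHS]mulr1.
  by rewrite ler_pM ?normc_ge0// exp_kernel_bound.
have k0 x : 0 <= 1 + complex.Re (z0 * exp_kernel z x).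
  by have := k1 x; rewrite ler_norml -subr_ge0 opprK addrC => /andP[].
rewrite Rintegral_exponential_law//; last first.
  have [mr _] := cbounded_measurable_Re bk.
  split; first exact: measurable_funD.
  exists (1 + 1) => x; rewrite (le_trans (ler_normD _ _))// normr1 lerD2l.
  exact: k1.
(* Re c is an antiderivative, on x >= 0, of the integrand with its exponential density; c'' serves
   for the continuity of c'. *)
pose c (x : R) : R[i] := -1 * cexp (- l%:C * x%:C) +
  - (z0 * (l%:C / (l%:C + z))) * cexp (- (l%:C + z) * x%:C).
pose c' (x : R) : R[i] := -1 * (- l%:C * cexp (- l%:C * x%:C)) +
  - (z0 * (l%:C / (l%:C + z))) * (- (l%:C + z) * cexp (- (l%:C + z) * x%:C)).
pose c'' (x : R) : R[i] := -1 * (- l%:C * (- l%:C * cexp (- l%:C * x%:C))) +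
  - (z0 * (l%:C / (l%:C + z))) *
    (- (l%:C + z) * (- (l%:C + z) * cexp (- (l%:C + z) * x%:C))).
have dc : curve_derive c c'.
  by apply: curve_deriveD; apply: curve_deriveZ; exact: curve_derive_cexp.
have dc' : curve_derive c' c''.
  by apply: curve_deriveD; apply: curve_deriveZ; apply: curve_deriveZ;
    exact: curve_derive_cexp.
have c'E x : 0 <= x -> complex.Re (c' x) =
    (1 + complex.Re (z0 * exp_kernel z x)) * (l * expR (- l * x)).
  move=> x0; have -> : c' x = (1 + z0 * exp_kernel z x) * (l * expR (- l * x))%:C.
    have E1 : cexp (- l%:C * x%:C) = (expR (- l * x))%:C.
      have -> : - l%:C * x%:C = (- l * x)%:C by rewrite -rmorphN -rmorphM.
      by apply: complex_eqP; rewrite /= ?cos0 ?sin0 ?mulr1 ?mulr0.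
    have E2 : cexp (- (l%:C + z) * x%:C) = (expR (- l * x))%:C * cexp (- z * x%:C).
      by rewrite -E1 -cexpD; congr cexp; ring.
    rewrite /c' E1 E2 /exp_kernel ger0_norm// rmorphM /=.
    by field.
  by rewrite Re_mul_real ReD.
have Fc : (\int[lebesgue_measure]_(x in `[0%R, +oo[) (complex.Re (c' x))%:E =
    0%:E - (complex.Re (c 0))%:E)%E.
  apply: (@ge0_continuous_FTC2y _ (fun x => complex.Re (c' x))
    (fun x => complex.Re (c x))).
  - by move=> x x0; rewrite c'E// !mulr_ge0 ?expR_ge0// ltW.
  - apply: continuous_subspaceT.
    by apply: (@is_derive_continuous _ (fun x => complex.Re (c'' x))) => x; have [] := dc' x.
  - set B := 1 + normc (z0 * (l%:C / (l%:C + z))).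
    have cB (x : R) : 0 <= x -> `|complex.Re (c x)| <= B * expR (- (l * x)).
      move=> x0; rewrite (le_trans (normc_Re _))// /c (le_trans (le_normcD _ _))//.
      rewrite !normcM !normcN normc1 mul1r -!normcM normcM !normc_cexp mulrDl mul1r.
      rewrite !Re_mul_real !ReN ReD /= mulNr lerD2l ler_wpM2l ?normc_ge0//.
      by rewrite ler_expR mulNr lerN2 ler_wpM2r// lerDl.
    have lim : B * expR (- (l * x)) @[x --> +oo] --> (0 : R).
      rewrite -[X in _ --> X](mulr0 B); apply: cvgMr.
      apply: (@cvg_comp _ _ _ (fun x => l * x) (fun y => expR (- y)) _ (pinfty_nbhs R)).
        exact: gt0_cvgMry.
      exact: cvgr_expR.
    apply/cvgr0Pnorm_le => e e0; near=> x.
    have x0 : 0 <= x by near: x; exact: nbhs_pinfty_ge.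
    rewrite (le_trans (cB x x0))//.
    have B0 : 0 <= B by rewrite addr_ge0// normc_ge0.
    rewrite -[leLHS]ger0_norm; last by rewrite mulr_ge0// expR_ge0.
    near: x; move: e e0; exact/cvgr0Pnorm_le.
  - by move=> x _; have [[]] := dc x.
  - apply: cvg_at_right_filter.
    by apply: (@is_derive_continuous _ (fun x => complex.Re (c' x))) => x; have [] := dc x.
  - move=> x _; rewrite derive1E; have [h _] := dc x; exact: derive_val.
have -> : \int[lebesgue_measure]_(x in `[0, +oo[)
    ((1 + complex.Re (z0 * exp_kernel z x)) * (l * expR (- l * x))) =
    \int[lebesgue_measure]_(x in `[0, +oo[) complex.Re (c' x).
  by apply: eq_Rintegral => x; rewrite inE /= in_itv /= andbT => x0; rewrite c'E.
rewrite /Rintegral Fc /= /c !mulr0 !cexp0 !mulr1 ReD !ReN /= .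
by rewrite sub0r opprD !opprK.
Unshelve. all: by end_near. Qed.

Lemma exponential_transform (z : R[i]) : 0 <= complex.Re z ->
  cintegral exponential_law setT (exp_kernel z) = l%:C / (l%:C + z).
Proof.
move=> z0; have bk : cbounded_measurable (exp_kernel z).
  exact: cbounded_measurable_exp_kernel.
have key (z1 : R[i]) : normc z1 <= 1 ->
    complex.Re (cintegral exponential_law setT (fun x => z1 * exp_kernel z x)) =
    complex.Re (z1 * (l%:C / (l%:C + z))).
  move=> z1le; apply: (addrI 1); rewrite -Re_exponential_transform// RintegralD//.
  - by rewrite Rintegral_cst// fine_probability_setT mulr1.
  - by apply: bounded_measurable_integrable; split => //; exists `|1|.
  - by apply: bounded_measurable_integrable; apply: cbounded_measurable_Re;
      exact: cbounded_measurable_scale.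
apply: complex_eqP.
- have := key 1; rewrite normc1 => /(_ (lexx _)); rewrite mul1r => <-.
  by congr complex.Re; apply: eq_cintegral => x _; rewrite mul1r.
- have i1 : normc (0 -i* 1 : R[i]) <= 1.
    by rewrite normcE /= expr0n add0r sqrrN expr1n sqrtr1.
  have := key _ i1; rewrite cintegralZ//.
  by rewrite !ReM /= !mul0r !sub0r !mulN1r !opprK.
Qed.

End exponential_law.

(** * The limit functional *)

Section sequences_to.
Context {R : realType}.
Implicit Types (u v : nat -> R[i]) (l z : R[i]).

(** Convergence in R[i] in epsilon form; [cvg_complex] translates it into the topological
    statement. *)
Definition tends u l := forall e : R, 0 < e ->
  exists n0, forall n, (n0 <= n)%N -> normc (u n - l) <= e.

Lemma tends_cst l : tends (fun=> l) l.
Proof. by move=> e e0; exists 0%N => n _; rewrite subrr normc0 ltW. Qed.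

Lemma tendsD u v k l : tends u k -> tends v l -> tends (fun n => u n + v n) (k + l).
Proof.
move=> hu hv e e0; have e20 : 0 < e / 2 by rewrite divr_gt0.
have [n1 h1] := hu _ e20; have [n2 h2] := hv _ e20.
exists (maxn n1 n2) => n; rewrite geq_max => /andP[n1n n2n].
by rewrite opprD addrACA (le_trans (le_normcD _ _))// [e]splitr lerD ?h1 ?h2.
Qed.

Lemma tendsZ z u l : tends u l -> tends (fun n => z * u n) (z * l).
Proof.
move=> hu e e0; have z0 : 0 < normc z + 1 by rewrite ltr_wpDl ?normc_ge0.
have [n1 h1] := hu _ (divr_gt0 e0 z0); exists n1 => n n1n.
rewrite -mulrBr normcM (le_trans (ler_wpM2l (normc_ge0 _) (h1 _ n1n)))//.
by rewrite mulrCA -[leRHS]mulr1 ler_wpM2l ?(ltW e0)// ler_pdivrMr ?mul1r ?lerDl.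
Qed.

Lemma tends_unique u k l : tends u k -> tends u l -> k = l.
Proof.
move=> hk hl; apply/eqP; rewrite -subr_eq0; apply/eqP; apply: eq0_normc.
apply/eqP; rewrite eq_le normc_ge0 andbT; apply/ler_addgt0Pr => e e0; rewrite add0r.
have e20 : 0 < e / 2 by rewrite divr_gt0.
have [n1 h1] := hk _ e20; have [n2 h2] := hl _ e20; pose n := maxn n1 n2.
have -> : k - l = (u n - l) - (u n - k) by ring.
by rewrite (le_trans (normcB _ _))// [e]splitr lerD ?h1 ?h2 ?leq_maxl ?leq_maxr.
Qed.

Lemma tends_shift u l : tends u l -> tends (fun n => u n.+1) l.
Proof.
by move=> hu e e0; have [n0 h0] := hu e e0; exists n0 => n n0n; exact/h0/leqW.
Qed.

Lemma tends_Re u l : tends u l ->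
  (complex.Re (u n) @[n --> \oo] --> complex.Re l).
Proof.
move=> hu; apply/cvgrPdist_le => e e0; have [n0 h0] := hu e e0.
by exists n0 => // n n0n; rewrite -normrN opprB -ReN -ReD (le_trans (normc_Re _))// h0.
Qed.

Lemma tends_Im u l : tends u l ->
  (complex.Im (u n) @[n --> \oo] --> complex.Im l).
Proof.
move=> hu; apply/cvgrPdist_le => e e0; have [n0 h0] := hu e e0.
by exists n0 => // n n0n; rewrite -normrN opprB -ImN -ImD (le_trans (normc_Im _))// h0.
Qed.

Lemma tends_ReIm u l : complex.Re (u n) @[n --> \oo] --> complex.Re l ->
  complex.Im (u n) @[n --> \oo] --> complex.Im l -> tends u l.
Proof.
move=> /cvgrPdist_le hr /cvgrPdist_le hi e e0.
have e20 : 0 < e / 2 by rewrite divr_gt0.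
have [n1 _ h1] := hr _ e20; have [n2 _ h2] := hi _ e20.
exists (maxn n1 n2) => n; rewrite geq_max => /andP[n1n n2n].
rewrite (le_trans (normc_le_ReIm _))// [e]splitr ReD ImD ReN ImN lerD//.
- by rewrite distrC; exact: h1.
- by rewrite distrC; exact: h2.
Qed.

Lemma tends_normc u l (B : R) : tends u l -> (forall n, normc (u n) <= B) ->
  normc l <= B.
Proof.
move=> hu uB; apply/ler_addgt0Pr => e e0; have [n0 h0] := hu e e0.
have -> : l = u n0 - (u n0 - l) by rewrite subKr.
by rewrite (le_trans (normcB _ _))// lerD// h0.
Qed.

Lemma cintegral_tends d (T : measurableType d)
    (mu : {finite_measure set T -> \bar R}) (f : nat -> T -> R[i])
    (g : T -> R[i]) (B : R) :
  (forall n, cbounded_measurable (f n)) -> cbounded_measurable g ->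
  (forall n x, normc (f n x) <= B) -> (forall x, tends (f^~ x) (g x)) ->
  tends (fun n => cintegral mu setT (f n)) (cintegral mu setT g).
Proof.
move=> bf [mr mi _] fB fg; apply: tends_ReIm => /=.
- apply: (@Rintegral_cvg _ _ _ _ _ _ B) => //.
  + by move=> n; case: (bf n).
  + by move=> n x; exact: le_trans (normc_Re _) (fB n x).
  + by move=> x; exact: tends_Re (fg x).
- apply: (@Rintegral_cvg _ _ _ _ _ _ B) => //.
  + by move=> n; case: (bf n).
  + by move=> n x; exact: le_trans (normc_Im _) (fB n x).
  + by move=> x; exact: tends_Im (fg x).
Qed.

End sequences_to.

Section limit_functional.
Context {R : realType} {N : nat}.
Variables (p : 'M[R]_N) (mV : probability R R) (mS mA : 'I_N -> probability R R).
Hypothesis p_ge0 : forall i j, 0 <= p i j.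
Hypothesis p_sum1 : forall i, \sum_j p i j = 1.
Implicit Types (g h : 'I_N -> R -> R[i]) (z : R[i]).
Implicit Types rho : ('I_N -> R -> R[i]) -> R[i].

Local Notation K := (transition p mV mS mA).

Variable i0 : 'I_N.
Variable ell : ('I_N -> R -> R[i]) -> R[i].
Hypothesis ellP : forall g, tuple_bm g -> forall e : R, 0 < e ->
  exists n0, forall n, (n0 <= n)%N -> forall i w,
    normc (iter n K g i w - ell g) <= e.

(** Uniform in n, whereas iterating [transition_bound] would give 8^n: positivity of K preserves the
    real bounds -B and B, and the factor 2 recombines real and imaginary parts. *)
Lemma iter_bound g (B : R) n i w : tuple_bm g ->
  (forall i w, normc (g i w) <= B) -> normc (iter n K g i w) <= 2 * B.
Proof.
move=> bg gB.
have re h : tuple_bm h -> (forall i w, normc (h i w) <= B) ->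
    `|complex.Re (iter n K h i w)| <= B.
  move=> bh hB; rewrite ler_norml.
  have hb : iter_between p mV mS mA h 0 (- B) B.
    by move=> j x; rewrite -ler_norml (le_trans (normc_Re _))//; exact: hB.
  by have := iter_between_add p_ge0 p_sum1 n bh hb i w; rewrite addn0.
rewrite (le_trans (normc_le_ReIm _))// mulr2n mulrDl mul1r lerD ?re//.
have ok := regular_iter_eval mV mS mA p_ge0 p_sum1 n i w.
have -> : complex.Im (iter n K g i w) =
    complex.Re (iter n K (fun i w => (0 -i* 1) * g i w) i w).
  by rewrite (regularZ ok)// ReM /= mul0r mulN1r opprK add0r.
apply: re; first exact: tuple_bmZ.
by move=> j x; rewrite normcM normcE /= expr0n add0r sqrrN expr1n sqrtr1 mul1r.
Qed.

Lemma ell_eval g i w : tuple_bm g -> tends (fun n => iter n K g i w) (ell g).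
Proof. by move=> bg e e0; have [n0 h0] := ellP bg e0; exists n0 => n n0n; exact: h0. Qed.

(** Uniform convergence of K^n g to a constant passes through any bounded functional. Both the limit
    of the transforms of W_n and the uniqueness of the coefficients rest on this. *)
Lemma regular_tends rho g : regular_functional rho -> tuple_bm g ->
  tends (fun n => rho (iter n K g)) (ell g * rho (fun _ _ => 1)).
Proof.
move=> ok bg e e0; have [B B0 hB] := regular_bound ok.
have B1 : 0 < B + 1 by rewrite ltr_wpDl.
have [n0 h0] := ellP bg (divr_gt0 e0 B1); exists n0 => n n0n.
have bi := tuple_bm_iter p mV mS mA n bg.
rewrite -mulNr -(regularZ ok); last exact: tuple_bm_cst.
rewrite -(regularD ok)//; last exact/tuple_bmZ/tuple_bm_cst.
rewrite (le_trans (hB _ (e / (B + 1)) _ _))//.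
- by apply: tuple_bmD => //; exact/tuple_bmZ/tuple_bm_cst.
- by move=> i w; rewrite mulr1; exact: h0.
- by rewrite mulrCA -[leRHS]mulr1 ler_wpM2l ?(ltW e0)// ler_pdivrMr ?mul1r ?lerDl.
Qed.

Lemma ell_transition g : tuple_bm g -> ell (K g) = ell g.
Proof.
move=> bg; apply: (@tends_unique _ (fun n => iter n.+1 K g i0 0)).
  under eq_fun do rewrite iterSr.
  exact/ell_eval/tuple_bm_transition.
exact: (tends_shift (ell_eval i0 0 bg)).
Qed.

(** Each property passes to the limit from the evaluations of K^n at (i0, 0): measurability as a
    pointwise limit, Fubini by dominated convergence with the bound of [iter_bound]. *)
Lemma regular_ell : regular_functional ell.
Proof.
have ev n := regular_iter_eval mV mS mA p_ge0 p_sum1 n i0 0.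
have bG (G : R -> 'I_N -> R -> R[i]) : family_bm G ->
    cbounded_measurable (fun y => ell (G y)).
  move=> fG; have bGy y : tuple_bm (G y) by exact: family_bm_tuple.
  have /choice[B hB] : forall i, exists B, forall x, normc (G x.1 i x.2) <= B.
    by move=> i; have [_ _ [B hB]] := fG i; exists B.
  have GB y i w : normc (G y i w) <= \sum_i B i.
    rewrite (bigD1 i)//= (le_trans (hB i (y, w)))// lerDl.
    by rewrite sumr_ge0// => j _; exact: le_trans (normc_ge0 _) (hB j (0, 0)).
  split.
  - apply: (measurable_fun_cvg (h := fun n y => complex.Re (iter n K (G y) i0 0))).
      by move=> n; have [] := regular_bm (ev n) fG.
    by move=> y _; exact: (tends_Re (ell_eval i0 0 (bGy y))).
  - apply: (measurable_fun_cvg (h := fun n y => complex.Im (iter n K (G y) i0 0))).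
      by move=> n; have [] := regular_bm (ev n) fG.
    by move=> y _; exact: (tends_Im (ell_eval i0 0 (bGy y))).
  - exists (2 * \sum_i B i) => y.
    apply: (tends_normc (ell_eval i0 0 (bGy y))) => n; exact: iter_bound.
split => //.
- move=> g h bg bh; apply: (@tends_unique _ (fun n => iter n K (fun i w => g i w + h i w) i0 0)).
    exact/ell_eval/tuple_bmD.
  under eq_fun do rewrite (regularD (ev _))//.
  by apply: tendsD; exact: ell_eval.
- move=> z g bg; apply: (@tends_unique _ (fun n => iter n K (fun i w => z * g i w) i0 0)).
    exact/ell_eval/tuple_bmZ.
  under eq_fun do rewrite (regularZ (ev _))//.
  by apply: tendsZ; exact: ell_eval.
- exists 2 => // g M bg gM.
  by apply: (tends_normc (ell_eval i0 0 bg)) => n; exact: iter_bound.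
- move=> Q G fG; have bGy y : tuple_bm (G y) by exact: family_bm_tuple.
  have bI : tuple_bm (fun i w => cintegral Q setT (fun y => G y i w)).
    move=> i; exact: (cbounded_measurable_cintegral Q
      (cbounded_measurable_comp (fG i) (@measurable_swap _ _ R R))).
  have /choice[B hB] : forall i, exists B, forall x, normc (G x.1 i x.2) <= B.
    by move=> i; have [_ _ [B hB]] := fG i; exists B.
  have GB y i w : normc (G y i w) <= \sum_i B i.
    rewrite (bigD1 i)//= (le_trans (hB i (y, w)))// lerDl.
    by rewrite sumr_ge0// => j _; exact: le_trans (normc_ge0 _) (hB j (0, 0)).
  apply: (@tends_unique _ (fun n =>
    iter n K (fun i w => cintegral Q setT (fun y => G y i w)) i0 0)).
    exact: ell_eval.
  under eq_fun do rewrite (regular_Fubini (ev _))//.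
  apply: (@cintegral_tends _ _ _ Q _ _ (2 * \sum_i B i)).
  + by move=> n; exact: (regular_bm (ev n)).
  + exact: bG.
  + by move=> n y; exact: iter_bound.
  + by move=> y; exact: ell_eval.
Qed.

End limit_functional.

Section model_facts.
Context {R : realType}.

Lemma stieltjes_halfline_ge0 (F : cumulativeBounded (0 : R) (1 : R)) :
  (forall x, x < 0 -> F x = 0) ->
  lebesgue_stieltjes_measure F `[0, +oo[%classic = 1%E.
Proof.
move=> F0.
(* The open half-line is exhausted by ]-oo, -1/(n+1)], where F vanishes; an atom at 0 stays in the
   complement. *)
have neg0 : lebesgue_stieltjes_measure F `]-oo, 0[%classic = 0%E.
  have -> : `]-oo, 0[%classic = \bigcup_n `]-oo, (- n.+1%:R^-1 : R)]%classic.
    apply/seteqP; split => x /=; rewrite in_itv /=.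
      move=> x0; exists (Num.bound (- x)^-1) => //=; rewrite in_itv /= lerNr.
      have nx : 0 < - x by rewrite oppr_gt0.
      rewrite invf_ple ?posrE// ltW//.
      rewrite (lt_le_trans (archi_boundP _)) ?invr_ge0 ?(ltW nx)//.
      by rewrite ler_nat.
    by move=> [n _]; rewrite /= in_itv /= => /le_lt_trans; apply; rewrite oppr_lt0.
  apply/eqP; rewrite -measure_le0.
  set I := fun n => `]-oo, (- n.+1%:R^-1 : R)]%classic.
  apply: (@le_trans _ _ (\sum_(0 <= n <oo) lebesgue_stieltjes_measure F (I n))%E).
    have mI n : measurable (I n) by exact: measurable_itv.
    by apply: measure_sigma_subadditive => //; exact: bigcupT_measurable.
  rewrite eseries0// => n _ _.
  by rewrite lebesgue_stieltjes_halfline F0// oppr_lt0.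
have := probability_setC (lebesgue_stieltjes_measure F) (measurable_itv `]-oo, (0:R)[).
rewrite setCitvl => ->; transitivity (1 - 0 : \bar R)%E; last exact: sube0.
by congr (1 - _)%E; exact: neg0.
Qed.

Lemma LST_stieltjes_prob (F : cumulativeBounded (0 : R) (1 : R)) (s : R[i]) :
  (forall x, x < 0 -> F x = 0) -> 0 <= complex.Re s ->
  LST F s = cintegral (stieltjes_prob F) setT (exp_kernel s).
Proof.
move=> F0 s0; have bk : cbounded_measurable (exp_kernel s).
  exact: cbounded_measurable_exp_kernel.
rewrite /LST (@cintegral_full _ _ (measurableTypeR R) (lebesgue_stieltjes_measure F)
  _ _ (exp_kernel s)) //.
- apply: complex_eqP => /=.
  + exact: (esym (Rintegral_stieltjes_prob F (cbounded_measurable_Re bk))).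
  + exact: (esym (Rintegral_stieltjes_prob F (cbounded_measurable_Im bk))).
- exact: stieltjes_halfline_ge0.
- by move=> x /=; rewrite in_itv /= andbT /exp_kernel => x0; rewrite ger0_norm.
Qed.

Lemma distribution_lt0 d (T : measurableType d) (P : probability T R)
    (X : {RV P >-> R}) : {ae P, forall w, X w < 0} ->
  distribution P X `]-oo, 0[%classic = 1%E.
Proof.
move=> X0; rewrite /distribution /pushforward.
have mX : measurable (X @^-1` `]-oo, 0[%classic).
  by rewrite -[Y in measurable Y]setTI; exact: measurable_funPT.
have neg0 : P (~` (X @^-1` `]-oo, 0[%classic)) = 0%E.
  apply: measure_negligible; first exact: measurableC.
  by apply: negligibleS X0 => w /= h; move: h; rewrite in_itv.
have := probability_setC P (measurableC mX).
by rewrite setCK neg0 sube0.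
Qed.

End model_facts.

(** * Existence and uniqueness of the coefficients *)

Section partial_fractions.
Context {F : fieldType} (I : finType) (tau : I -> F).
Hypothesis tau_inj : injective tau.

(** a is the coefficient of degree |I|, the denominator being monic. The rest r has smaller degree,
    so Lagrange interpolation at the distinct tau k recovers it, and its coefficients are the
    residues b k. *)
Lemma partial_fractions (E : {poly F}) : (size E <= #|I|.+1)%N ->
  exists (a : F) (b : I -> F), forall s, (\prod_k ('X - (tau k)%:P)).[s] != 0 ->
    E.[s] / (\prod_k ('X - (tau k)%:P)).[s] = a + \sum_k b k / (s - tau k).
Proof.
move=> sE; set D := \prod_k _.
have mD : D \is monic by exact: monic_prod_XsubC.
have sD : size D = #|I|.+1.
  by rewrite /D size_prod_XsubC -sum1_size sum1_card.
pose a := E`_#|I|; pose r := E - a *: D.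
have sr : (size r <= #|I|)%N.
  apply/leq_sizeP => j; rewrite leq_eqVlt => /predU1P[<-|Ij].
    rewrite coefB coefZ; have := monicP mD; rewrite lead_coefE sD /= => ->.
    by rewrite mulr1 subrr.
  have Ej : E`_j = 0 by rewrite nth_default// (leq_trans sE).
  by rewrite coefB coefZ Ej nth_default ?sD// mulr0 subrr.
pose P k := \prod_(l | l != k) ('X - (tau l)%:P).
have P0 k : (P k).[tau k] != 0.
  rewrite horner_prod; apply/prodf_neq0 => l lk.
  by rewrite hornerXsubC subr_eq0; apply: contra lk => /eqP/tau_inj ->.
have Pl k l : l != k -> (P k).[tau l] = 0.
  by move=> lk; rewrite horner_prod (bigD1 l)//= hornerXsubC subrr mul0r.
have sP k : size (P k) = #|I|.
  have DP : D = P k * ('X - (tau k)%:P) by rewrite /D (bigD1 k)//= mulrC.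
  have P_neq0 : P k != 0 by exact/monic_neq0/monic_prod_XsubC.
  have := sD; rewrite DP size_Mmonic ?monicXsubC// size_XsubC addn2 /=.
  by case.
pose b k := r.[tau k] / (P k).[tau k].
have rE : r = \sum_k b k *: P k.
  apply/eqP; rewrite -subr_eq0; apply/eqP.
  apply: (@roots_geq_poly_eq0 _ _ (map tau (enum I))).
  - apply/allP => _ /mapP[k _ ->]; apply/eqP.
    rewrite hornerD hornerN horner_sum (bigD1 k)//= big1 ?addr0.
      by rewrite hornerZ /b divfK// subrr.
    by move=> l lk; rewrite hornerZ Pl ?mulr0// eq_sym.
  - by rewrite map_inj_uniq// enum_uniq.
  - rewrite size_map -cardE (leq_trans (size_polyD _ _))// geq_max sr size_polyN.
    apply: (leq_trans (size_sum _ _ _)); apply/bigmax_leqP => k _.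
    by rewrite (leq_trans (size_scale_leq _ _))// sP.
exists a, b => s Ds.
have -> : E = a *: D + r by rewrite /r addrC subrK.
rewrite hornerD hornerZ mulrDl mulfK//; congr (_ + _).
rewrite rE horner_sum mulr_suml; apply: eq_bigr => k _.
rewrite hornerZ -mulrA; congr (_ * _).
have DE : D.[s] = (s - tau k) * (P k).[s].
  by rewrite /D (bigD1 k)//= hornerM hornerXsubC.
move: Ds; rewrite DE mulf_eq0 negb_or => /andP[sk Pk].
by rewrite invfM mulrCA mulfV// mulr1.
Qed.

End partial_fractions.

Section rational_functional.
Context {R : realType} {N : nat}.
Variables (m : 'I_N -> nat) (t : forall i : 'I_N, 'I_(m i) -> R[i]).
Hypothesis t_lt0 : forall i (f : 'I_(m i)), complex.Re (t f) < 0.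
Hypothesis t_inj : distinct_poles t.

Local Notation D := (\prod_k denom t k).
Local Notation M := (total_degree m).

(* 1 / (s - z) is the transform of the complex density e^{zu} on [0, +oo[,
   written as a bounded density against an exponential law. *)
Lemma pole_functional (i : 'I_N) (z : R[i]) : complex.Re z < 0 ->
  exists rho : ('I_N -> R -> R[i]) -> R[i], regular_functional rho /\
    forall j s, 0 <= complex.Re s ->
      rho (state_exp j s) = if i == j then (s - z)^-1 else 0.
Proof.
move=> z0; have l0 : 0 < - complex.Re z by rewrite oppr_gt0.
(* With l = -Re z, the density exp(zu) is 1/l times the exponential density of parameter l times
   exp(i u Im z), and this unimodular factor is [exp_kernel z1] on u >= 0. *)
pose mu := exponential_law l0.
pose z1 : R[i] := 0 -i* complex.Im z.
have z1_0 : 0 <= complex.Re z1 by [].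
have bt : cbounded_measurable (fun u : R => exp_kernel z1 u).
  exact: cbounded_measurable_exp_kernel.
have mi j : measurable [set x : R | i = j].
  have [ij|/eqP ij] := eqVneq i j.
    by rewrite (_ : [set _ | _] = setT)//; apply/seteqP; split.
  by rewrite (_ : [set _ | _] = set0)//; apply/seteqP; split.
have ok0 := @regular_atom _ N _ _ mu (exp_kernel z1) (fun=> i) id bt
  mi (@measurable_id _ _ _).
pose rho (g : 'I_N -> R -> R[i]) := \sum_(k < 1) (- complex.Re z)%:C^-1 *
  cintegral mu setT (fun x => exp_kernel z1 x * g i x).
exists rho; split; first exact: (regular_lincomb _ _ (fun=> ok0)).
move=> j s s0; rewrite /rho big_ord1 /state_exp; case: eqP => _; last first.
  under eq_cintegral do rewrite mulr0.
  by rewrite cintegral_prob_cst mulr0.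
have sz1 : 0 <= complex.Re (z1 + s) by rewrite ReD addr_ge0.
rewrite (@eq_cintegral _ _ _ _ _ _ (exp_kernel (z1 + s))); last first.
  by move=> x _; rewrite /exp_kernel -cexpD; congr cexp; ring.
rewrite exponential_transform// mulrA mulVf ?mul1r; last first.
  by rewrite -(rmorph0 (real_complex R)) (inj_eq (@complexI R)) gt_eqF.
by congr (_^-1); apply: complex_eqP; rewrite ?ReD ?ImD ?ReN ?ImN /=; ring.
Qed.

(** By partial fractions: the constant term is the transform of an atom at w = 0, each simple
    fraction that of a [pole_functional], and the part placed in state i is seen by e_{j,s} only for
    j = i. *)
Lemma rational_functional (E : 'I_N -> {poly R[i]}) :
  (forall j, (size (E j) <= M.+1)%N) ->
  exists rho : ('I_N -> R -> R[i]) -> R[i], regular_functional rho /\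
    forall j s, 0 <= complex.Re s -> rho (state_exp j s) = (E j).[s] / D.[s].
Proof.
move=> sE.
pose I := {k : 'I_N & 'I_(m k)}; pose tau (k : I) := t (tagged k).
have DE : D = \prod_(k : I) ('X - (tau k)%:P).
  by rewrite /denom (sig_big_dep _ _ (fun k f => 'X - (t f)%:P)) /=.
have /choice[a /choice[b ab]] : forall j, exists (a : R[i]) (b : I -> R[i]),
    forall s, D.[s] != 0 -> (E j).[s] / D.[s] = a + \sum_k b k / (s - tau k).
  by move=> j; rewrite DE; apply: (partial_fractions t_inj); rewrite card_poles.
have /choice[rho hrho] : forall x : 'I_N * I, exists rho : ('I_N -> R -> R[i]) -> R[i],
    regular_functional rho /\ forall j s, 0 <= complex.Re s ->
      rho (state_exp j s) = if x.1 == j then (s - tau x.2)^-1 else 0.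
  by move=> [i k]; exact: (pole_functional i (t_lt0 (tagged k))).
(* [None] stands for the atom at 0, [Some k] for the pole k. *)
pose rho0 o i : ('I_N -> R -> R[i]) -> R[i] :=
  if o is Some k then rho (i, k) else fun g => g i 0.
pose c o i := if o is Some k then b i k else a i.
have ok0 o i : regular_functional (rho0 o i).
  by case: o => [k|]; [have [] := hrho (i, k)|exact: regular_eval].
pose r := None :: map Some (index_enum I).
have ok1 i := regular_lincomb r (c^~ i) (ok0^~ i).
exists (fun g => \sum_i 1 * \sum_(o <- r) c o i * rho0 o i g); split.
  exact: (regular_lincomb _ (fun=> 1) ok1).
move=> j s s0; have Ds : D.[s] != 0 by exact: prod_denom_neq0.
rewrite ab// (bigD1 j)//= [X in _ + X]big1 ?addr0 ?mul1r.
  rewrite big_cons big_map /= /state_exp eqxx /exp_kernel normr0 mulr0 cexp0 mulr1.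
  congr (_ + _); apply: eq_bigr => k _; have [_ h] := hrho (j, k).
  by rewrite h// eqxx.
move=> i ij; rewrite mul1r big_cons big_map /= /state_exp (negbTE ij) mulr0 add0r.
rewrite big1// => k _; have [_ h] := hrho (i, k).
by rewrite -/(state_exp j s) h//= (negbTE ij) mulr0.
Qed.

End rational_functional.

(** * The coefficients of the limit transform *)

Section stationary_transform.
Context {R : realType} {N : nat}.
Variables (p : 'M[R]_N) (q : 'rV[R]_N).
Variables (mV : probability R R) (mS mA : 'I_N -> probability R R).
Variables (m : 'I_N -> nat) (t : forall i : 'I_N, 'I_(m i) -> R[i]).
Variable numer : 'I_N -> {poly R[i]}.
Hypothesis p_ge0 : forall i j, 0 <= p i j.
Hypothesis p_sum1 : forall i, \sum_j p i j = 1.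
Hypothesis q_stat : stationary_distribution p q.
Hypothesis t_lt0 : forall i (f : 'I_(m i)), complex.Re (t f) < 0.
Hypothesis service_transform : forall i (s : R[i]), 0 <= complex.Re s ->
  cintegral (mS i) setT (exp_kernel s) = (numer i).[s] / (denom t i).[s].
Hypothesis mV_lt0 : mV `]-oo, 0[%classic = 1%E.
Variable i0 : 'I_N.
Variable ell : ('I_N -> R -> R[i]) -> R[i].
Hypothesis ellP : forall g, tuple_bm g -> forall e : R, 0 < e ->
  exists n0, forall n, (n0 <= n)%N -> forall i w,
    normc (iter n (transition p mV mS mA) g i w - ell g) <= e.
Implicit Types (s z : R[i]) (i j : 'I_N).
Implicit Types rho : ('I_N -> R -> R[i]) -> R[i].

Local Notation K := (transition p mV mS mA).
Local Notation D := (\prod_k denom t k).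
Local Notation M := (total_degree m).
Local Notation L := (@node_basis R N m).
Implicit Types c : 'I_M.+1 -> 'I_N -> R[i].

Definition numer_poly c j : {poly R[i]} := \sum_(w < M.+1) c w j *: 'X^w.

Lemma size_numer_poly c j : (size (numer_poly c j) <= M.+1)%N.
Proof.
apply: (leq_trans (size_sum _ _ _)); apply/bigmax_leqP => w _.
by rewrite (leq_trans (size_scale_leq _ _))// size_polyXn.
Qed.

Lemma horner_numer_poly c j s :
  (numer_poly c j).[s] = \sum_(w < M.+1) c w j * s ^+ w.
Proof.
by rewrite horner_sum; apply: eq_bigr => w _; rewrite hornerZ hornerXn.
Qed.

Lemma coef_numer_poly c j (w : 'I_M.+1) : (numer_poly c j)`_w = c w j.
Proof.
rewrite coef_sum (bigD1 w)//= coefZ coefXn eqxx mulr1 big1 ?addr0// => k kw.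
by rewrite coefZ coefXn eq_sym (inj_eq val_inj) (negbTE kw) mulr0.
Qed.

Lemma numer_poly_coef (E : 'I_N -> {poly R[i]}) j : (size (E j) <= M.+1)%N ->
  numer_poly (fun w i => (E i)`_w) j = E j.
Proof.
move=> sE; rewrite /numer_poly -{2}[E j]coefK poly_def.
rewrite [RHS](big_ord_widen M.+1 (fun w => (E j)`_w *: 'X^w))// [RHS]big_mkcond /=.
apply: eq_bigr => w _; case: ltnP => // h.
by rewrite nth_default// scale0r.
Qed.

Lemma rational_partE c j s :
  rational_part t c j s = (numer_poly c j).[s] / D.[s].
Proof. by rewrite /rational_part horner_numer_poly horner_prod. Qed.

(** By construction it matches D times the transform of rho at the nodes; agreement on the whole
    half-plane comes from [regular_interpolation] once rho is a composite with K. *)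
Definition interpolant rho j : {poly R[i]} :=
  \sum_(k < M.+1) (D.[k%:R] * rho (state_exp j k%:R)) *: L k.

Lemma size_interpolant rho j : (size (interpolant rho j) <= M.+1)%N.
Proof.
apply: (leq_trans (size_sum _ _ _)); apply/bigmax_leqP => w _.
by rewrite (leq_trans (size_scale_leq _ _))// size_node_basis.
Qed.

Lemma horner_interpolant rho j s : (interpolant rho j).[s] =
  \sum_(k < M.+1) (L k).[s] * (D.[k%:R] * rho (state_exp j k%:R)).
Proof.
by rewrite horner_sum; apply: eq_bigr => w _; rewrite hornerZ mulrC.
Qed.

Lemma eq_poly_nodes (E F : {poly R[i]}) : (size E <= M.+1)%N ->
  (size F <= M.+1)%N -> (forall n : nat, E.[n%:R] = F.[n%:R]) -> E = F.
Proof.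
move=> sE sF EF; apply/eqP; rewrite -subr_eq0; apply/eqP.
apply: (@roots_geq_poly_eq0 _ _ [seq n%:R | n <- iota 0 M.+1]).
- by apply/allP => _ /mapP[n _ ->]; apply/eqP; rewrite hornerD hornerN EF subrr.
- by rewrite map_inj_uniq ?iota_uniq//; exact: mulrIn (oner_neq0 _).
- by rewrite size_map size_iota (leq_trans (size_polyD _ _))// geq_max size_polyN sE.
Qed.

Lemma state_exp0 j : state_exp j 0 = (fun i (_ : R) => (i == j)%:R : R[i]).
Proof.
apply/funext => i; apply/funext => w; rewrite /state_exp; case: eqP => // _.
by rewrite /exp_kernel oppr0 mul0r cexp0.
Qed.

Lemma stationary_sum j : \sum_i (q 0 i)%:C * (p i j)%:C = (q 0 j)%:C.
Proof.
have [_ _ qp] := q_stat; rewrite -[in RHS]qp mxE rmorph_sum.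
by apply: eq_bigr => i _; rewrite rmorphM.
Qed.

(** e_{j,0} depends on the state alone, and on such tuples the functional given by q and an atom at
    w = 0 is invariant under K. Its constant sequence of values q_j has to converge to
    ell(e_{j,0}). *)
Lemma ell_state_exp0 j : ell (state_exp j 0) = (q 0 j)%:C.
Proof.
pose rho (g : 'I_N -> R -> R[i]) : R[i] := \sum_i (q 0 i)%:C * g i 0.
have ok : regular_functional rho.
  exact: (regular_lincomb _ _ (fun i => regular_eval i 0)).
have rhoK n (a : 'I_N -> R[i]) :
    rho (iter n K (fun i _ => a i)) = \sum_i (q 0 i)%:C * a i.
  elim: n a => [//|n IH] a.
  rewrite iterSr (_ : K _ = fun i _ => \sum_j (p i j)%:C * a j); last first.
    by apply/funext => i; apply/funext => w; exact: transition_state.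
  rewrite IH; under eq_bigr do rewrite mulr_sumr.
  rewrite exchange_big /=; apply: eq_bigr => k _.
  by rewrite -stationary_sum mulr_suml; apply: eq_bigr => i _; rewrite mulrA.
have b0 : tuple_bm (@state_exp R N j 0) by exact: tuple_bm_state_exp.
have [q0 q1 _] := q_stat.
have := regular_tends ellP ok b0.
have -> : rho (fun _ _ => 1) = 1.
  rewrite (rhoK 0%N (fun=> 1)); under eq_bigr do rewrite mulr1.
  by rewrite -(rmorph_sum (real_complex R)) q1.
rewrite mulr1 state_exp0 => /tends_unique; apply.
under eq_fun do rewrite rhoK.
rewrite (bigD1 j)//= eqxx mulr1 big1 ?addr0; first exact: tends_cst.
by move=> i ij; rewrite (negbTE ij) mulr0.
Qed.

(** For y < 0 the point ty = -t|y| has positive real part, so the rational function may be replaced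
    there by the transform of rho; V < 0 almost surely then extends the integral to the whole
    line. *)
Lemma pole_mean rho c i k (f : 'I_(m k)) : regular_functional rho ->
  (forall s, 0 <= complex.Re s -> rho (state_exp i s) = rational_part t c i s) ->
  cintegral mV `]-oo, 0[%classic (fun y => rational_part t c i (t f * y%:C)) =
  cintegral mV setT (fun v => rho (state_exp i (- t f * `|v|%:C))).
Proof.
move=> ok rc; have h : 0 <= complex.Re (- t f) by rewrite ReN oppr_ge0 ltW// t_lt0.
apply: cintegral_full => //.
  exact: (regular_bm ok (family_bm_state_exp i h)).
move=> y; rewrite /= in_itv /= => y0; rewrite ltr0_norm// -rc; last first.
  by rewrite Re_mul_real mulr_le0 ?ltW ?t_lt0.
by congr (rho (state_exp i _)); rewrite rmorphN mulrNN.
Qed.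

(** [coefficient_system] regrouped by state, with the transforms of A taken under the probability
    laws on R that define K. *)
Definition pole_system c := forall j,
  c ord0 j = (q 0 j)%:C * D.[0] /\
  forall k (f : 'I_(m k)),
    cintegral (mA j) setT (exp_kernel (- t f)) *
      (\sum_i (p i j)%:C * (numer i).[t f] *
         (\prod_(nu | nu != i) (denom t nu).[t f]) *
         cintegral mV `]-oo, 0[%classic (fun y => rational_part t c i (t f * y%:C)))
    = (numer_poly c j).[t f].

Lemma numer_poly0 c j : (numer_poly c j).[0] = c ord0 j.
Proof. by rewrite horner_coef0 -[RHS]coef_numer_poly. Qed.

Definition stationary_coef (w : 'I_M.+1) j := (interpolant ell j)`_w.

(** The invariance ell = ell o K makes the interpolant exact on the whole of Re s >= 0. *)
Lemma rational_part_stationary_coef j s : 0 <= complex.Re s ->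
  rational_part t stationary_coef j s = ell (state_exp j s).
Proof.
move=> s0; have Ds := prod_denom_neq0 t_lt0 s0.
apply: (mulfI Ds); rewrite rational_partE numer_poly_coef ?size_interpolant//.
rewrite mulrCA divff// mulr1 horner_interpolant.
have ok := regular_ell p_ge0 p_sum1 i0 ellP.
have ellK z : 0 <= complex.Re z -> ell (K (state_exp j z)) = ell (state_exp j z).
  by move=> z0; apply: (ell_transition i0 ellP); exact: tuple_bm_state_exp.
rewrite -ellK// (regular_interpolation p mV mA t_lt0 service_transform j ok s0).
by apply: eq_bigr => k _; rewrite ellK//; exact: natc_ge0.
Qed.

(** The numerator is evaluated at a pole in two ways: as the interpolant of ell, and by
    [regular_interpolation_pole] for ell o K. *)
Lemma pole_system_stationary_coef : pole_system stationary_coef.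
Proof.
have ok := regular_ell p_ge0 p_sum1 i0 ellP.
move=> j; split=> [|k f].
  rewrite -numer_poly0 -ell_state_exp0 -rational_part_stationary_coef//.
  by rewrite rational_partE divfK// prod_denom_neq0.
rewrite numer_poly_coef ?size_interpolant// horner_interpolant.
transitivity (\sum_(l < M.+1) (L l).[t f] * (D.[l%:R] * ell (K (state_exp j l%:R)))).
  rewrite (regular_interpolation_pole p mV mA t_lt0 service_transform)//.
  congr (_ * _); apply: eq_bigr => i _; congr (_ * _); apply: pole_mean => // s s0.
  by rewrite rational_part_stationary_coef.
apply: eq_bigr => l _; rewrite (ell_transition i0 ellP)//.
exact/tuple_bm_state_exp/natc_ge0.
Qed.

(* The numerator of rho o K agrees with that of rho at 0, by stationarity of q,
   and at the M distinct poles, by the linear system; both have degree at most M. *)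
Lemma rational_invariant rho c : distinct_poles t -> regular_functional rho ->
  pole_system c ->
  (forall j s, 0 <= complex.Re s -> rho (state_exp j s) = rational_part t c j s) ->
  forall j s, 0 <= complex.Re s -> rho (K (state_exp j s)) = rational_part t c j s.
Proof.
move=> t_inj ok sys rc j s s0; have Ds := prod_denom_neq0 t_lt0 s0.
apply: (mulfI Ds); rewrite rational_partE mulrCA divff// mulr1.
rewrite (regular_interpolation p mV mA t_lt0 service_transform j ok s0).
rewrite -(horner_interpolant (fun g => rho (K g))); congr horner.
apply/eqP; rewrite -subr_eq0; apply/eqP.
pose I := {k : 'I_N & 'I_(m k)}; pose tau (k : I) := t (tagged k).
apply: (@roots_geq_poly_eq0 _ _ (0 :: map tau (enum {: I}))).
- rewrite /= rootE hornerD hornerN subr_eq0; apply/andP; split.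
    rewrite horner_interpolant.
    have re0 : 0 <= complex.Re (0 : R[i]) by [].
    rewrite -(regular_interpolation p mV mA t_lt0 service_transform j ok re0).
    have -> : K (state_exp j 0) = fun i _ => \sum_l (p i l)%:C * (l == j)%:R.
      by rewrite state_exp0; apply/funext => i; apply/funext => w; exact: transition_state.
    (* K e_{j,0} is column j of p, a combination of the e_{l,0}, on which rho takes the values
       q_l. *)
    have -> : (fun (i : 'I_N) (_ : R) => \sum_l (p i l)%:C * (l == j)%:R : R[i]) =
        (fun i w => \sum_l (p l j)%:C * state_exp l 0 i w).
      apply/funext => i; apply/funext => w; rewrite (bigD1 j)//= eqxx mulr1 big1 ?addr0.
        rewrite [RHS](bigD1 i)//= state_exp0 eqxx mulr1 [X in _ + X]big1 ?addr0// => l li.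
        by rewrite state_exp0 eq_sym (negbTE li) mulr0.
      by move=> l lj; rewrite (negbTE lj) mulr0.
    have b0 l : tuple_bm (@state_exp R N l 0) by exact: tuple_bm_state_exp.
    rewrite (regular_sum _ ok) => [|l]; last exact: tuple_bmZ.
    have rho0 l : rho (state_exp l 0) = (q 0 l)%:C.
      have [h _] := sys l; rewrite rc// rational_partE numer_poly0 h mulfK//.
      exact: prod_denom_neq0.
    have [h _] := sys j; rewrite numer_poly0 h -stationary_sum mulrC; apply/eqP.
    congr (_ * _); apply: eq_bigr => l _.
    by rewrite (regularZ ok (p l j)%:C (b0 l)) rho0 mulrC.
  apply/allP => _ /mapP[[k f] _ ->]; rewrite rootE hornerD hornerN subr_eq0.
  rewrite horner_interpolant /tau /=.
  rewrite (regular_interpolation_pole p mV mA t_lt0 service_transform)//.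
  have [_ <-] := sys j; apply/eqP; congr (_ * _).
  by apply: eq_bigr => i _; congr (_ * _); rewrite (pole_mean f ok (rc i)).
- rewrite /= map_inj_uniq// enum_uniq andbT; apply/mapP => -[k _ k0].
  by have := t_lt0 (tagged k); rewrite -/(tau k) -k0 ltxx.
- rewrite /= size_map -cardE card_poles (leq_trans (size_polyD _ _))// geq_max size_polyN.
  by rewrite size_interpolant size_numer_poly.
Qed.

(** By [rational_invariant] the sequence rho(K^n e_{j,s}) is constant, while it tends to
    ell(e_{j,s}) rho(1). The equations for c_{0,j} give rho(1) = 1, the sum of the q_j. *)
Lemma pole_system_ell c : distinct_poles t -> pole_system c ->
  forall j s, 0 <= complex.Re s -> rational_part t c j s = ell (state_exp j s).
Proof.
move=> t_inj sys j s s0.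
have [rho [ok rhoE]] := rational_functional t_lt0 t_inj (size_numer_poly c).
have rc n i z : 0 <= complex.Re z ->
    rho (iter n K (state_exp i z)) = rational_part t c i z.
  elim: n i z => [|n IH] i z z0; first by rewrite rhoE// rational_partE.
  rewrite iterSr; have okn := regular_iter mV mS mA p_ge0 p_sum1 n ok.
  exact: (rational_invariant t_inj okn sys IH).
have rho1 : rho (fun _ _ => 1) = 1.
  have b0 l : tuple_bm (@state_exp R N l 0) by exact: tuple_bm_state_exp.
  have -> : (fun _ _ => 1) = (fun i w => \sum_l @state_exp R N l 0 i w).
    apply/funext => i; apply/funext => w; rewrite (bigD1 i)//= state_exp0 eqxx.
    by rewrite big1 ?addr0// => l li; rewrite state_exp0 eq_sym (negbTE li).
  rewrite (regular_sum _ ok)//; have [_ q1 _] := q_stat.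
  rewrite -[RHS](congr1 (real_complex R) q1) (rmorph_sum (real_complex R)).
  apply: eq_bigr => l _; have [h _] := sys l.
  rewrite (rc 0%N)// rational_partE numer_poly0 h mulfK//.
  exact: prod_denom_neq0.
have := regular_tends ellP ok (tuple_bm_state_exp j s0).
rewrite rho1 mulr1 => /tends_unique hu; apply/esym/hu.
by under eq_fun do rewrite rc//; exact: tends_cst.
Qed.

(** Both rational functions take the values of ell at every natural number, so their numerators, of
    degree at most M, coincide. *)
Lemma pole_system_unique c : distinct_poles t -> pole_system c ->
  forall w j, c w j = stationary_coef w j.
Proof.
move=> t_inj sys w j; rewrite -coef_numer_poly.
suff -> : numer_poly c j = interpolant ell j by [].
apply: eq_poly_nodes; rewrite ?size_numer_poly ?size_interpolant// => n.
have n0 : 0 <= complex.Re (n%:R : R[i]) by exact: natc_ge0.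
have Dn : D.[n%:R]^-1 != 0 by rewrite invr_neq0// prod_denom_neq0.
have := pole_system_ell t_inj sys j n0.
rewrite -rational_part_stationary_coef// !rational_partE => /(mulIf Dn) ->.
by rewrite numer_poly_coef// size_interpolant.
Qed.

End stationary_transform.

Theorem mainTheorem2 (R : realType) (d : measure_display)
    (T : measurableType d) (P : probability T R) (N : nat)
    (p : 'M[R]_N) (q : 'rV[R]_N)
    (Z : nat -> T -> 'I_N) (W V S A : nat -> {RV P >-> R})
    (FS GA : 'I_N -> cumulativeBounded (0 : R) (1 : R))
    (m : 'I_N -> nat) (t : forall i : 'I_N, 'I_(m i) -> R[i])
    (numer : 'I_N -> {poly R[i]}) :
  transition_matrix p -> irreducible_chain p -> aperiodic_chain p ->
  stationary_distribution p q ->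
  (forall n i, measurable [set w | Z n w = i]) ->
  (forall n w, 0 <= W n w) ->
  (forall n w, 0 <= S n w) ->
  (forall n w, 0 <= A n.+1 w) ->
  (forall n w, W n.+1 w = Num.max (V n w * W n w + S n w - A n.+1 w) 0) ->
  iid V ->
  (forall n, {ae P, forall w, V n w < 0}) ->
  (forall n, indep_classes P (events (V n)) (environment Z W S A n)) ->
  (forall n, P.-integrable setT (fun w => (V n w)%:E)) ->
  (forall n, P.-integrable setT (fun w => (S n w - A n.+1 w)%:E)) ->
  (forall i x, x < 0 -> FS i x = 0) ->
  (forall j x, x < 0 -> GA j x = 0) ->
  modulated_law Z W S A p FS GA ->
  stability Z S A ->
  (forall i (f : 'I_(m i)), complex.Re (t i f) < 0) ->
  (forall i (s : R[i]), 0 <= complex.Re s ->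
     LST (FS i) s = (numer i).[s] / (denom t i).[s]) ->
  exists c : 'I_(total_degree m).+1 -> 'I_N -> R[i],
    [/\ coefficient_system t p q numer GA (distribution P (V 0%N)) c,
        (forall (j : 'I_N) (s : R[i]), 0 <= complex.Re s ->
           (lst_sequence Z W j s n : R[i]^o) @[n --> \oo] -->
             (rational_part t c j s : R[i]^o)) &
        (distinct_poles t ->
           forall c' : 'I_(total_degree m).+1 -> 'I_N -> R[i],
             coefficient_system t p q numer GA (distribution P (V 0%N)) c' ->
             forall w j, c' w j = c w j)].
Proof.
move=> [p_ge0 p_sum1] irr aper q_stat mZ W_ge0 S_ge0 A_ge0 W_rec V_iid V_lt0
  V_indep _ _ FS0 GA0 law stable t_lt0 LST_FS.
have [i0 [l0 [p_i0l0 idle]]] :=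
  stability_idle p_ge0 mZ S_ge0 A_ge0 V_iid V_indep FS0 GA0 law stable.
pose mS i := stieltjes_prob (FS i); pose mA j := stieltjes_prob (GA j).
pose K := transition p (distribution P (V 0%N)) mS mA.
(* Choice makes ell a total function; its values outside bounded measurable tuples are
   unconstrained. *)
have /choice[ell ellP] : forall g, exists l : R[i], tuple_bm g ->
    forall e : R, 0 < e -> exists n0, forall n, (n0 <= n)%N -> forall i w,
      normc (iter n K g i w - l) <= e.
  move=> g; have [bg|nbg] := pselect (tuple_bm g); last by exists 0.
  have [l hl] := @iter_converges R N p (distribution P (V 0%N)) mS mA p_ge0 p_sum1 irr aper _ _
    p_i0l0 idle _ bg.
  by exists l.
have mV_lt0 := distribution_lt0 (V_lt0 0%N).
have service_transform i (s : R[i]) : 0 <= complex.Re s ->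
    cintegral (mS i) setT (exp_kernel s) = (numer i).[s] / (denom t i).[s].
  by move=> s0; rewrite -LST_FS// LST_stieltjes_prob//; exact: FS0.
have systemE c : coefficient_system t p q numer GA (distribution P (V 0%N)) c <->
    pole_system p q (distribution P (V 0%N)) mA t numer c.
  have LST_GA j k (f : 'I_(m k)) : LST (GA j) (- t k f) =
      cintegral (mA j) setT (exp_kernel (- t k f)).
    rewrite LST_stieltjes_prob //; first exact: GA0.
    by rewrite ReN oppr_ge0 ltW.
  split=> [[c0 cf] j|sys]; split=> [|k f].
  - by rewrite c0 horner_prod.
  - by rewrite horner_numer_poly -cf LST_GA.
  - by move=> j; have [-> _] := sys j; rewrite horner_prod.
  - by move=> j; have [_ h] := sys j; rewrite -horner_numer_poly -h LST_GA.
exists (stationary_coef t ell); split.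
- apply/systemE.
  exact: (pole_system_stationary_coef p_ge0 p_sum1 q_stat t_lt0 service_transform mV_lt0 i0 ellP).
- move=> j s s0.
  rewrite (rational_part_stationary_coef p_ge0 p_sum1 t_lt0 service_transform i0 ellP)//.
  apply: cvg_complex.
  have bW n i : cbounded_measurable (fun w => @state_exp R N j s i (W n w)).
    exact: (cbounded_measurable_comp (tuple_bm_state_exp j s0 i) (measurable_funPT (W n))).
  (* The initial law of (Z_0, W_0) as a functional, with an explicit weight 1 to fit [regular_atom].
     The transform at time n is then rho(K^n e_{j,s}), whose limit is the same for every initial
     law. *)
  pose rho (g : 'I_N -> R -> R[i]) := cintegral P setT (fun w => 1 * g (Z 0%N w) (W 0%N w)).
  have ok : regular_functional rho.
    by apply: regular_atom => //; exact: cbounded_measurable_cst.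
  have lstE n : lst_sequence Z W j s n = rho (iter n K (state_exp j s)).
    rewrite /lst_sequence /rho.
    transitivity (cintegral P setT (fun w => state_exp j s (Z n w) (W n w))).
      apply: eq_cintegral => w _; rewrite /state_exp /exp_kernel ger0_norm//.
      by case: eqP; rewrite ?mulr1 ?mulr0.
    under [RHS]eq_cintegral do rewrite mul1r.
    have : tuple_bm (@state_exp R N j s) by exact: tuple_bm_state_exp.
    elim: n (state_exp j s) => [//|n IH] g bg.
    rewrite iterSr -IH; last exact: tuple_bm_transition.
    exact: (transition_step p_ge0 mZ W_ge0 S_ge0 A_ge0 W_rec V_iid V_lt0 V_indep FS0 GA0 law).
  have rho1 : rho (fun _ _ => 1) = 1.
    rewrite /rho; under eq_cintegral do rewrite mul1r.
    exact: cintegral_prob_cst.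
  have := regular_tends ellP ok (tuple_bm_state_exp j s0); rewrite rho1 mulr1.
  by under eq_fun do rewrite -lstE.
- move=> t_inj c /systemE sys w j.
  exact: (pole_system_unique p_ge0 p_sum1 q_stat t_lt0 service_transform mV_lt0 i0 ellP).
Qed.
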